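(* Let $G$ be an abelian group and $\mathbb{F}$ a field. (1) If $\mathcal{B}$ is a $G$-graded-central-simple algebra over $\mathbb{F}$, then there exist a subgroup $H$ of $G$, an algebra $\mathcal{A}$ graded by $\overline{G}=G/H$ which is central simple as an ungraded algebra, and $\tau\in\mathrm{Z}^2_{\mathrm{sym}}(G,\mathbb{F}^\times)$ such that $\mathcal{B}\simeq_G L^\tau_\pi(\mathcal{A})$, where $\pi:G\to\overline{G}$ is the canonical projection. (2) Conversely, if $H\le G$, $\mathcal{A}$ is a central simple $\overline{G}=G/H$-graded algebra and $\tau\in\mathrm{Z}^2_{\mathrm{sym}}(G,\mathbb{F}^\times)$, then $L^\tau_\pi(\mathcal{A})$ is $G$-graded-central-simple and $C(L^\tau_\pi(\mathcal{A}))\simeq_G\mathbb{F}^{\tau'}H$, where $\tau'=\tau|_{H\times H}$. (3) For $i=1,2$ let $H_i\le G$, $\pi_i:G\to G/H_i$ the canonical projection, $\mathcal{A}_i$ a central simple $G/H_i$-graded algebra, and $\tau_i\in\mathrm{Z}^2_{\mathrm{sym}}(G,\mathbb{F}^\times)$. Then $L^{\tau_1}_{\pi_1}(\mathcal{A}_1)\simeq_G L^{\tau_2}_{\pi_2}(\mathcal{A}_2)$ if and only if $H_1=H_2=:H$ (so $\pi_1=\pi_2=:\pi:G\to\overline{G}=G/H$) and there exists $\mu\in\mathrm{Z}^2_{\mathrm{sym}}(\overline{G},\mathbb{F}^\times)$ such that $[\tau_1]=\pi^*([\mu])[\tau_2]$ in $\mathrm{H}^2_{\mathrm{sym}}(G,\mathbb{F}^\times)$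 and $\mathcal{A}_1^\mu\simeq_{\overline{G}}\mathcal{A}_2$.
   Context: Algebras are arbitrary (nonassociative, possibly infinite-dimensional) algebras over $\mathbb{F}$. A $G$-grading is a decomposition $\mathcal{A}=\bigoplus_g\mathcal{A}_g$ with $\mathcal{A}_g\mathcal{A}_h\subseteq\mathcal{A}_{gh}$; $\simeq_G$ denotes graded isomorphism. Centroid: $C(\mathcal{A})=\{c\in\mathrm{End}_{\mathbb{F}}(\mathcal{A})\mid c(xy)=c(x)y=xc(y)\}$, $C(\mathcal{A})_g=\{c\in C(\mathcal{A}): c\mathcal{A}_{g'}\subseteq\mathcal{A}_{gg'}\ \forall g'\}$. An algebra is central simple if it is simple and its centroid is $\mathbb{F}1$. A $G$-graded algebra is graded-simple if $\mathcal{A}^2=\mathcal{A}$ and there are no proper nonzero graded ideals, graded-central if $C(\mathcal{A})_e=\mathbb{F}1$, graded-central-simple if both; for such algebras $C(\mathcal{A})=\bigoplus_gC(\mathcal{A})_g$ is $G$-graded. Symmetric $2$-cocycles $\mathrm{Z}^2_{\mathrm{sym}}(A,\mathbb{F}^\times)$: maps $\tau:A\times A\to\mathbb{F}^\times$ with $\tau(a_1,a_2)\tau(a_1a_2,a_3)=\tau(a_1,a_2a_3)\tau(a_2,a_3)$ and $\tau(a_1,a_2)=\tau(a_2,a_1)$; coboundaries $\mathrm{d}\gamma(a_1,a_2)=\gamma(a_1)\gamma(a_2)\gamma(a_1a_2)^{-1}$; $\mathrm{H}^2_{\mathrm{sym}}=\mathrm{Z}^2_{\mathrm{sym}}/\mathrm{B}^2$.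 For $\pi:G\to\overline{G}$, $\pi^*:\mathrm{H}^2_{\mathrm{sym}}(\overline{G},\mathbb{F}^\times)\to\mathrm{H}^2_{\mathrm{sym}}(G,\mathbb{F}^\times)$, $[\mu]\mapsto[\mu\circ(\pi\times\pi)]$. The $\tau$-twist $\mathcal{A}^\tau$ of a graded algebra is the same graded space with multiplication $x*y=\tau(g_1,g_2)xy$ for $x\in\mathcal{A}_{g_1},y\in\mathcal{A}_{g_2}$. The twisted group algebra $\mathbb{F}^{\tau'}H$ is the $\tau'$-twist of the group algebra $\mathbb{F}H$ with its natural grading (viewed as $G$-graded with support $H$). For $H\le G$, $\pi:G\to\overline{G}=G/H$, $g\mapsto\bar g$, and a $\overline{G}$-graded algebra $\mathcal{A}$, the loop algebra is the $G$-graded subalgebra $L_\pi(\mathcal{A})=\bigoplus_{g\in G}\mathcal{A}_{\bar g}\otimes g$ of $\mathcal{A}\otimes_{\mathbb{F}}\mathbb{F}G$ (degree of $\mathcal{A}_{\bar g}\otimes g$ is $g$), and $L^\tau_\pi(\mathcal{A}):=(L_\pi(\mathcal{A}))^\tau$ for $\tau\in\mathrm{Z}^2_{\mathrm{sym}}(G,\mathbb{F}^\times)$. *)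

(* Defs.v *)
From HB Require Import structures.
From mathcomp Require Import all_boot all_order all_algebra.
From Stdlib Require Import IndefiniteDescription ClassicalDescription FunctionalExtensionality PropExtensionality.
Set Implicit Arguments. Unset Strict Implicit. Unset Printing Implicit Defensive.
Import GRing.Theory.
Local Open Scope ring_scope.

Definition asbool (P : Prop) : bool :=
  if excluded_middle_informative P then true else false.
Lemma asboolP (P : Prop) : reflect P (asbool P).
Proof. rewrite /asbool; case: excluded_middle_informative => h; by constructor. Qed.

Section ClassicalChoice.
Variable T : Type.
Definition cfind (P : pred T) (n : nat) : option T :=
  match excluded_middle_informative (exists x, P x) with
  | left h => Some (proj1_sig (constructive_indefinite_description _ h))
  | right _ => None end.
Lemma cfind_correct P n x : cfind P n = Some x -> P x.
Proof.
rewrite /cfind; case: excluded_middle_informative => // h [<-].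
by case: constructive_indefinite_description.
Qed.
Lemma cfind_complete (P : pred T) : (exists x, P x) -> exists n, cfind P n.
Proof. by move=> h; exists 0%N; rewrite /cfind; case: excluded_middle_informative. Qed.
Lemma cfind_ext (P Q : pred T) : P =1 Q -> cfind P =1 cfind Q.
Proof. by move=> /functional_extensionality ->. Qed.
End ClassicalChoice.

Section FunSpace.
Variables (R : pzRingType) (T : Type) (V : lmodType R).
Definition funT := T -> V.
Lemma funT_eqP : Equality.axiom (fun f g : funT => asbool (f = g)).
Proof. by move=> f g; apply: (iffP (asboolP _)). Qed.
HB.instance Definition _ := hasDecEq.Build funT funT_eqP.
HB.instance Definition _ := hasChoice.Build funT
  (@cfind_correct funT) (@cfind_complete funT) (@cfind_ext funT).
Definition fzero : funT := fun _ => 0.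
Definition fopp (f : funT) : funT := fun x => - f x.
Definition fadd (f g : funT) : funT := fun x => f x + g x.
Definition fscale (a : R) (f : funT) : funT := fun x => a *: f x.
Lemma faddA : associative fadd.
Proof. by move=> f g h; apply: functional_extensionality => x; rewrite /fadd addrA. Qed.
Lemma faddC : commutative fadd.
Proof. by move=> f g; apply: functional_extensionality => x; rewrite /fadd addrC. Qed.
Lemma fadd0 : left_id fzero fadd.
Proof. by move=> f; apply: functional_extensionality => x; rewrite /fadd add0r. Qed.
Lemma faddN : left_inverse fzero fopp fadd.
Proof. by move=> f; apply: functional_extensionality => x; rewrite /fadd /fopp addNr. Qed.
HB.instance Definition _ := GRing.isZmodule.Build funT faddA faddC fadd0 faddN.
Lemma fscaleA a b (f : funT) : fscale a (fscale b f) = fscale (a * b) f.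
Proof. by apply: functional_extensionality => x; rewrite /fscale scalerA. Qed.
Lemma fscale1 : left_id 1 fscale.
Proof. by move=> f; apply: functional_extensionality => x; rewrite /fscale scale1r. Qed.
Lemma fscaleDr : right_distributive fscale +%R.
Proof. by move=> a f g; apply: functional_extensionality => x; rewrite /fscale /= /fadd scalerDr. Qed.
Lemma fscaleDl (f : funT) : {morph fscale^~ f : a b / a + b}.
Proof. by move=> a b; apply: functional_extensionality => x; rewrite /fscale /= /fadd scalerDl. Qed.
HB.instance Definition _ := GRing.Zmodule_isLmodule.Build R funT fscaleA fscale1 fscaleDr fscaleDl.
End FunSpace.

Section Span.
Variables (F : fieldType) (V : lmodType F) (P : pred V).
Definition inspan (v : V) : Prop :=
  forall Q : pred V, 0 \in Q -> (forall a x y, x \in Q -> y \in Q -> a *: x + y \in Q) ->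
    {subset P <= Q} -> v \in Q.
Definition spanP : pred V := fun v => asbool (inspan v).
Lemma spanP_closed : subsemimod_closed spanP.
Proof.
have h0 : 0 \in spanP by rewrite unfold_in; apply/asboolP => Q.
have hl a x y : x \in spanP -> y \in spanP -> a *: x + y \in spanP.
  rewrite !unfold_in => /asboolP hx /asboolP hy; apply/asboolP => Q Q0 QL QP.
  by apply: (QL); [exact: (hx Q Q0 QL QP) | exact: (hy Q Q0 QL QP)].
split; [split=> // x y hx hy|].
  by rewrite -(scale1r x); apply: hl.
by move=> a x hx; rewrite -(addr0 (a *: x)); apply: hl.
Qed.
HB.instance Definition _ := GRing.isSubmodClosed.Build F V spanP spanP_closed.
Record spanT := SpanT { sp_val : V; sp_valP : sp_val \in spanP }.
HB.instance Definition _ := [isSub for sp_val].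
HB.instance Definition _ := [Choice of spanT by <:].
HB.instance Definition _ := [SubChoice_isSubLmodule of spanT by <:].
End Span.


Record subgrp (G : zmodType) := SubGrp {
  sg_pred : pred G;
  sg0 : 0 \in sg_pred;
  sgB : forall x y, x \in sg_pred -> y \in sg_pred -> x - y \in sg_pred }.

(* the quotient group G/H, elements are chosen coset representatives *)
Section Quotient.
Variables (G : zmodType) (H : subgrp G).
Local Notation Hp := (sg_pred H).
Lemma sgN x : x \in Hp -> - x \in Hp.
Proof. by move=> hx; rewrite -sub0r; apply: sgB => //; apply: sg0. Qed.
Lemma sgD x y : x \in Hp -> y \in Hp -> x + y \in Hp.
Proof. by move=> hx hy; rewrite -(opprK y); apply: sgB => //; apply: sgN. Qed.
Lemma qrep_ex x : exists y, x - y \in Hp.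
Proof. by exists x; rewrite subrr sg0. Qed.
Definition qrep (x : G) : G := xchoose (qrep_ex x).
Lemma qrepP x : x - qrep x \in Hp.
Proof. exact: (xchooseP (qrep_ex x)). Qed.
Lemma qrep_eq x y : x - y \in Hp -> qrep x = qrep y.
Proof.
move=> hxy; apply: eq_xchoose => z; apply/idP/idP => h.
  have -> : y - z = (x - z) - (x - y) by rewrite [RHS]addrC opprB addrA subrK.
  exact: sgB.
have -> : x - z = (x - y) + (y - z) by rewrite addrA subrK.
exact: sgD.
Qed.
Lemma qrepK x : qrep (qrep x) = qrep x.
Proof. by apply: qrep_eq; rewrite -opprB; apply: sgN; apply: qrepP. Qed.
Record quot := Quot { q_val : G; q_valP : qrep q_val == q_val }.
HB.instance Definition _ := [isSub for q_val].
HB.instance Definition _ := [Choice of quot by <:].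
Definition qproj (x : G) : quot := @Quot (qrep x) (introT eqP (qrepK x)).
Lemma qproj_val (a : quot) : qproj (q_val a) = a.
Proof. by case: a => v hv; apply: val_inj => /=; apply/eqP. Qed.
Lemma qproj_eq x y : x - y \in Hp -> qproj x = qproj y.
Proof. by move=> h; apply: val_inj => /=; apply: qrep_eq. Qed.
Lemma qprojDl x y : qproj (qrep x + y) = qproj (x + y).
Proof.
apply: qproj_eq; rewrite opprD addrACA subrr addr0 -opprB.
by apply: sgN; apply: qrepP.
Qed.
Definition qzero : quot := qproj 0.
Definition qopp (a : quot) : quot := qproj (- q_val a).
Definition qadd (a b : quot) : quot := qproj (q_val a + q_val b).
Lemma qaddA : associative qadd.
Proof.
move=> a b c; rewrite /qadd /= qprojDl [q_val a + _]addrC qprojDl.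
by rewrite addrC addrA.
Qed.
Lemma qaddC : commutative qadd.
Proof. by move=> a b; rewrite /qadd addrC. Qed.
Lemma qadd0 : left_id qzero qadd.
Proof. by move=> a; rewrite /qadd /= qprojDl add0r qproj_val. Qed.
Lemma qaddN : left_inverse qzero qopp qadd.
Proof. by move=> a; rewrite /qadd /= qprojDl addNr. Qed.
HB.instance Definition _ := GRing.isZmodule.Build quot qaddA qaddC qadd0 qaddN.
End Quotient.

(* Graded (nonassociative, possibly infinite-dimensional) algebras.         *)
(* A G-graded algebra is given by its underlying F-vector space, its        *)
(* product, and the family (A_g)_g of homogeneous components; the algebra   *)
(* axioms (bilinearity, A = (+)_g A_g, A_g A_h <= A_{g+h}) are is_galg.     *)
(* Groups are abelian and written additively (e = 0, gh = g + h).          *)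
Record galg (F : fieldType) (G : Type) := GAlg {
  gcar : lmodType F;
  gmul : gcar -> gcar -> gcar;
  gcomp : G -> pred gcar }.
Arguments gcar {F G} g : rename.
Arguments gmul {F G} g _ _ : rename.
Arguments gcomp {F G} g _ : rename.

Section GradedNotions.
Local Unset Implicit Arguments.
Context {F : fieldType} {G : zmodType}.

Definition subspace {V : lmodType F} (P : pred V) : Prop :=
  0 \in P /\ forall a x y, x \in P -> y \in P -> a *: x + y \in P.

Definition bilinear_mul (A : galg F G) : Prop :=
  (forall a x y z, gmul A (a *: x + y) z = a *: gmul A x z + gmul A y z) /\
  (forall a x y z, gmul A z (a *: x + y) = a *: gmul A z x + gmul A z y).

Definition is_grading (A : galg F G) : Prop :=
  (forall g, subspace (gcomp A g)) /\
  (forall x : gcar A, exists (s : seq G) (f : G -> gcar A),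
      (forall g, f g \in gcomp A g) /\ x = \sum_(g <- s) f g) /\
  (forall (s : seq G) (f : G -> gcar A), uniq s -> (forall g, f g \in gcomp A g) ->
      \sum_(g <- s) f g = 0 -> forall g, g \in s -> f g = 0) /\
  (forall g h x y, x \in gcomp A g -> y \in gcomp A h -> gmul A x y \in gcomp A (g + h)).

Definition is_galg (A : galg F G) : Prop := bilinear_mul A /\ is_grading A.

Definition is_ideal (A : galg F G) (I : pred (gcar A)) : Prop :=
  subspace I /\ forall x y, x \in I -> gmul A x y \in I /\ gmul A y x \in I.
Definition is_graded_subspace (A : galg F G) (I : pred (gcar A)) : Prop :=
  forall x, x \in I -> exists (s : seq G) (f : G -> gcar A),
    (forall g, f g \in gcomp A g /\ f g \in I) /\ x = \sum_(g <- s) f g.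

Definition sq_full (A : galg F G) : Prop :=
  forall x : gcar A, exists s : seq (F * gcar A * gcar A),
    x = \sum_(p <- s) p.1.1 *: gmul A p.1.2 p.2.
Definition nonzero (A : galg F G) : Prop := exists x : gcar A, x != 0.

Definition simple (A : galg F G) : Prop :=
  nonzero A /\ sq_full A /\
  forall I : pred (gcar A), is_ideal A I -> (forall x, x \in I -> x = 0) \/ (forall x, x \in I).
Definition graded_simple (A : galg F G) : Prop :=
  nonzero A /\ sq_full A /\
  forall I : pred (gcar A), is_ideal A I -> is_graded_subspace A I ->
    (forall x, x \in I -> x = 0) \/ (forall x, x \in I).

Definition is_centroid (A : galg F G) (c : gcar A -> gcar A) : Prop :=
  (forall a x y, c (a *: x + y) = a *: c x + c y) /\
  (forall x y, c (gmul A x y) = gmul A (c x) y /\ c (gmul A x y) = gmul A x (c y)).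
Definition centroid_deg (A : galg F G) (g : G) (c : gcar A -> gcar A) : Prop :=
  forall g' x, x \in gcomp A g' -> c x \in gcomp A (g + g').

Definition central (A : galg F G) : Prop :=
  forall c : gcar A -> gcar A, is_centroid A c -> exists a : F, forall x, c x = a *: x.
Definition graded_central (A : galg F G) : Prop :=
  forall c : gcar A -> gcar A, is_centroid A c -> centroid_deg A 0 c -> exists a : F, forall x, c x = a *: x.

Definition central_simple (A : galg F G) : Prop := simple A /\ central A.
Definition graded_central_simple (A : galg F G) : Prop :=
  graded_simple A /\ graded_central A.

Definition giso (A B : galg F G) : Prop :=
  exists phi : gcar A -> gcar B,
    (forall a x y, phi (a *: x + y) = a *: phi x + phi y) /\ bijective phi /\
    (forall x y, phi (gmul A x y) = gmul B (phi x) (phi y)) /\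
    (forall g x, x \in gcomp A g -> phi x \in gcomp B g) /\
    (forall g y, y \in gcomp B g -> exists2 x, x \in gcomp A g & phi x = y).

Definition sym2cocycle (t : G -> G -> F) : Prop :=
  (forall a b, t a b != 0) /\
  (forall a b c, t a b * t (a + b) c = t a (b + c) * t b c) /\
  (forall a b, t a b = t b a).
Definition cohomologous (t1 t2 : G -> G -> F) : Prop :=
  exists gam : G -> F, (forall a, gam a != 0) /\
    forall a b, t1 a b = t2 a b * (gam a * gam b / gam (a + b)).

(* the tau-twist A^tau: x * y = tau(g1,g2) xy on homogeneous elements, *)
(* extended bilinearly via (a chosen) homogeneous decomposition         *)
Definition gdec {A : galg F G} (x : gcar A) : seq G * (G -> gcar A) :=
  match excluded_middle_informative
    (exists p : seq G * (G -> gcar A), uniq p.1 /\ (forall g, p.2 g \in gcomp A g) /\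
        x = \sum_(g <- p.1) p.2 g) with
  | left h => proj1_sig (constructive_indefinite_description _ h)
  | right _ => ([::], fun _ => 0) end.
Definition twist (A : galg F G) (t : G -> G -> F) : galg F G :=
  @GAlg F G (gcar A)
    (fun x y => \sum_(g <- (gdec x).1) \sum_(h <- (gdec y).1)
                  t g h *: gmul A ((gdec x).2 g) ((gdec y).2 h))
    (gcomp A).

(* finitely supported functions G -> V model V (x) FG *)
Definition fsupp {V : lmodType F} (f : G -> V) : seq G :=
  match excluded_middle_informative (exists s : seq G, forall g, f g != 0 -> g \in s) with
  | left h => undup (proj1_sig (constructive_indefinite_description _ h))
  | right _ => [::] end.
Definition fdelta {V : lmodType F} (g : G) (v : V) : funT G V :=
  fun k => if k == g then v else 0.
Definition conv {V : lmodType F} (m : V -> V -> V) (f f' : funT G V) : funT G V :=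
  fun k => \sum_(g <- fsupp f) \sum_(h <- fsupp f')
             (if g + h == k then m (f g) (f' h) else 0).

(* loop algebra L_pi(A) = (+)_g A_{pi g} (x) g  inside  A (x) FG *)
Section Loop.
Context {Gb : zmodType}.
Variables (pi : G -> Gb) (A : galg F Gb).
Definition loop_gen : pred (funT G (gcar A)) :=
  fun f => asbool (exists g v, v \in gcomp A (pi g) /\ f = fdelta g v).
Definition loop_car : lmodType F := spanT loop_gen.
Definition loop_mul (x y : loop_car) : loop_car :=
  insubd 0 (conv (gmul A) (sp_val x) (sp_val y)).
Definition loop_comp (g : G) : pred loop_car :=
  fun x => asbool ((forall k, k != g -> sp_val x k = 0) /\ sp_val x g \in gcomp A (pi g)).
Definition loop : galg F G := @GAlg F G loop_car loop_mul loop_comp.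
End Loop.
Definition tloop {Gb : zmodType} (pi : G -> Gb) (A : galg F Gb) (t : G -> G -> F) :=
  twist (loop pi A) t.

Section GroupAlg.
Variable H : subgrp G.
Definition grp_gen : pred (funT G F^o) :=
  fun f => asbool (exists g (a : F^o), g \in sg_pred H /\ f = fdelta g a).
Definition grp_car : lmodType F := spanT grp_gen.
Definition grp_mul (x y : grp_car) : grp_car :=
  insubd 0 (conv *%R (sp_val x) (sp_val y)).
Definition grp_comp (g : G) : pred grp_car :=
  fun x => asbool ((forall k, k != g -> sp_val x k = 0) /\
                   (g \in sg_pred H \/ sp_val x g = 0)).
Definition grpalg : galg F G := @GAlg F G grp_car grp_mul grp_comp.
End GroupAlg.
(* restriction tau' = tau|_{H x H} (extended by 1, values outside H x H are never used) *)
Definition restr (H : subgrp G) (t : G -> G -> F) : G -> G -> F :=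
  fun a b => if (a \in sg_pred H) && (b \in sg_pred H) then t a b else 1.
Definition tgrpalg (H : subgrp G) (t' : G -> G -> F) : galg F G := twist (grpalg H) t'.

Section CentroidAlg.
Variable A : galg F G.
Definition cent_gen : pred (funT (gcar A) (gcar A)) := fun c => asbool (is_centroid A c).
Definition cent_car : lmodType F := spanT cent_gen.
Definition cent_mul (c d : cent_car) : cent_car :=
  insubd 0 ((sp_val c \o sp_val d) : funT (gcar A) (gcar A)).
Definition cent_comp (g : G) : pred cent_car :=
  fun c => asbool (centroid_deg A g (sp_val c)).
Definition centroid_alg : galg F G := @GAlg F G cent_car cent_mul cent_comp.
End CentroidAlg.

End GradedNotions.

(* Main.v *)
(* A homogeneous nonzero element of the centroid of a graded-simple algebra B has a graded
   ideal as kernel and as image, so it is invertible; hence C(B) is a twisted group algebra of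
   its support H, with a cocycle that extends from H to G because the units of F embed, inside
   the abelian extension of H that the cocycle defines, in a divisible and thus injective group.
   After twisting B by the inverse of the extended cocycle, H acts on B by centroid elements, and
   identifying the components in each H-coset along this action yields a G/H-graded algebra A
   with B isomorphic to the twisted loop algebra L of A.
   Conversely C(L)_k corresponds to C(A)_(pi k) by a(x)g |-> t(k,g) d(a)(x)(k+g): an element c of
   C(L)_k commutes with the action of H, so it descends to A. Graded simplicity passes between A
   and L as well, and a graded-simple algebra whose centroid lives in degree 0 is simple: a shortest
   nonzero element x0 of an ideal is the image of one of its homogeneous components under an
   element of the centroid, so x0 is homogeneous. This settles (1) and (2).
   An isomorphism of loop algebras rescales the action of H by a function on H, which trivialises
   t1/t2 modulo cocycles inflated from G/H; this gives (3). *)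
Require Import Defs.
From HB Require Import structures.
From mathcomp Require Import all_boot all_order all_algebra.
From mathcomp Require Import ring.
From mathcomp Require classical_sets.
From Stdlib Require Import Classical IndefiniteDescription ClassicalDescription.
From Stdlib Require Import FunctionalExtensionality.
Import Order.TTheory GRing.Theory Num.Theory.
Local Open Scope ring_scope.
Set Implicit Arguments. Unset Strict Implicit. Unset Printing Implicit Defensive.

(** * Finite sums, linear maps and subspaces *)

Lemma eq_big_supp (I : eqType) (V : zmodType) (r s : seq I) (f : I -> V) :
  uniq r -> uniq s -> (forall i, f i != 0 -> (i \in r) && (i \in s)) ->
  \sum_(i <- r) f i = \sum_(i <- s) f i.
Proof.
move=> ur us rs; rewrite (bigID (fun i => f i != 0)) [RHS](bigID (fun i => f i != 0)) /=.
rewrite [X in _ + X]big1 ?[X in _ = _ + X]big1 => [|i /negbNE/eqP //|i /negbNE/eqP //].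
rewrite !addr0 -big_filter -[RHS]big_filter; apply: perm_big.
apply: uniq_perm; rewrite ?filter_uniq // => i; rewrite !mem_filter.
by case: (boolP (f i != 0)) => //= /rs /andP[-> ->].
Qed.

Lemma big_if_eq (I : eqType) (V : zmodType) (r : seq I) (i : I) (f : I -> V) :
  uniq r -> (f i != 0 -> i \in r) -> \sum_(j <- r) (if j == i then f j else 0) = f i.
Proof.
move=> ur ir; rewrite (@eq_big_supp _ _ r [:: i]) ?big_seq1 ?eqxx // => j.
by rewrite inE; have [-> /ir ->|_] := eqVneq j i; rewrite ?eqxx.
Qed.

Section LinearMaps.
Variables (F : fieldType) (U V : lmodType F) (f : U -> V).
Hypothesis f_lin : linear f.

Let fL : {linear U -> V} := HB.pack f (GRing.isLinear.Build F U V *:%R f f_lin).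

Lemma lin0 : f 0 = 0. Proof. exact: (linear0 fL). Qed.
Lemma linB x y : f (x - y) = f x - f y. Proof. exact: (linearB fL). Qed.
Lemma linZ a x : f (a *: x) = a *: f x. Proof. exact: (linearZZ fL). Qed.
Lemma linMz x (n : int) : f (x *~ n) = f x *~ n. Proof. exact: (raddfMz fL). Qed.
Lemma lin_sum (I : Type) (r : seq I) (P : pred I) (h : I -> U) :
  f (\sum_(i <- r | P i) h i) = \sum_(i <- r | P i) f (h i).
Proof. exact: (linear_sum fL). Qed.

Lemma lin_inj : (forall x, f x = 0 -> x = 0) -> injective f.
Proof. by move=> f0 x y e; apply/subr0_eq/f0; rewrite linB e subrr. Qed.

Lemma can_linear (f' : V -> U) : cancel f f' -> cancel f' f -> linear f'.
Proof. by move=> fK f'K a x y; apply: (can_inj fK); rewrite f_lin !f'K. Qed.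
End LinearMaps.

Section LinearCombinators.
Variables (F : fieldType) (U V W : lmodType F).

Lemma linear_zero : linear (fun _ : U => 0 : V).
Proof. by move=> a x y; rewrite scaler0 addr0. Qed.

Lemma linear_id : linear (@id U).
Proof. by []. Qed.

Lemma linear_scale (c : F) (f : U -> V) : linear f -> linear (fun x => c *: f x).
Proof. by move=> fL a x y; rewrite fL scalerDr !scalerA mulrC. Qed.

Lemma linear_add (f g : U -> V) : linear f -> linear g -> linear (fun x => f x + g x).
Proof. by move=> fL gL a x y; rewrite fL gL scalerDr addrACA. Qed.

Lemma linear_comp (f : V -> W) (g : U -> V) : linear f -> linear g -> linear (f \o g).
Proof. by move=> fL gL a x y; rewrite /= gL fL. Qed.
End LinearCombinators.
Arguments linear_zero {F U V}.
Arguments linear_id {F U}.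

Definition pred_of_Prop (T : Type) (Q : T -> Prop) : pred T := fun x => asbool (Q x).

Lemma pred_of_PropP (T : Type) (Q : T -> Prop) x : reflect (Q x) (x \in pred_of_Prop Q).
Proof. exact: asboolP. Qed.

Section SubspaceClosure.
Variables (F : fieldType) (V : lmodType F) (P : pred V).
Hypothesis P_sub : subspace P.

Lemma subspace0 : 0 \in P. Proof. by case: P_sub. Qed.
Lemma subspaceZ a x : x \in P -> a *: x \in P.
Proof. by move=> xP; rewrite -[a *: x]addr0; apply: P_sub.2 => //; apply: subspace0. Qed.
Lemma subspaceD x y : x \in P -> y \in P -> x + y \in P.
Proof. by move=> xP yP; rewrite -[x]scale1r; apply: P_sub.2. Qed.
Lemma subspace_sum (I : Type) (r : seq I) (f : I -> V) :
  (forall i, f i \in P) -> \sum_(i <- r) f i \in P.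
Proof. by move=> fP; elim/big_ind: _ => //; [apply: subspace0|apply: subspaceD]. Qed.

Lemma subspaceZK a x : a != 0 -> a *: x \in P -> x \in P.
Proof. by move=> a0 /(subspaceZ a^-1); rewrite scalerA mulVf // scale1r. Qed.
End SubspaceClosure.

Section Subspaces.
Variables (F : fieldType) (V : lmodType F).

Lemma subspace_eq (W : lmodType F) (f g : V -> W) :
  linear f -> linear g -> subspace [pred x | f x == g x].
Proof.
move=> fL gL; split=> [|a x y]; rewrite !inE ?(lin0 fL) ?(lin0 gL) //.
by move=> /eqP fx /eqP fy; rewrite fL gL fx fy.
Qed.

Lemma subspace_preim (W : lmodType F) (f : V -> W) (Q : pred W) :
  linear f -> subspace Q -> subspace [pred x | f x \in Q].
Proof.
move=> fL QS; split=> [|a x y]; rewrite !inE ?(lin0 fL) ?fL; first exact: (subspace0 QS).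
exact: QS.2.
Qed.

Lemma subspace_image (W : lmodType F) (f : W -> V) (Q : pred W) :
  linear f -> subspace Q -> subspace (pred_of_Prop (fun y => exists2 x, x \in Q & f x = y)).
Proof.
move=> fL QS; split=> [|a _ _ /pred_of_PropP[x xQ <-] /pred_of_PropP[y yQ <-]].
  by apply/pred_of_PropP; exists 0; [apply: subspace0|rewrite (lin0 fL)].
by apply/pred_of_PropP; exists (a *: x + y); [apply: QS.2|rewrite fL].
Qed.

Lemma subspace_forall (I : Type) (Q : I -> pred V) :
  (forall i, subspace (Q i)) -> subspace (pred_of_Prop (fun x => forall i, x \in Q i)).
Proof.
move=> QS; split=> [|a x y /pred_of_PropP xQ /pred_of_PropP yQ].
  by apply/pred_of_PropP => i; apply: subspace0.
by apply/pred_of_PropP => i; apply: (QS i).2.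
Qed.

Lemma subspace_trivial_or_nonzero (P : pred V) :
  (forall x, x \in P -> x = 0) \/ exists2 x, x \in P & x != 0.
Proof.
case: (classic (exists2 x, x \in P & x != 0)) => [|P0]; [by right|left=> x xP].
by apply/eqP; apply: contra_notT P0 => x0; exists x.
Qed.
End Subspaces.

Section FiniteSupport.
Variables (F : fieldType) (G : zmodType) (V : lmodType F).

Lemma fun_at_linear (k : G) : linear (fun f : funT G V => f k).
Proof. by []. Qed.

Definition supported_on (s : seq G) (f : funT G V) := forall g, f g != 0 -> g \in s.
Definition finsupp (f : funT G V) := exists s, supported_on s f.

Lemma fsuppP (f : funT G V) : finsupp f -> uniq (fsupp f) /\ supported_on (fsupp f) f.
Proof.
rewrite /fsupp => fin_f; case: excluded_middle_informative => // fin_f'.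
split; first exact: undup_uniq.
by case: constructive_indefinite_description => s fs g /= /fs; rewrite mem_undup.
Qed.

Lemma common_support (f f' : funT G V) : finsupp f -> finsupp f' ->
  exists s, [/\ uniq s, supported_on s f, supported_on s f' &
    forall a, supported_on s (a *: f + f')].
Proof.
move=> [r fr] [r' fr']; exists (undup (r ++ r')).
have fs g : f g != 0 -> g \in undup (r ++ r') by move=> /fr gr; rewrite mem_undup mem_cat gr.
have fs' g : f' g != 0 -> g \in undup (r ++ r').
  by move=> /fr' gr; rewrite mem_undup mem_cat gr orbT.
split=> // [|a g]; first exact: undup_uniq.
rewrite fun_at_linear; apply: contraNT => gs.
move: (contraNN (fs g) gs) (contraNN (fs' g) gs) => /negbNE/eqP -> /negbNE/eqP ->.
by rewrite scaler0 addr0.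
Qed.

Lemma fdelta_sum (s : seq G) (f : funT G V) : uniq s -> supported_on s f ->
  f = \sum_(g <- s) fdelta g (f g).
Proof.
move=> us fs; apply: functional_extensionality => k.
rewrite (lin_sum (fun_at_linear k)).
rewrite (eq_bigr (fun g => if g == k then f g else 0)) ?big_if_eq //; first exact: fs.
by move=> g _; rewrite /fdelta eq_sym.
Qed.

End FiniteSupport.

(** * Abelian groups *)

Section QuotientProjection.
Variables (G : zmodType) (H : subgrp G).

Lemma qprojD : {morph qproj H : x y / x + y}.
Proof.
move=> x y; rewrite -[RHS]/(qproj H (qrep H x + qrep H y)) qprojDl [x + qrep H y]addrC qprojDl.
by rewrite addrC.
Qed.

Lemma qproj_zmod_morphism : zmod_morphism (qproj H).
Proof. by move=> x y; apply: (addIr (qproj H y)); rewrite -qprojD !subrK. Qed.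

HB.instance Definition _ :=
  GRing.isZmodMorphism.Build G (quot H) (qproj H) qproj_zmod_morphism.

Lemma qproj_eq0 x : (qproj H x == 0) = (x \in sg_pred H).
Proof.
apply/eqP/idP => [[x0]|xH]; last by apply: qproj_eq; rewrite subr0.
have -> : x = (x - qrep H x) - (0 - qrep H 0) by rewrite x0 sub0r opprK subrK.
by apply: sgB; apply: qrepP.
Qed.
End QuotientProjection.

Definition divisible (D : zmodType) := forall (n : nat) (d : D), (0 < n)%N -> exists e, e *+ n = d.

Section SubgroupOfProp.
Variables (G : zmodType) (Q : G -> Prop).
Hypotheses (Q0 : Q 0) (QB : forall x y, Q x -> Q y -> Q (x - y)).

Let pred_of_Prop0 : 0 \in pred_of_Prop Q. Proof. exact/pred_of_PropP. Qed.
Let pred_of_PropB x y :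
  x \in pred_of_Prop Q -> y \in pred_of_Prop Q -> x - y \in pred_of_Prop Q.
Proof. by move=> /pred_of_PropP Qx /pred_of_PropP Qy; apply/pred_of_PropP/QB. Qed.

Definition subgrp_of_Prop : subgrp G := SubGrp pred_of_Prop0 pred_of_PropB.

Lemma subgrp_of_PropP x : reflect (Q x) (x \in sg_pred subgrp_of_Prop).
Proof. exact: pred_of_PropP. Qed.
End SubgroupOfProp.

Section SubgroupClosed.
Variables (G : zmodType) (H : subgrp G).

Lemma sg_zmod_closed : zmod_closed (sg_pred H).
Proof. by split; [apply: sg0|move=> x y; apply: sgB]. Qed.

HB.instance Definition _ := GRing.isZmodClosed.Build G (sg_pred H) sg_zmod_closed.
End SubgroupClosed.

Lemma int_subgrp_principal (S : subgrp int) :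
  exists n : nat, forall m : int, (m \in sg_pred S) = (n %| m)%Z.
Proof.
have mulS (q n : int) : n \in sg_pred S -> q * n \in sg_pred S.
  by move=> nS; rewrite mulrC -mulrzz rpredMz.
case: (classic (exists n, (0 < n)%N && (n%:Z \in sg_pred S))) => [ex_pos|no_pos]; last first.
  exists 0%N => m; rewrite dvd0z; apply/idP/eqP => [mS|->]; last exact: sg0.
  have absS : `|m|%:Z \in sg_pred S by rewrite abszE; case: ger0P => _; rewrite ?rpredN.
  by apply/eqP; apply: contra_notT no_pos => m0; exists `|m|%N; rewrite absz_gt0 m0.
have [n /andP[n_gt0 nS] n_min] := ex_minnP ex_pos; exists n => m.
apply/idP/dvdzP => [mS|[q ->]]; last exact: mulS.
exists (m %/ n)%Z; rewrite {1}(divz_eq m n); suff -> : (m %% n)%Z = 0 by rewrite addr0.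
have nZ : n%:Z != 0 by rewrite -lt0n.
have remS : (m %% n)%Z \in sg_pred S by rewrite /modz rpredB // mulS.
have := modz_ge0 m nZ; have := ltz_mod m nZ.
case: (m %% n)%Z remS => // r rS /= r_lt _; congr Posz; apply/eqP; rewrite -leqn0 leqNgt.
by apply: contraTN r_lt => r_gt0; rewrite -leNgt; apply: n_min; rewrite r_gt0.
Qed.

Section Adjunction.
Variables (M : zmodType) (S : subgrp M) (p : M).

Let in_adjunction (q : M) := exists m : int, q - p *~ m \in sg_pred S.

Let in_adjunction0 : in_adjunction 0.
Proof. by exists 0; rewrite subrr sg0. Qed.

Let in_adjunctionB x y : in_adjunction x -> in_adjunction y -> in_adjunction (x - y).
Proof.
move=> [m xm] [n yn]; exists (m - n).
have -> : x - y - p *~ (m - n) = (x - p *~ m) - (y - p *~ n); last exact: sgB.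
by rewrite mulrzBr !opprB addrACA [RHS]addrACA; congr (_ + _); rewrite addrC.
Qed.

Definition subgrp_adjoin : subgrp M := subgrp_of_Prop in_adjunction0 in_adjunctionB.

Lemma subgrp_adjoinP q :
  reflect (exists m : int, q - p *~ m \in sg_pred S) (q \in sg_pred subgrp_adjoin).
Proof. exact: subgrp_of_PropP. Qed.
End Adjunction.

Lemma pairMz (U V : zmodType) (x : U) (y : V) (m : int) : (x, y) *~ m = (x *~ m, y *~ m).
Proof.
rewrite [LHS]surjective_pairing; congr (_, _).
  exact: (raddfMz (fst : {additive U * V -> U})).
exact: (raddfMz (snd : {additive U * V -> V})).
Qed.

Section DomainMultiples.
Variables (G D : zmodType) (S : subgrp (G * D)%type) (g : G).

Let in_domain (m : int) := exists d, (g *~ m, d) \in sg_pred S.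

Let in_domain0 : in_domain 0.
Proof. by exists 0; rewrite mulr0z sg0. Qed.

Let in_domainB m n : in_domain m -> in_domain n -> in_domain (m - n).
Proof. by move=> [d md] [e ne]; exists (d - e); rewrite mulrzBr; apply: sgB md ne. Qed.

Definition domain_multiples : subgrp int := subgrp_of_Prop in_domain0 in_domainB.

Lemma domain_multiplesP m :
  reflect (exists d, (g *~ m, d) \in sg_pred S) (m \in sg_pred domain_multiples).
Proof. exact: subgrp_of_PropP. Qed.
End DomainMultiples.

Section DivisibleExtension.
Variables (H G D : zmodType) (i : {additive H -> G}) (phi : {additive H -> D}).
Hypotheses (i_inj : injective i) (D_div : divisible D).

(* Subgroups of [G * D] are viewed as graphs of partial homomorphisms from [G] to [D]. *)
Let compatible (S : subgrp (G * D)%type) := forall h d, (i h, d) \in sg_pred S -> d = phi h.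

Let maximal_compatible : exists2 S, compatible S &
  forall S', compatible S' -> {subset sg_pred S <= sg_pred S'} -> {subset sg_pred S' <= sg_pred S}.
Proof.
pose good (R : G * D -> Prop) :=
  (forall p q, R p -> R q -> R (p - q)) /\ forall h d, R (i h, d) -> d = phi h.
have [C Cgood Ctot|R [[RB Rphi] Rmax]] := @classical_sets.Zorn_bigcup (G * D)%type good.
  split=> [p q [R CR Rp] [R' CR' Rq]|h d [R /Cgood[_ Rphi]]]; last exact: Rphi.
  have [RR'|R'R] := Ctot R R' CR CR'; [exists R'|exists R] => //.
    exact: (Cgood R' CR').1 (RR' p Rp) Rq.
  exact: (Cgood R CR).1 Rp (R'R q Rq).
have good0 : good (eq^~ 0).
  split=> [_ _ -> ->|h d [/eqP]]; first by rewrite subrr.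
  by rewrite -(raddf0 i) (inj_eq i_inj) => /eqP-> ->; rewrite raddf0.
have R0 : R 0.
  apply: NNPP => nR0; case: (Rmax (eq^~ 0)) => //; split=> [p Rp|R0]; last exact/nR0/R0.
  by case: nR0; rewrite -(subrr p); apply: RB.
pose S := subgrp_of_Prop R0 RB.
have SP q : reflect (R q) (q \in sg_pred S) := subgrp_of_PropP R0 RB q.
exists S => [h d /SP|S' S'phi SS' p pS']; first exact: Rphi.
apply/SP; apply: NNPP => nRp; apply: (Rmax (fun q => q \in sg_pred S')).
  by split=> [q Rq|S'R]; [exact/SS'/SP|exact/nRp/S'R].
by split=> [q r|]; [apply: sgB|apply: S'phi].
Qed.

Section Maximal.
Variable S : subgrp (G * D)%type.
Hypothesis S_compat : compatible S.
Hypothesis S_max : forall S', compatible S' ->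
  {subset sg_pred S <= sg_pred S'} -> {subset sg_pred S' <= sg_pred S}.

Let mem_adjoin p : compatible (subgrp_adjoin S p) -> p \in sg_pred S.
Proof.
move=> adj; apply: (S_max adj) => [q qS|]; apply/subgrp_adjoinP.
  by exists 0; rewrite mulr0z subr0.
by exists 1; rewrite mulr1z subrr sg0.
Qed.

Let graph_sub h : (i h, phi h) \in sg_pred S.
Proof.
apply: mem_adjoin => k d /subgrp_adjoinP[m]; rewrite pairMz => kd.
have /S_compat/eqP : (i (k - h *~ m), d - phi h *~ m) \in sg_pred S by rewrite raddfB raddfMz.
by rewrite raddfB raddfMz => /eqP/addIr.
Qed.

Let functional g d d' : (g, d) \in sg_pred S -> (g, d') \in sg_pred S -> d = d'.
Proof.
move=> gd gd'; apply/subr0_eq; rewrite -[RHS](raddf0 phi); apply: S_compat.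
by rewrite raddf0 -(subrr g); apply: sgB gd gd'.
Qed.

Let domain_full g : exists d, (g, d) \in sg_pred S.
Proof.
have [n multiples] := int_subgrp_principal (domain_multiples S g).
have [d gd] : exists d, (g *~ n, d *~ n) \in sg_pred S.
  have := dvdzz n; rewrite -multiples => /domain_multiplesP[d]; case: n {multiples} => [|n].
    by exists 0; rewrite !mulr0z sg0.
  by have [e <-] : exists e, e *+ n.+1 = d by [apply: D_div]; exists e.
exists d; apply: mem_adjoin => h d' /subgrp_adjoinP[m]; rewrite pairMz => hm.
have gm : (g *~ m, phi h - d' + d *~ m) \in sg_pred S.
  have -> : (g *~ m, phi h - d' + d *~ m) = (i h, phi h) - ((i h, d') - (g *~ m, d *~ m)).
    by congr (_, _) => /=; rewrite ?subKr // opprB addrA addrAC.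
  exact: sgB (graph_sub h) hm.
have /dvdzP[q mE] : (n %| m)%Z by rewrite -multiples; apply/domain_multiplesP; eexists; apply: gm.
have gdm : (g *~ m, d *~ m) \in sg_pred S by rewrite mE [q * _]mulrC !mulrzA -pairMz rpredMz.
by apply/esym/subr0_eq/(addIr (d *~ m)); rewrite add0r; apply: functional gm gdm.
Qed.

Lemma maximal_compatible_graph : exists psi : {additive G -> D}, forall h, psi (i h) = phi h.
Proof.
have [psi psiS] := functional_choice _ domain_full.
have psiB : zmod_morphism psi.
  by move=> x y; apply: (@functional (x - y)) => //; apply: sgB (psiS x) (psiS y).
pose psi_add : {additive G -> D} := HB.pack psi (GRing.isZmodMorphism.Build G D psi psiB).
by exists psi_add => h; apply: functional (psiS _) (graph_sub h).
Qed.
End Maximal.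

Theorem divisible_extension : exists psi : {additive G -> D}, forall h, psi (i h) = phi h.
Proof. by have [S S_compat S_max] := maximal_compatible; apply: maximal_compatible_graph S_max. Qed.
End DivisibleExtension.

(* Write [E] as the quotient of the free abelian group [Z^(E)] by its relations, and embed it in
   the quotient by the same relations of the group of functions from [E] to the rationals. *)
Section DivisibleEmbedding.
Variable E : zmodType.
Local Notation V := (funT E rat^o).

Let delta (e : E) : V := fdelta e (1 : rat^o).

Definition int_comb (M : zmodType) (b : E -> M) (s : seq (E * int)) : M :=
  \sum_(p <- s) b p.1 *~ p.2.

Let int_comb_cat_opp (M : zmodType) (b : E -> M) s s' :
  int_comb b (s ++ [seq (p.1, - p.2) | p <- s']) = int_comb b s - int_comb b s'.
Proof.
rewrite /int_comb big_cat big_map -sumrN; congr (_ + _).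
by apply: eq_bigr => p _; rewrite mulrNz.
Qed.

Lemma int_comb_delta_eq0 s : int_comb delta s = 0 -> int_comb id s = 0.
Proof.
move=> s0; pose r := undup [seq p.1 | p <- s].
pose coef (e : E) (p : E * int) : int := if e == p.1 then p.2 else 0.
transitivity (\sum_(p <- s) \sum_(e <- r) (if e == p.1 then e *~ p.2 else 0)).
  apply: eq_big_seq => p ps; rewrite (big_if_eq (f := fun e => e *~ p.2)) ?undup_uniq //.
  by rewrite mem_undup map_f.
rewrite exchange_big big1 // => e _ /=.
rewrite (eq_bigr (fun p => e *~ coef e p)) => [|p _]; last by rewrite /coef; case: ifP.
rewrite -mulrz_sumr; suff -> : \sum_(p <- s) coef e p = 0 by rewrite mulr0z.
apply/eqP; rewrite -intq_eq0 rmorph_sum /=; apply/eqP.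
rewrite -[RHS]/((0 : V) e) -s0 /int_comb (lin_sum (fun_at_linear e)).
apply: eq_bigr => p _.
by rewrite (linMz (fun_at_linear e)) /coef /delta /fdelta; case: ifP; rewrite ?mul0rz.
Qed.

Let relation (f : V) := exists2 s, f = int_comb delta s & int_comb id s = 0.

Let relation0 : relation 0.
Proof. by exists [::]; rewrite /int_comb big_nil. Qed.

Let relationB f f' : relation f -> relation f' -> relation (f - f').
Proof.
move=> [s -> s0] [s' -> s'0]; exists (s ++ [seq (p.1, - p.2) | p <- s']).
  by rewrite int_comb_cat_opp.
by rewrite int_comb_cat_opp s0 s'0 subrr.
Qed.

Let relations : subgrp V := subgrp_of_Prop relation0 relationB.

Theorem divisible_embedding :
  exists (D : zmodType) (j : {additive E -> D}), injective j /\ divisible D.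
Proof.
pose D := quot relations; pose j e : D := qproj relations (fdelta e (1 : rat^o)).
have jB : zmod_morphism j.
  move=> x y; rewrite -[RHS](raddfB (qproj relations)); apply: qproj_eq.
  apply/subgrp_of_PropP; exists [:: (x - y, 1); (x, -1); (y, 1)];
    rewrite /int_comb !big_cons big_nil /=.
    by rewrite mulrNz !mulr1z addr0 opprB [- delta x + _]addrC.
  by rewrite mulrNz !mulr1z addr0 [- x + y]addrC addrA subrK subrr.
pose j_add : {additive E -> D} := HB.pack j (GRing.isZmodMorphism.Build E D j jB).
exists D, j_add; split=> [x y /eqP|n d n_gt0].
  rewrite -subr_eq0 -raddfB /= /j qproj_eq0 => /subgrp_of_PropP[s sE s0].
  have : int_comb id ([:: (x - y, 1)] ++ [seq (p.1, - p.2) | p <- s]) = 0.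
    apply: int_comb_delta_eq0; rewrite int_comb_cat_opp -sE /int_comb big_seq1.
    by rewrite mulr1z subrr.
  by rewrite int_comb_cat_opp s0 subr0 /int_comb big_seq1 mulr1z => /subr0_eq.
have n_neq0 : n%:R != 0 :> rat by rewrite pnatr_eq0 -lt0n.
exists (qproj relations ((n%:R)^-1 *: q_val d)).
by rewrite -raddfMn -scaler_nat scalerA divff // scale1r; apply: qproj_val.
Qed.
End DivisibleEmbedding.

Lemma quot_divisible (D : zmodType) (S : subgrp D) : divisible D -> divisible (quot S).
Proof.
move=> D_div n d n_gt0; have [e eE] : exists e, e *+ n = q_val d by apply: D_div.
by exists (qproj S e); rewrite -raddfMn eE; apply: qproj_val.
Qed.

Section SubgroupType.
Variables (G : zmodType) (H : subgrp G).

Definition subgrp_type : Type := {x : G | x \in sg_pred H}.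

HB.instance Definition _ := SubChoice.copy subgrp_type {x : G | x \in sg_pred H}.
HB.instance Definition _ := [SubChoice_isSubZmodule of subgrp_type by <:].
End SubgroupType.

(** * Symmetric 2-cocycles *)

Section Cocycles.
Variables (F : fieldType) (G : zmodType) (t : G -> G -> F).
Hypothesis tC : sym2cocycle t.

Lemma cocycle_neq0 a b : t a b != 0. Proof. by case: tC. Qed.
Lemma cocycleC a b : t a b = t b a. Proof. by case: tC => _ []. Qed.
Lemma cocycleA a b c : t a b * t (a + b) c = t b c * t a (b + c).
Proof. by case: tC => _ [-> _]; rewrite mulrC. Qed.
Lemma cocycleCA a b c : t b c * t a (b + c) = t a c * t b (a + c).
Proof. by rewrite -!cocycleA [t b a]cocycleC addrC. Qed.
Lemma cocycle0r a : t a 0 = t 0 0.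
Proof. by have := cocycleA a 0 0; rewrite !addr0 => /(mulIf (cocycle_neq0 a 0)). Qed.
Lemma cocycle0l a : t 0 a = t 0 0. Proof. by rewrite cocycleC cocycle0r. Qed.
End Cocycles.

Section CocycleOperations.
Variables (F : fieldType) (G : zmodType).

Lemma cocycle_div (t1 t2 : G -> G -> F) :
  sym2cocycle t1 -> sym2cocycle t2 -> sym2cocycle (fun a b => t1 a b / t2 a b).
Proof.
move=> t1C t2C; split=> [a b|]; first by rewrite mulf_neq0 ?invr_eq0 ?cocycle_neq0.
split=> [a b c|a b]; last by rewrite (cocycleC t1C) (cocycleC t2C).
by rewrite [RHS]mulrC !mulf_div (cocycleA t1C) (cocycleA t2C).
Qed.

Lemma coboundary_cocycle (gam : G -> F) :
  (forall a, gam a != 0) -> sym2cocycle (fun a b => gam a * gam b / gam (a + b)).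
Proof.
move=> gam0; split=> [a b|]; first by rewrite !mulf_neq0 ?invr_eq0.
split=> [a b c|a b]; last by rewrite mulrC addrC [gam a * _]mulrC mulrC.
by rewrite addrA; field; rewrite !gam0.
Qed.
End CocycleOperations.

Section CocycleDescent.
Variables (F : fieldType) (G Gb : zmodType) (pi : {additive G -> Gb}) (s : Gb -> G).
Hypothesis sK : cancel s pi.

Lemma cocycle_deflation (t : G -> G -> F) : sym2cocycle t ->
  (forall h g, pi h = 0 -> t h g = t 0 0) ->
  exists2 mu : Gb -> Gb -> F, sym2cocycle mu & forall a b, t a b = mu (pi a) (pi b).
Proof.
move=> tC t_ker.
have t_mod h g g' : pi h = 0 -> t (h + g) g' = t g g'.
  move=> h0; have := cocycleA tC h g g'; rewrite (t_ker h g h0) (t_ker h (g + g') h0).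
  by rewrite [t g g' * _]mulrC => /(mulfI (cocycle_neq0 tC 0 0)).
have tE a a' b b' : pi a = pi a' -> pi b = pi b' -> t a b = t a' b'.
  have tEl x x' y : pi x = pi x' -> t x y = t x' y.
    by move=> xx'; rewrite -(subrK x' x) t_mod // raddfB xx' subrr.
  by move=> aa' bb'; rewrite (tEl a a') // (cocycleC tC) (tEl b b') // (cocycleC tC).
exists (fun x y => t (s x) (s y)) => [|a b]; last by apply: tE; rewrite sK.
split=> [x y|]; first exact: cocycle_neq0.
split=> [x y z|x y]; last exact: cocycleC.
rewrite (tE (s (x + y)) (s x + s y) (s z) (s z)) ?raddfD ?sK //.
rewrite (tE (s x) (s x) (s (y + z)) (s y + s z)) ?raddfD ?sK //.
by rewrite (cocycleA tC) mulrC.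
Qed.

Lemma kernel_trivialization_extension (t : G -> G -> F) (lam : G -> F) : sym2cocycle t ->
  (forall h, pi h = 0 -> lam h != 0) ->
  (forall h k, pi h = 0 -> pi k = 0 -> t h k * lam (h + k) = lam h * lam k) ->
  exists2 gam : G -> F, forall g, gam g != 0 &
    forall h g, pi h = 0 -> t h g * gam (h + g) = lam h * gam g.
Proof.
move=> tC lam0 lamM; have t0 := cocycle_neq0 tC.
pose r g := g - s (pi g); have r0 g : pi (r g) = 0 by rewrite raddfB sK subrr.
exists (fun g => lam (r g) / t (r g) (s (pi g))) => [g|h g h0].
  by rewrite mulf_neq0 ?invr_eq0 ?lam0.
have -> : pi (h + g) = pi g by rewrite raddfD h0 add0r.
have -> : r (h + g) = h + r g by rewrite /r raddfD h0 add0r addrA.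
have tA := cocycleA tC h (r g) (s (pi g)); rewrite subrK in tA.
apply: (mulfI (mulf_neq0 (t0 h (r g)) (t0 (h + r g) (s (pi g))))).
transitivity (t h g * (t h (r g) * lam (h + r g))); first by field; rewrite t0.
by rewrite lamM // tA; field; rewrite t0.
Qed.
End CocycleDescent.

Section ExtensionGroup.
Variables (F : fieldType) (H : zmodType) (t : H -> H -> F).

Definition cocycle_ext of sym2cocycle t : Type := {p : H * F | p.2 != 0}.

Hypothesis tC : sym2cocycle t.
Local Notation E := (cocycle_ext tC).
HB.instance Definition _ := Choice.copy E {p : H * F | p.2 != 0}.

Definition ext_mk (x : H) (a : F) (a0 : a != 0) : E := exist (fun p : H * F => p.2 != 0) (x, a) a0.
Definition ext_base (e : E) : H := (sval e).1.
Definition ext_coef (e : E) : F := (sval e).2.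

Lemma ext_coef_neq0 e : ext_coef e != 0.
Proof. exact: svalP e. Qed.

Lemma ext_eq e e' : ext_base e = ext_base e' -> ext_coef e = ext_coef e' -> e = e'.
Proof.
rewrite /ext_base /ext_coef => eb ec; apply: val_inj.
by rewrite /= [sval e]surjective_pairing [sval e']surjective_pairing eb ec.
Qed.

Definition ext_zero : E := ext_mk 0 (invr_neq0 (cocycle_neq0 tC 0 0)).
Definition ext_add (e e' : E) : E := @ext_mk (ext_base e + ext_base e')
  (ext_coef e * ext_coef e' * t (ext_base e) (ext_base e'))
  (mulf_neq0 (mulf_neq0 (ext_coef_neq0 e) (ext_coef_neq0 e')) (cocycle_neq0 tC _ _)).
Definition ext_opp (e : E) : E := @ext_mk (- ext_base e)
  (ext_coef e * t (- ext_base e) (ext_base e) * t 0 0)^-1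
  (invr_neq0 (mulf_neq0 (mulf_neq0 (ext_coef_neq0 e) (cocycle_neq0 tC _ _)) (cocycle_neq0 tC 0 0))).

Let ext_base_add e e' : ext_base (ext_add e e') = ext_base e + ext_base e'.
Proof. by []. Qed.

Let ext_coef_add e e' :
  ext_coef (ext_add e e') = ext_coef e * ext_coef e' * t (ext_base e) (ext_base e').
Proof. by []. Qed.

Lemma ext_addA : associative ext_add.
Proof.
move=> e1 e2 e3; apply: ext_eq; rewrite ?ext_coef_add ?ext_base_add ?addrA //.
move: (ext_coef e1) (ext_coef e2) (ext_coef e3) => a b c.
move: (ext_base e1) (ext_base e2) (ext_base e3) => x y z.
transitivity (a * b * c * (t y z * t x (y + z))); first ring.
by rewrite -(cocycleA tC); ring.
Qed.

Lemma ext_addC : commutative ext_add.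
Proof.
move=> e1 e2; apply: ext_eq; rewrite ?ext_coef_add ?ext_base_add 1?addrC //.
by rewrite (cocycleC tC) [ext_coef e1 * _]mulrC.
Qed.

Lemma ext_add0 : left_id ext_zero ext_add.
Proof.
move=> e; apply: ext_eq; rewrite ?ext_coef_add ?ext_base_add ?add0r //.
by rewrite (cocycle0l tC) mulrAC mulVf ?mul1r // cocycle_neq0.
Qed.

Lemma ext_addN : left_inverse ext_zero ext_opp ext_add.
Proof.
move=> e; apply: ext_eq; rewrite ?ext_coef_add ?ext_base_add ?addNr //.
rewrite -[ext_coef (ext_opp e)]/(_^-1) -[ext_coef ext_zero]/(_^-1) -[ext_base (ext_opp e)]/(- _).
by field; rewrite !cocycle_neq0 // ext_coef_neq0.
Qed.

HB.instance Definition _ := GRing.isZmodule.Build E ext_addA ext_addC ext_add0 ext_addN.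

Lemma ext_baseB e e' : ext_base (e - e') = ext_base e - ext_base e'.
Proof. by []. Qed.

Definition ext_lift (x : H) : E := ext_mk x (oner_neq0 F).

(* Identifies the kernel of [ext_base] with the unit group of [F]. *)
Definition ext_scalar (e : E) : F := ext_coef e * t 0 0.

Lemma ext_scalar_neq0 e : ext_scalar e != 0.
Proof. by rewrite mulf_neq0 ?ext_coef_neq0 ?cocycle_neq0. Qed.

Lemma ext_scalarD e e' : ext_base e = 0 -> ext_base e' = 0 ->
  ext_scalar (e + e') = ext_scalar e * ext_scalar e'.
Proof. by move=> e0 e'0; rewrite /ext_scalar ext_coef_add e0 e'0; ring. Qed.

Lemma ext_scalar_lift x y e : ext_base e = 0 ->
  e + ext_lift (x + y) = ext_lift x + ext_lift y -> ext_scalar e = t x y.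
Proof.
move=> e0 /(congr1 (@ext_coef)); rewrite !ext_coef_add e0 (cocycle0l tC).
by rewrite -![ext_coef (ext_lift _)]/1 mulr1 !mul1r.
Qed.
End ExtensionGroup.

Section CocycleExtension.
Variables (F : fieldType) (H G : zmodType) (i : {additive H -> G}) (t0 : H -> H -> F).
Hypotheses (i_inj : injective i) (t0C : sym2cocycle t0).
Local Notation E := (cocycle_ext t0C).

Section DivisibleOvergroup.
Variables (D : zmodType) (j : {additive E -> D}).
Hypotheses (j_inj : injective j) (D_div : divisible D).

Let scalar (d : D) := exists2 e : E, ext_base e = 0 & d = j e.

Let scalar0 : scalar 0.
Proof. by exists 0; rewrite ?raddf0. Qed.

Let scalarB x y : scalar x -> scalar y -> scalar (x - y).
Proof.
move=> [e e0 ->] [e' e'0 ->]; exists (e - e'); rewrite ?raddfB //.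
by rewrite ext_baseB e0 e'0 subr0.
Qed.

Let scalars : subgrp D := subgrp_of_Prop scalar0 scalarB.

Let extends_lift : exists X : G -> D, (forall h, X (i h) = j (ext_lift t0C h)) /\
  forall x y, X x + X y - X (x + y) \in sg_pred scalars.
Proof.
pose phi h : quot scalars := qproj scalars (j (ext_lift t0C h)).
have phiB : zmod_morphism phi.
  move=> x y; rewrite -[RHS](raddfB (qproj scalars)) -raddfB; apply: qproj_eq; rewrite -raddfB.
  apply/subgrp_of_PropP; exists (ext_lift t0C (x - y) - (ext_lift t0C x - ext_lift t0C y)) => //.
  by rewrite !ext_baseB subrr.
pose phi_add : {additive H -> quot scalars} :=
  HB.pack phi (GRing.isZmodMorphism.Build H _ phi phiB).
have [psi psiE] := divisible_extension phi_add i_inj (quot_divisible D_div).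
have /functional_choice[X XP] g : exists d,
    qproj scalars d = psi g /\ forall h, g = i h -> d = j (ext_lift t0C h).
  case: (classic (exists h, g = i h)) => [[h ->]|not_i].
    by exists (j (ext_lift t0C h)); split=> [|k /i_inj-> //]; rewrite psiE.
  by exists (q_val (psi g)); split=> [|h gh]; [apply: qproj_val|case: not_i; exists h].
exists X; split=> [h|x y]; first exact: (XP (i h)).2.
by rewrite -qproj_eq0 raddfB raddfD /= !(XP _).1 raddfD subrr.
Qed.

Lemma cocycle_extension_of_divisible :
  exists2 t : G -> G -> F, sym2cocycle t & forall h k, t (i h) (i k) = t0 h k.
Proof.
have [X [XH Xadd]] := extends_lift.
have /functional_choice[m mP] (xy : G * G) : exists e : E,
    ext_base e = 0 /\ j e = X xy.1 + X xy.2 - X (xy.1 + xy.2).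
  by have /subgrp_of_PropP[e e0 eE] := Xadd xy.1 xy.2; exists e.
have m0 x y : ext_base (m (x, y)) = 0 := (mP (x, y)).1.
have mE x y : j (m (x, y)) = X x + X y - X (x + y) := (mP (x, y)).2.
exists (fun x y => ext_scalar (m (x, y))) => [|h k].
  split=> [x y|]; first exact: ext_scalar_neq0.
  split=> [x y z|x y]; last first.
    by congr ext_scalar; apply: j_inj; rewrite !mE [y + x]addrC [X y + _]addrC.
  rewrite -!ext_scalarD //; congr ext_scalar; apply: j_inj; rewrite !raddfD !mE /=.
  rewrite [RHS]addrC [X x + X (y + z)]addrC !addrA !subrK; congr (_ - _).
  by rewrite [RHS]addrC addrA.
apply: ext_scalar_lift => //; apply: j_inj.
have XD : X (i h + i k) = j (ext_lift t0C (h + k)) by rewrite -raddfD XH.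
by rewrite !(raddfD j) mE !XH XD subrK.
Qed.
End DivisibleOvergroup.

Theorem sym2cocycle_extension :
  exists2 t : G -> G -> F, sym2cocycle t & forall h k, t (i h) (i k) = t0 h k.
Proof.
have [D [j [j_inj D_div]]] := divisible_embedding E.
exact: cocycle_extension_of_divisible j_inj D_div.
Qed.
End CocycleExtension.

(** * Graded algebras *)

Section Grading.
Variables (F : fieldType) (G : zmodType) (A : galg F G).
Hypothesis gA : is_galg A.

Lemma comp_subspace g : subspace (gcomp A g). Proof. by case: gA => _ []. Qed.
Lemma comp0 g : 0 \in gcomp A g. Proof. exact: (subspace0 (comp_subspace g)). Qed.
Lemma comp_mul g h x y :
  x \in gcomp A g -> y \in gcomp A h -> gmul A x y \in gcomp A (g + h).
Proof. by case: gA => _ [_ [_ [_]]]; apply. Qed.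

Lemma gdecP (x : gcar A) : [/\ uniq (gdec x).1, forall g, (gdec x).2 g \in gcomp A g &
  x = \sum_(g <- (gdec x).1) (gdec x).2 g].
Proof.
rewrite /gdec; case: excluded_middle_informative => [h|[]].
  by case: constructive_indefinite_description => /= p [? [? ?]].
case: gA => _ [_ [/(_ x) [s [f [fA ->]]] _]].
exists (undup s, fun g => f g *+ count_mem g s); split; first exact: undup_uniq.
split=> [g|] /=; first by rewrite -scaler_nat; apply: (subspaceZ (comp_subspace g)).
by rewrite -(big_undup_iterop_count _ s).
Qed.

Definition proj (g : G) (x : gcar A) : gcar A := if g \in (gdec x).1 then (gdec x).2 g else 0.

Lemma proj_in g x : proj g x \in gcomp A g.
Proof. by rewrite /proj; case: ifP => _; [case: (gdecP x)|apply: comp0]. Qed.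

Definition degs (x : gcar A) : seq G := [seq g <- (gdec x).1 | proj g x != 0].

Lemma mem_degs x g : (g \in degs x) = (proj g x != 0).
Proof. by rewrite mem_filter /proj; case: ifP => _; rewrite ?andbT ?andbF ?eqxx. Qed.

Lemma degs_uniq x : uniq (degs x).
Proof. by case: (gdecP x) => us _ _; apply: filter_uniq. Qed.

Lemma sum_proj_sub s x : uniq s -> {subset degs x <= s} -> \sum_(g <- s) proj g x = x.
Proof.
move=> us xs; have [us' _ xE] := gdecP x; rewrite [RHS]xE (@eq_big_supp _ _ s (gdec x).1) //.
  by apply: eq_big_seq => g gs; rewrite /proj gs.
by move=> g; rewrite -mem_degs => gx; rewrite xs //; move: gx; rewrite mem_filter => /andP[].
Qed.

Lemma sum_proj x : \sum_(g <- degs x) proj g x = x.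
Proof. exact: sum_proj_sub (degs_uniq x) _. Qed.

Lemma proj_sum s (f : G -> gcar A) g : uniq s -> (forall h, f h \in gcomp A h) ->
  (forall h, f h != 0 -> h \in s) -> proj g (\sum_(h <- s) f h) = f g.
Proof.
move=> us fA fs; set x := \sum_(h <- s) f h; pose S := undup (s ++ degs x).
have memS h : (h \in S) = (h \in s) || (h \in degs x) by rewrite mem_undup mem_cat.
have uS : uniq S by rewrite undup_uniq.
have S0 : \sum_(h <- S) (proj h x - f h) = 0.
  rewrite sumrB sum_proj_sub // => [|h hx]; last by rewrite memS hx orbT.
  apply/eqP; rewrite subr_eq0 /x; apply/eqP/eq_big_supp => // h /fs hs.
  by rewrite memS hs.
have dA h : proj h x - f h \in gcomp A h.
  rewrite addrC -scaleN1r; apply: (comp_subspace h).2 => //; exact: proj_in.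
case: (boolP (g \in S)) => [gS|]; last first.
  by rewrite memS negb_or mem_degs => /andP[/(contraNN (@fs g)) /negbNE/eqP -> /negbNE/eqP].
by case: gA => _ [_ [_ [direct _]]]; apply/subr0_eq/(direct S _ uS dA S0).
Qed.

Lemma proj_linear g : linear (proj g).
Proof.
move=> a x y; pose S := undup (degs x ++ degs y); have uS : uniq S by rewrite undup_uniq.
have memS h : (h \in S) = (h \in degs x) || (h \in degs y) by rewrite mem_undup mem_cat.
rewrite -{1}(@sum_proj_sub S x) // => [|h hx]; last by rewrite memS hx.
rewrite -{1}(@sum_proj_sub S y) // => [|h hy]; last by rewrite memS hy orbT.
rewrite scaler_sumr -big_split /= proj_sum // => h.
  by apply: (comp_subspace h).2; apply: proj_in.
rewrite memS !mem_degs; apply: contraNT; rewrite negb_or.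
by move=> /andP[/negbNE/eqP -> /negbNE/eqP ->]; rewrite scaler0 addr0.
Qed.

Lemma projH g h x : x \in gcomp A h -> proj g x = if h == g then x else 0.
Proof.
move=> xh; pose f k := if h == k then x else 0.
have -> : x = \sum_(k <- [:: h]) f k by rewrite big_seq1 /f eqxx.
rewrite proj_sum ?big_seq1 /f ?eqxx // => k; last first.
  by rewrite inE; case: (eqVneq h k); rewrite ?eqxx.
by case: eqP => [<-|_] //; apply: comp0.
Qed.

Lemma proj_id g x : x \in gcomp A g -> proj g x = x.
Proof. by move=> /projH ->; rewrite eqxx. Qed.

Lemma proj_ext x y : (forall g, proj g x = proj g y) -> x = y.
Proof.
move=> xy; apply/subr0_eq; rewrite -(sum_proj (x - y)) big1 // => g _.
by rewrite (linB (proj_linear g)) xy subrr.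
Qed.

Lemma comp_disjoint g h x : x \in gcomp A g -> x \in gcomp A h -> g != h -> x = 0.
Proof. by move=> xg xh /negbTE gh; rewrite -(proj_id xg) (projH g xh) eq_sym gh. Qed.

Lemma nonzero_proj x : x != 0 -> exists g, proj g x != 0.
Proof.
move=> x0; apply: NNPP => none; case/eqP: x0; apply: proj_ext => g.
rewrite (lin0 (proj_linear g)); apply/eqP.
by apply: contra_notT none => ?; exists g.
Qed.

Lemma homog_spanning (P : pred (gcar A)) : subspace P ->
  (forall g x, x \in gcomp A g -> x \in P) -> forall x, x \in P.
Proof.
move=> P_sub PH x; rewrite -(sum_proj x); apply: (subspace_sum P_sub) => g.
exact/(PH g)/proj_in.
Qed.

Lemma linear_homog_ext (V : lmodType F) (f1 f2 : gcar A -> V) : linear f1 -> linear f2 ->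
  (forall g x, x \in gcomp A g -> f1 x = f2 x) -> f1 =1 f2.
Proof.
move=> f1L f2L fH x; apply/eqP; apply: (homog_spanning (subspace_eq f1L f2L)) => g y /fH e.
by rewrite inE e.
Qed.

Section Glue.
Variables (V : lmodType F) (phi : G -> gcar A -> V).

Definition glue (x : gcar A) : V := \sum_(g <- degs x) phi g (proj g x).

Hypothesis phi_lin : forall g, linear (phi g).

Lemma glueE s x : uniq s -> {subset degs x <= s} -> glue x = \sum_(g <- s) phi g (proj g x).
Proof.
move=> us xs; apply: eq_big_supp (degs_uniq x) us _ => g phi0; suff gx : g \in degs x.
  by rewrite gx xs.
by rewrite mem_degs; apply: contraNneq phi0 => ->; rewrite (lin0 (phi_lin g)).
Qed.

Lemma glue_linear : linear glue.
Proof.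
move=> a x y; pose S := undup (degs x ++ degs y ++ degs (a *: x + y)).
have uS : uniq S by rewrite undup_uniq.
rewrite !(@glueE S) //; try by move=> g; rewrite mem_undup !mem_cat => ->; rewrite ?orbT.
rewrite scaler_sumr -big_split; apply: eq_bigr => g _ /=.
by rewrite proj_linear phi_lin.
Qed.

Lemma glueH g x : x \in gcomp A g -> glue x = phi g x.
Proof.
move=> xg; rewrite (@glueE [:: g]) // ?big_seq1 ?proj_id // => h.
by rewrite mem_degs (projH h xg) inE; case: (eqVneq g h); rewrite ?eqxx.
Qed.

Lemma sum_gdec x : \sum_(g <- (gdec x).1) phi g ((gdec x).2 g) = glue x.
Proof.
have [us _ _] := gdecP x; rewrite (@glueE (gdec x).1) //.
  by apply: eq_big_seq => g gs; rewrite /proj gs.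
by move=> g; rewrite mem_filter => /andP[].
Qed.
End Glue.

Lemma glue_family_linear (U V : lmodType F) (phi : U -> G -> gcar A -> V) x :
  (forall g z, linear (fun u => phi u g z)) -> linear (fun u => glue (phi u) x).
Proof.
move=> phi_lin a u v; rewrite /glue scaler_sumr -big_split; apply: eq_bigr => g _ /=.
exact: phi_lin.
Qed.
End Grading.
Arguments proj {F G} A g x : rename.

Section Multiplication.
Variables (F : fieldType) (G : zmodType) (A : galg F G).
Hypothesis gA : is_galg A.

Lemma gmull_linear y : linear (fun x => gmul A x y).
Proof. by move=> a x z; apply: gA.1.1. Qed.
Lemma gmulr_linear x : linear (gmul A x).
Proof. by move=> a y z; apply: gA.1.2. Qed.

Lemma gmul0l y : gmul A 0 y = 0. Proof. exact: (lin0 (gmull_linear y)). Qed.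
Lemma gmul0r x : gmul A x 0 = 0. Proof. exact: (lin0 (gmulr_linear x)). Qed.
Lemma gmulZl y a x : gmul A (a *: x) y = a *: gmul A x y.
Proof. exact: (linZ (gmull_linear y)). Qed.
Lemma gmulZr x a y : gmul A x (a *: y) = a *: gmul A x y.
Proof. exact: (linZ (gmulr_linear x)). Qed.

Lemma bilinear_homog_ext (V : lmodType F) (b1 b2 : gcar A -> gcar A -> V) :
  (forall y, linear (b1^~ y)) -> (forall x, linear (b1 x)) ->
  (forall y, linear (b2^~ y)) -> (forall x, linear (b2 x)) ->
  (forall g h x y, x \in gcomp A g -> y \in gcomp A h -> b1 x y = b2 x y) ->
  forall x y, b1 x y = b2 x y.
Proof.
move=> l1 r1 l2 r2 bH x y; move: x; apply: (linear_homog_ext gA (l1 y) (l2 y)) => g x xg.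
by move: y; apply: (linear_homog_ext gA (r1 x) (r2 x)) => h y; apply: bH xg.
Qed.

Lemma proj_mulr g h x y : y \in gcomp A h -> proj A g (gmul A x y) = gmul A (proj A (g - h) x) y.
Proof.
move=> yh; move: x; apply: (linear_homog_ext gA) => [||k x xk].
- exact: linear_comp (proj_linear gA g) (gmull_linear y).
- exact: linear_comp (gmull_linear y) (proj_linear gA _).
rewrite (projH gA _ xk) (projH gA _ (comp_mul gA xk yh)).
have -> : (k + h == g) = (k == g - h) by rewrite -[RHS](inj_eq (addIr h)) subrK.
by case: ifP => // _; rewrite gmul0l.
Qed.

Lemma proj_mull g h x y : x \in gcomp A h -> proj A g (gmul A x y) = gmul A x (proj A (g - h) y).
Proof.
move=> xh; move: y; apply: (linear_homog_ext gA) => [||k y yk].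
- exact: linear_comp (proj_linear gA g) (gmulr_linear x).
- exact: linear_comp (gmulr_linear x) (proj_linear gA _).
rewrite (projH gA _ yk) (projH gA _ (comp_mul gA xh yk)).
have -> : (h + k == g) = (k == g - h) by rewrite addrC -[RHS](inj_eq (addIr h)) subrK.
by case: ifP => // _; rewrite gmul0r.
Qed.

Lemma sq_full_spanning (P : pred (gcar A)) : sq_full A -> subspace P ->
  (forall x y, gmul A x y \in P) -> forall x, x \in P.
Proof.
move=> sqA P_sub PM x; have [s ->] := sqA x; apply: (subspace_sum P_sub) => p.
exact/(subspaceZ P_sub)/PM.
Qed.

Lemma sq_full_homog_spanning (P : pred (gcar A)) : sq_full A -> subspace P ->
  (forall g h x y, x \in gcomp A g -> y \in gcomp A h -> gmul A x y \in P) ->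
  forall x, x \in P.
Proof.
move=> sqA P_sub PM; apply: (sq_full_spanning sqA P_sub) => x y; move: x.
apply: (homog_spanning gA (subspace_preim (gmull_linear y) P_sub)) => g x xg; rewrite inE.
move: y; apply: (homog_spanning gA (subspace_preim (gmulr_linear x) P_sub)) => h y.
exact: PM xg.
Qed.

Lemma sq_full_intro : (forall P : pred (gcar A), subspace P ->
  (forall x y, gmul A x y \in P) -> forall x, x \in P) -> sq_full A.
Proof.
move=> span x; pose P := pred_of_Prop (fun x : gcar A => exists s : seq (F * gcar A * gcar A),
  x = \sum_(p <- s) p.1.1 *: gmul A p.1.2 p.2).
have [||s ->] := pred_of_PropP _ _ (span P _ _ x); last by exists s.
- split=> [|a _ _ /pred_of_PropP[s ->] /pred_of_PropP[r ->]]; apply/pred_of_PropP.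
    by exists [::]; rewrite big_nil.
  exists ([seq (a * p.1.1, p.1.2, p.2) | p <- s] ++ r).
  rewrite big_cat big_map /= scaler_sumr; congr (_ + _).
  by apply: eq_bigr => p _; rewrite scalerA.
- by move=> y z; apply/pred_of_PropP; exists [:: (1, y, z)]; rewrite big_seq1 scale1r.
Qed.

Lemma ideal_homog_intro (I : pred (gcar A)) : subspace I ->
  (forall g x y, x \in I -> y \in gcomp A g -> gmul A x y \in I /\ gmul A y x \in I) ->
  is_ideal A I.
Proof.
move=> I_sub IH; split=> // x y xI; split; move: y.
- apply: (homog_spanning gA (subspace_preim (gmulr_linear x) I_sub)) => g y yg.
  exact: (IH g x y xI yg).1.
- apply: (homog_spanning gA (subspace_preim (gmull_linear x) I_sub)) => g y yg.
  exact: (IH g x y xI yg).2.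
Qed.

Lemma graded_subspace_intro (I : pred (gcar A)) :
  (forall g x, x \in I -> proj A g x \in I) -> is_graded_subspace A I.
Proof.
move=> Iproj x xI; exists (degs x), (fun g => proj A g x); rewrite sum_proj //.
by split=> // g; split; [apply: proj_in|apply: Iproj].
Qed.

Lemma graded_subspace_proj (I : pred (gcar A)) g x :
  subspace I -> is_graded_subspace A I -> x \in I -> proj A g x \in I.
Proof.
move=> I_sub Igr xI; have [s [f [fI ->]]] := Igr x xI.
rewrite (lin_sum (proj_linear gA g)); apply: (subspace_sum I_sub) => h.
rewrite (projH gA g (fI h).1); case: ifP => _; [exact: (fI h).2|exact: (subspace0 I_sub)].
Qed.

Definition graded_core (I : pred (gcar A)) : pred (gcar A) :=
  pred_of_Prop (fun x => forall g, x \in [pred y | proj A g y \in I]).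

Lemma graded_coreP I x : reflect (forall g, proj A g x \in I) (x \in graded_core I).
Proof. exact: pred_of_PropP. Qed.

Lemma graded_core_graded (I : pred (gcar A)) : subspace I -> is_graded_subspace A (graded_core I).
Proof.
move=> I_sub; apply: graded_subspace_intro => g x /graded_coreP xI; apply/graded_coreP => h.
by rewrite (projH gA h (proj_in gA g x)); case: ifP => _ //; apply: subspace0.
Qed.

Lemma graded_core_ideal (I : pred (gcar A)) : is_ideal A I -> is_ideal A (graded_core I).
Proof.
move=> [I_sub idI]; apply: ideal_homog_intro => [|g x y /graded_coreP xI yg].
  by apply: subspace_forall => g; apply: (subspace_preim (proj_linear gA g)).
split; apply/graded_coreP => h; first by rewrite (proj_mulr _ _ yg); apply: (idI _ _ _).1.
by rewrite (proj_mull _ _ yg); apply: (idI _ _ _).2.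
Qed.

Lemma graded_simple_full (I : pred (gcar A)) g x : graded_simple A -> is_ideal A I ->
  x \in gcomp A g -> x \in I -> x != 0 -> forall y, y \in I.
Proof.
move=> [_ [_ simpA]] idI xg xI /eqP x0; have I_sub := idI.1.
have [] := simpA _ (graded_core_ideal idI) (graded_core_graded I_sub) => [core0|coreT].
  case: x0; apply: core0; apply/graded_coreP => h; rewrite (projH gA h xg).
  by case: ifP => _ //; apply: subspace0.
by apply: (homog_spanning gA I_sub) => h y yh; have /graded_coreP/(_ h) := coreT y; rewrite proj_id.
Qed.

Lemma graded_simple_intro : nonzero A -> sq_full A ->
  (forall I g x, is_ideal A I -> is_graded_subspace A I ->
     x \in gcomp A g -> x \in I -> x != 0 -> forall y, y \in I) ->
  graded_simple A.
Proof.
move=> nzA sqA full; split=> //; split=> // I idI grI.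
have [|[x xI /(nonzero_proj gA)[g xg]]] := subspace_trivial_or_nonzero I; [by left|right].
apply: (full I g (proj A g x)) => //; first exact: proj_in.
exact: graded_subspace_proj idI.1 grI xI.
Qed.

Section Twist.
Variable t : G -> G -> F.

Let twist_row_linear g y : linear (fun x => glue (fun h y => t g h *: gmul A x y) y).
Proof. by apply: glue_family_linear => h z; apply/linear_scale/gmull_linear. Qed.

Lemma twist_mulE x y : gmul (twist A t) x y =
  glue (fun g x => glue (fun h y => t g h *: gmul A x y) y) x.
Proof.
rewrite -(sum_gdec gA (fun g => twist_row_linear g y)); apply: eq_bigr => g _.
by rewrite -(sum_gdec gA) // => h; apply/linear_scale/gmulr_linear.
Qed.

Lemma twist_mulH g h x y : x \in gcomp A g -> y \in gcomp A h ->
  gmul (twist A t) x y = t g h *: gmul A x y.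
Proof.
move=> xg yh; rewrite twist_mulE (glueH gA (fun g => twist_row_linear g y) xg).
by apply: (glueH gA) yh => k; apply/linear_scale/gmulr_linear.
Qed.

Lemma twist_galg : is_galg (twist A t).
Proof.
split; first split=> a x y z.
- by rewrite !twist_mulE; exact: (glue_linear gA (fun g => twist_row_linear g z)).
- rewrite !twist_mulE; move: a x y; apply: glue_family_linear => g u.
  by apply: (glue_linear gA) => h; apply/linear_scale/gmulr_linear.
case: (gA) => _ [h1 [h2 [h3 _]]]; split=> //; split=> //; split=> // g h x y xg yh.
by rewrite (twist_mulH xg yh); apply: (subspaceZ (comp_subspace gA _)); apply: comp_mul.
Qed.
End Twist.
End Multiplication.

Section GradedIsomorphisms.
Variables (F : fieldType) (G : zmodType).
Implicit Types A B : galg F G.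

Record graded_iso A B (f : gcar A -> gcar B) (f' : gcar B -> gcar A) : Prop := GradedIso {
  iso_linear : linear f;
  iso_can : cancel f f';
  iso_can_inv : cancel f' f;
  iso_mul : forall x y, f (gmul A x y) = gmul B (f x) (f y);
  iso_comp : forall g x, x \in gcomp A g -> f x \in gcomp B g;
  iso_comp_inv : forall g y, y \in gcomp B g -> f' y \in gcomp A g }.

Lemma gisoP A B : giso A B <-> exists f f', @graded_iso A B f f'.
Proof.
split=> [[f [fL [[f' fK f'K] [fM [fA fB]]]]]|[f [f' [fL fK f'K fM fA f'A]]]].
  by exists f, f'; split=> // g y /fB [x xg <-]; rewrite fK.
exists f; do 3?split=> //; first by exists f'.
by split=> // g y yg; exists (f' y); [apply: f'A|apply: f'K].
Qed.

Lemma graded_iso_sym A B (f : gcar A -> gcar B) (f' : gcar B -> gcar A) :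
  graded_iso f f' -> graded_iso f' f.
Proof.
move=> [fL fK f'K fM fA f'A]; split=> //; first exact: can_linear fK f'K.
by move=> x y; apply: (can_inj fK); rewrite fM !f'K.
Qed.

Lemma giso_sym A B : giso A B -> giso B A.
Proof. by move=> /gisoP[f [f' fI]]; apply/gisoP; exists f', f; apply: graded_iso_sym. Qed.

Lemma giso_intro A B (phi : G -> gcar A -> gcar B) : is_galg A -> is_galg B ->
  (forall g, linear (phi g)) ->
  (forall g x, x \in gcomp A g -> phi g x \in gcomp B g) ->
  (forall g x, x \in gcomp A g -> phi g x = 0 -> x = 0) ->
  (forall g y, y \in gcomp B g -> exists2 x, x \in gcomp A g & phi g x = y) ->
  (forall g h x y, x \in gcomp A g -> y \in gcomp A h ->
     phi (g + h) (gmul A x y) = gmul B (phi g x) (phi h y)) ->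
  giso A B.
Proof.
move=> gA gB phiL phiA phi_inj phi_surj phiM.
pose f := glue phi; have fL : linear f by exact: glue_linear.
have fH g x : x \in gcomp A g -> f x = phi g x by exact: glueH.
have f_proj g x : proj B g (f x) = phi g (proj A g x).
  move: x; apply: (linear_homog_ext gA) => [||h x xh].
  - exact: linear_comp (proj_linear gB g) fL.
  - exact: linear_comp (phiL g) (proj_linear gA g).
  rewrite (fH h x xh) (projH gA g xh) (projH gB g (phiA h x xh)).
  by case: eqP => [->|_] //; rewrite (lin0 (phiL g)).
have f_inj : injective f.
  apply: (lin_inj fL) => x fx; apply: (proj_ext gA) => g; rewrite (lin0 (proj_linear gA g)).
  by apply: (phi_inj g); [apply: proj_in|rewrite -f_proj fx (lin0 (proj_linear gB g))].
have f_surj y : exists x, f x = y.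
  pose im := pred_of_Prop (fun y => exists2 x, x \in (predT : pred (gcar A)) & f x = y).
  suff /pred_of_PropP[x _ <-] : y \in im by exists x.
  apply: (homog_spanning gB (subspace_image fL _)) => // g z /phi_surj[x xg <-].
  by apply/pred_of_PropP; exists x; rewrite ?(fH g).
have [f' f'K] := functional_choice _ f_surj.
exists f; split=> //; split; first by exists f' => // x; apply: f_inj; rewrite f'K.
split; last split=> [g x xg|g y /phi_surj [x xg <-]].
- apply: (bilinear_homog_ext gA) => [y|x|y|x|g h x y xg yh].
  + exact: linear_comp fL (gmull_linear gA y).
  + exact: linear_comp fL (gmulr_linear gA x).
  + exact: linear_comp (gmull_linear gB (f y)) fL.
  + exact: linear_comp (gmulr_linear gB (f x)) fL.
  by rewrite (fH _ _ (comp_mul gA xg yh)) (fH _ _ xg) (fH _ _ yh) phiM.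
- by rewrite (fH _ _ xg); apply: phiA.
by exists x => //; apply: fH.
Qed.
End GradedIsomorphisms.

(** * The centroid of a graded algebra *)

Section Centroid.
Variables (F : fieldType) (G : zmodType) (A : galg F G).
Hypothesis gA : is_galg A.
Implicit Types c d : gcar A -> gcar A.

Definition homog_centroid (k : G) c := is_centroid A c /\ centroid_deg A k c.

Definition centroid_support (k : G) := exists2 c, homog_centroid k c & exists x, c x != 0.

Lemma centroid_linear c : is_centroid A c -> linear c.
Proof. by case. Qed.

Lemma centroid0 : is_centroid A (fun=> 0).
Proof. by split=> [a x y|x y]; rewrite ?scaler0 ?addr0 ?(gmul0l gA) ?(gmul0r gA). Qed.

Lemma centroid_lin_comb a c d :
  is_centroid A c -> is_centroid A d -> is_centroid A (fun x => a *: c x + d x).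
Proof.
move=> [cL cM] [dL dM]; split=> [|x y].
  exact: (linear_add (linear_scale a cL) dL).
by rewrite gA.1.1 gA.1.2 -(cM x y).1 -(cM x y).2 -(dM x y).1 -(dM x y).2.
Qed.

Lemma centroid_comp c d : is_centroid A c -> is_centroid A d -> is_centroid A (c \o d).
Proof.
move=> [cL cM] [dL dM]; split=> [|x y] /=; first exact: (linear_comp cL dL).
by rewrite {1}(dM x y).1 (cM _ _).1 (dM x y).2 (cM _ _).2.
Qed.

Lemma homog_centroid_id : homog_centroid 0 id.
Proof. by split=> // g x; rewrite add0r. Qed.

Lemma homog_centroid_comp k l c d :
  homog_centroid k c -> homog_centroid l d -> homog_centroid (k + l) (c \o d).
Proof.
move=> [cC cD] [dC dD]; split; first exact: centroid_comp.
by move=> g x xg; rewrite -addrA; apply/cD/dD.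
Qed.

Lemma centroid_glue (phi : G -> gcar A -> gcar A) :
  (forall g, linear (phi g)) ->
  (forall g h x y, x \in gcomp A g -> y \in gcomp A h ->
     phi (g + h) (gmul A x y) = gmul A (phi g x) y /\
     phi (g + h) (gmul A x y) = gmul A x (phi h y)) ->
  is_centroid A (glue phi).
Proof.
move=> phiL phiM; have fL : linear (glue phi) by exact: glue_linear.
have fH g x : x \in gcomp A g -> glue phi x = phi g x by exact: glueH.
have fmull y : linear (fun x => glue phi (gmul A x y)).
  exact: linear_comp fL (gmull_linear gA y).
have fmulr x : linear (fun y => glue phi (gmul A x y)).
  exact: linear_comp fL (gmulr_linear gA x).
split=> // x y; split; move: x y; apply: (bilinear_homog_ext gA) => //.
- by move=> y; apply: (linear_comp (gmull_linear gA y) fL).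
- by move=> x; apply: gmulr_linear.
- by move=> g h x y xg yh; rewrite (fH _ _ (comp_mul gA xg yh)) (fH _ _ xg) (phiM g h x y xg yh).1.
- by move=> y; apply: gmull_linear.
- by move=> x; apply: (linear_comp (gmulr_linear gA x) fL).
- by move=> g h x y xg yh; rewrite (fH _ _ (comp_mul gA xg yh)) (fH _ _ yh) (phiM g h x y xg yh).2.
Qed.

Definition centroid_component c k := glue (fun g (x : gcar A) => proj A (k + g) (c x)).

Section Components.
Variables (c : gcar A -> gcar A) (k : G).
Hypothesis cC : is_centroid A c.

Let family_linear g : linear (fun x => proj A (k + g) (c x)).
Proof. exact: linear_comp (proj_linear gA _) (centroid_linear cC). Qed.

Lemma centroid_componentH g x :
  x \in gcomp A g -> centroid_component c k x = proj A (k + g) (c x).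
Proof. exact: (glueH gA family_linear). Qed.

Lemma homog_centroid_component : homog_centroid k (centroid_component c k).
Proof.
split=> [|g x xg]; last by rewrite (centroid_componentH xg); apply: proj_in.
apply: centroid_glue => [g|g h x y xg yh]; first exact: family_linear.
split; first by rewrite (cC.2 x y).1 (proj_mulr gA _ _ yh) addrA addrK.
by rewrite (cC.2 x y).2 (proj_mull gA _ _ xg) addrCA [g + _]addrC addrK.
Qed.
End Components.

Lemma homog_centroid_proj c k g x :
  homog_centroid k c -> proj A (k + g) (c x) = c (proj A g x).
Proof.
move=> [cC cD]; have cL := centroid_linear cC; move: x; apply: (linear_homog_ext gA) => [||h x xh].
- exact: linear_comp (proj_linear gA _) cL.
- exact: linear_comp cL (proj_linear gA g).
rewrite (projH gA g xh) (projH gA _ (cD _ _ xh)) (inj_eq (addrI k)).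
by case: ifP => // _; rewrite (lin0 cL).
Qed.

Lemma centroid_comm c d x :
  sq_full A -> is_centroid A c -> is_centroid A d -> c (d x) = d (c x).
Proof.
move=> sqA cC dC; have [cL cM] := cC; have [dL dM] := dC; apply/eqP; move: x.
apply: (sq_full_spanning sqA (subspace_eq (linear_comp cL dL) (linear_comp dL cL))) => x y.
by rewrite inE /= (dM x y).2 (cM _ _).1 (cM x y).1 (dM _ _).2.
Qed.

Section GradedSimple.
Hypothesis gsA : graded_simple A.

Let sqA : sq_full A. Proof. by case: gsA => _ []. Qed.

Lemma homog_centroid_eq0 c k x :
  homog_centroid k c -> x != 0 -> c x = 0 -> forall y, c y = 0.
Proof.
move=> cH x0 cx; have [cC cD] := cH; have [cL cM] := cC.
have [g gx0] := nonzero_proj gA x0; pose I := [pred y | c y == 0].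
have idI : is_ideal A I.
  split=> [|y z]; first exact: (subspace_eq cL linear_zero).
  rewrite !inE => /eqP cy; rewrite (cM y z).1 (cM z y).2 cy.
  by rewrite (gmul0l gA) (gmul0r gA) eqxx.
have gxI : proj A g x \in I.
  by rewrite inE -(homog_centroid_proj g x cH) cx (lin0 (proj_linear gA _)).
by move=> y; apply/eqP/(graded_simple_full gA gsA idI (proj_in gA g x) gxI gx0 y).
Qed.

Section Nonzero.
Variables (c : gcar A -> gcar A) (k : G).
Hypotheses (cH : homog_centroid k c) (c_neq0 : exists x, c x != 0).

Lemma homog_centroid_inj : injective c.
Proof.
apply: (lin_inj (centroid_linear cH.1)) => x cx; have [y cy] := c_neq0.
by apply: contraNeq cy => x0; rewrite (homog_centroid_eq0 cH x0 cx).
Qed.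

Lemma homog_centroid_surj y : exists x, c x = y.
Proof.
have [cC cD] := cH; have [cL cM] := cC; have [x0 cx0] := c_neq0.
pose I := pred_of_Prop (fun y => exists2 x, x \in (predT : pred (gcar A)) & c x = y).
have idI : is_ideal A I.
  split=> [|_ z /pred_of_PropP[x _ <-]]; first exact: subspace_image.
  split; apply/pred_of_PropP; first by exists (gmul A x z) => //; rewrite (cM x z).1.
  by exists (gmul A z x) => //; rewrite (cM z x).2.
have [g gx0] : exists g, c (proj A g x0) != 0.
  have [g] := nonzero_proj gA cx0; rewrite -[g](subrKC k) (homog_centroid_proj _ _ cH).
  by exists (g - k).
have gxI : c (proj A g x0) \in I by apply/pred_of_PropP; exists (proj A g x0).
have /pred_of_PropP[x _ <-] := graded_simple_full gA gsA idI (cD g _ (proj_in gA g x0)) gxI gx0 y.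
by exists x.
Qed.

Lemma homog_centroid_inv :
  exists c', [/\ homog_centroid (- k) c', cancel c c' & cancel c' c].
Proof.
have [c' c'K] := functional_choice _ homog_centroid_surj; have [[cL cM] _] := cH.
have cK : cancel c c' by move=> x; apply: homog_centroid_inj; rewrite c'K.
exists c'; split=> //; split; first split=> [|x y].
- exact: can_linear cK c'K.
- by split; apply: homog_centroid_inj; [rewrite (cM _ _).1|rewrite (cM _ _).2]; rewrite !c'K.
move=> g x xg; suff -> : c' x = proj A (- k + g) (c' x) by apply: proj_in.
apply: homog_centroid_inj; rewrite -(homog_centroid_proj _ _ cH) !c'K addNKr.
by rewrite (proj_id gA xg).
Qed.
End Nonzero.

Lemma homog_centroid_line c d k : graded_central A -> homog_centroid k c -> (exists x, c x != 0) ->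
  homog_centroid k d -> exists lam : F, forall x, d x = lam *: c x.
Proof.
move=> gcA cH c0 dH; have [c' [c'H cK c'K]] := homog_centroid_inv cH c0.
have c'dH := homog_centroid_comp c'H dH; rewrite addNr in c'dH.
have [lam lamE] := gcA _ c'dH.1 c'dH.2.
by exists lam => x; rewrite -[LHS]c'K -[c' (d x)]/((c' \o d) x) lamE (linZ (centroid_linear cH.1)).
Qed.

Lemma centroid_support0 : centroid_support 0.
Proof. by have [[x x0] _] := gsA; exists id; [apply: homog_centroid_id|exists x]. Qed.

Lemma centroid_supportB k l : centroid_support k -> centroid_support l -> centroid_support (k - l).
Proof.
move=> [c cH [x cx]] [d dH d0]; have [d' [d'H dK _]] := homog_centroid_inv dH d0.
by exists (c \o d'); [apply: homog_centroid_comp|exists (d x); rewrite /= dK].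
Qed.

Lemma centroid_finite_components c : is_centroid A c ->
  exists2 s : seq G, uniq s & forall x, c x = \sum_(k <- s) centroid_component c k x.
Proof.
move=> cC; have [[x1 /(nonzero_proj gA)[g0]]] := gsA; set x0 := proj A g0 x1 => x0n _.
have cH k := homog_centroid_component k cC.
pose s := undup [seq h - g0 | h <- degs (c x0)].
have outside_s k : k \notin s -> forall x, centroid_component c k x = 0.
  move=> ks; apply: (homog_centroid_eq0 (cH k) x0n).
  rewrite (centroid_componentH k cC (proj_in gA g0 x1)).
  apply: contraNeq ks; rewrite -mem_degs => gx; rewrite mem_undup.
  by apply/mapP; exists (k + g0); rewrite ?addrK.
exists s; rewrite ?undup_uniq //; apply: (linear_homog_ext gA) => [||g x xg].
- exact: centroid_linear cC.
- move=> a x y; rewrite scaler_sumr -big_split; apply: eq_bigr => k _ /=.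
  by rewrite (centroid_linear (cH k).1).
apply: (proj_ext gA) => h; rewrite (lin_sum (proj_linear gA h)).
rewrite (eq_bigr (fun k => if k == h - g then proj A h (centroid_component c k x) else 0)).
  rewrite big_if_eq ?undup_uniq // => [|ne].
    by rewrite (centroid_componentH _ cC xg) subrK (proj_id gA (proj_in gA _ _)).
  by apply: contraNT ne => hs; rewrite outside_s // (lin0 (proj_linear gA h)).
move=> k _; rewrite (projH gA h ((cH k).2 g x xg)) -(inj_eq (addIr g) k) subrK.
by case: ifP.
Qed.
End GradedSimple.
End Centroid.
Arguments homog_centroid {F G} A k c : rename.

Section CentroidAlgebra.
Variables (F : fieldType) (G : zmodType) (A : galg F G).
Hypothesis gA : is_galg A.
Local Notation C := (centroid_alg A).

Definition cent_fun (c : gcar C) : gcar A -> gcar A := sp_val (c : spanT (cent_gen A)).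
Definition cent_elt (c : gcar A -> gcar A) : gcar C :=
  insubd (0 : spanT (cent_gen A)) (c : funT (gcar A) (gcar A)).

Lemma cent_fun_centroid c : is_centroid A (cent_fun c).
Proof.
have := sp_valP (c : spanT (cent_gen A)); rewrite unfold_in => /asboolP in_span.
have /asboolP // : sp_val (c : spanT (cent_gen A)) \in cent_gen A.
apply: in_span => // [|a x y /asboolP xC /asboolP yC]; apply/asboolP; first exact: centroid0.
exact: centroid_lin_comb.
Qed.

Lemma cent_eltK c : is_centroid A c -> cent_fun (cent_elt c) = c.
Proof.
move=> cC; apply: (insubdK (0 : spanT (cent_gen A))); rewrite unfold_in; apply/asboolP => Q _ _.
by apply; rewrite unfold_in; apply/asboolP.
Qed.

Lemma cent_fun_inj c d : cent_fun c =1 cent_fun d -> c = d.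
Proof. by move=> e; apply: val_inj; apply: functional_extensionality. Qed.

Lemma cent_fun_linear x : linear (fun c => cent_fun c x).
Proof. by []. Qed.

Lemma cent_fun_mul c d x : cent_fun (gmul C c d) x = cent_fun c (cent_fun d x).
Proof.
have cdC := centroid_comp (cent_fun_centroid c) (cent_fun_centroid d).
by rewrite -[gmul C c d]/(cent_elt (cent_fun c \o cent_fun d)) cent_eltK.
Qed.

Lemma cent_compP c g : reflect (homog_centroid A g (cent_fun c)) (c \in gcomp C g).
Proof.
by apply: (iffP (asboolP _)) => [cD|[]//]; split; first exact: cent_fun_centroid.
Qed.

Lemma cent_comp_direct (s : seq G) (f : G -> gcar C) : uniq s -> (forall g, f g \in gcomp C g) ->
  \sum_(g <- s) f g = 0 -> forall g, g \in s -> f g = 0.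
Proof.
move=> us fC s0 g gs; apply: cent_fun_inj; apply: (linear_homog_ext gA) => [||h x xh].
- exact: (centroid_linear (cent_fun_centroid _)).
- exact: linear_zero.
pose f' k := cent_fun (f (k - h)) x.
have f'E k : f' (k + h) = cent_fun (f k) x by rewrite /f' addrK.
have f'A k : f' k \in gcomp A k.
  by rewrite -[k in gcomp A k](subrK h); have /cent_compP[_] := fC (k - h); apply.
case: (gA) => _ [_ [_ [direct _]]]; rewrite -[LHS]f'E.
apply: (direct [seq k + h | k <- s] f') => //; last by apply/mapP; exists g.
  by rewrite map_inj_uniq //; apply: addIr.
by rewrite big_map (eq_bigr _ (fun k _ => f'E k)) -(lin_sum (cent_fun_linear x)) s0.
Qed.

Lemma centroid_galg : graded_simple A -> is_galg C.
Proof.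
move=> gsA; split; [split=> a x y z|split; [|split; [|split]]].
- by apply: cent_fun_inj => u; rewrite cent_fun_linear !cent_fun_mul.
- apply: cent_fun_inj => u; rewrite cent_fun_linear !cent_fun_mul cent_fun_linear.
  by rewrite (centroid_linear (cent_fun_centroid z)).
- move=> g; split=> [|a c d /cent_compP[_ cD] /cent_compP[_ dD]].
    by apply/asboolP => h x _; apply: (comp0 gA).
  by apply/asboolP => h x xh; apply: (comp_subspace gA _).2; [apply: cD|apply: dD].
- move=> c; have cC := cent_fun_centroid c.
  have [s _ sE] := centroid_finite_components gA gsA cC.
  have cH k := homog_centroid_component gA k cC.
  exists s, (fun k => cent_elt (centroid_component (cent_fun c) k)).
  split=> [k|]; first by apply/cent_compP; rewrite (cent_eltK (cH k).1).
  apply: cent_fun_inj => x; rewrite (lin_sum (cent_fun_linear x)) sE; apply: eq_bigr => k _.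
  by rewrite (cent_eltK (cH k).1).
- exact: cent_comp_direct.
- move=> g h c d /cent_compP cH /cent_compP dH; apply/cent_compP.
  have [_ cdD] := homog_centroid_comp cH dH; split; first exact: cent_fun_centroid.
  by move=> k x xk; rewrite cent_fun_mul; apply: cdD.
Qed.
End CentroidAlgebra.

(* A nonzero element [x0] of an ideal [I] with the fewest homogeneous components is determined,
   together with its multiples, by any one of its components: sending [x0]'s component of degree
   [g0] to [x0] extends to a centroid element [theta] of [A]. *)
Section MinimalSupport.
Variables (F : fieldType) (G : zmodType) (A : galg F G).
Hypotheses (gA : is_galg A) (gsA : graded_simple A).
Variables (I : pred (gcar A)) (x0 : gcar A) (g0 : G).
Hypotheses (idI : is_ideal A I) (x0I : x0 \in I) (x0_g0 : proj A g0 x0 != 0).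
Hypothesis x0_min : forall x, x \in I -> (size (degs x) < size (degs x0))%N -> x = 0.

Let I_sub : subspace I := idI.1.

Let aligned (g : G) : pred (gcar A) :=
  pred_of_Prop (fun w => w \in I /\ forall h, proj A h w != 0 -> h - g + g0 \in degs x0).

Let aligned_subspace g : subspace (aligned g).
Proof.
have pL := proj_linear gA.
split=> [|a w w' /pred_of_PropP[wI ws] /pred_of_PropP[wI' ws']]; apply/pred_of_PropP.
  by split=> [|h]; [apply: (subspace0 I_sub)|rewrite (lin0 (pL h)) eqxx].
split=> [|h]; first exact: I_sub.2.
have [w0|/ws //] := eqVneq (proj A h w) 0.
by rewrite pL w0 scaler0 add0r; apply: ws'.
Qed.

Let aligned_eq0 g w : w \in aligned g -> proj A g w = 0 -> w = 0.
Proof.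
move=> /pred_of_PropP[wI ws] gw; apply: x0_min => //.
have sub_rem : {subset [seq h - g + g0 | h <- degs w] <= rem g0 (degs x0)}.
  move=> _ /mapP[h + ->]; rewrite mem_degs mem_rem_uniq ?degs_uniq // !inE => hw.
  rewrite ws // andbT; apply: contraNneq hw => e; suff -> : h = g by rewrite gw.
  by apply/subr0_eq/(addIr g0); rewrite e add0r.
have inj_shift : injective (fun h => h - g + g0) by move=> h k /addIr/addIr.
have := uniq_leq_size _ sub_rem; rewrite map_inj_uniq // degs_uniq // size_map => /(_ isT).
rewrite size_rem ?mem_degs // => /leq_ltn_trans; apply; rewrite prednK //.
by rewrite -has_predT; apply/hasP; exists g0; rewrite ?mem_degs.
Qed.

Let aligned_eq g w w' : w \in aligned g -> w' \in aligned g -> proj A g w = proj A g w' -> w = w'.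
Proof.
move=> wT wT' e; apply/subr0_eq/(@aligned_eq0 g); last by rewrite (linB (proj_linear gA g)) e subrr.
by rewrite addrC -scaleN1r; apply: (aligned_subspace g).2.
Qed.

Let aligned_mulr g h w b : w \in aligned g -> b \in gcomp A h -> gmul A w b \in aligned (g + h).
Proof.
move=> /pred_of_PropP[wI ws] bh; apply/pred_of_PropP; split=> [|k]; first exact: (idI.2 _ _ wI).1.
rewrite (proj_mulr gA _ _ bh) => kw; rewrite [g + h]addrC opprD addrA; apply: ws.
by apply: contraNneq kw => ->; rewrite (gmul0l gA).
Qed.

Let aligned_mull g h w b : w \in aligned g -> b \in gcomp A h -> gmul A b w \in aligned (h + g).
Proof.
move=> /pred_of_PropP[wI ws] bh; apply/pred_of_PropP; split=> [|k]; first exact: (idI.2 _ _ wI).2.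
rewrite (proj_mull gA _ _ bh) => kw; rewrite opprD addrA; apply: ws.
by apply: contraNneq kw => ->; rewrite (gmul0r gA).
Qed.

Let x0_aligned : x0 \in aligned g0.
Proof. by apply/pred_of_PropP; split=> // h; rewrite subrK mem_degs. Qed.

Let liftable : pred (gcar A) := pred_of_Prop (fun y =>
  forall g, y \in [pred y | proj A g y \in
    pred_of_Prop (fun z => exists2 w, w \in aligned g & proj A g w = z)]).

Let liftableP y :
  reflect (forall g, exists2 w, w \in aligned g & proj A g w = proj A g y) (y \in liftable).
Proof.
by apply: (iffP (pred_of_PropP _ _)) => lift g; have := lift g; rewrite inE => /pred_of_PropP.
Qed.

Let liftable_ideal : is_ideal A liftable.
Proof.
have pL := proj_linear gA; apply: (ideal_homog_intro gA) => [|h x y /liftableP xT yh].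
  by apply: subspace_forall => g; apply: (subspace_preim (pL g)); apply: (subspace_image (pL g)).
split; apply/liftableP => g; have [w wT wE] := xT (g - h).
  exists (gmul A w y); first by rewrite -[g](subrK h); apply: aligned_mulr.
  by rewrite !(proj_mulr gA _ _ yh) wE.
exists (gmul A y w); first by rewrite -[g](subrKC h); apply: aligned_mull.
by rewrite !(proj_mull gA _ _ yh) wE.
Qed.

Let liftable_full y : y \in liftable.
Proof.
apply: (graded_simple_full gA gsA liftable_ideal (proj_in gA g0 x0) _ x0_g0).
apply/liftableP => g; rewrite (projH gA g (proj_in gA g0 x0)); case: eqP => [<-|_].
  by exists x0.
by exists 0; [apply: subspace0|rewrite (lin0 (proj_linear gA g))].
Qed.

Lemma minimal_support_centroid : exists2 theta, is_centroid A theta & theta (proj A g0 x0) = x0.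
Proof.
have pL := proj_linear gA.
have /functional_choice[w wP] (gy : G * gcar A) : exists w,
    w \in aligned gy.1 /\ proj A gy.1 w = proj A gy.1 gy.2.
  by have /liftableP/(_ gy.1)[w] := liftable_full gy.2; exists w.
have w_in g y : w (g, y) \in aligned g := (wP (g, y)).1.
have w_proj g y : proj A g (w (g, y)) = proj A g y := (wP (g, y)).2.
have w_lin g : linear (fun y => w (g, y)).
  move=> a x y; apply: (@aligned_eq g) => //; first exact: (aligned_subspace g).2.
  by rewrite pL !w_proj pL.
exists (glue (fun g y => w (g, y))).
  apply: (centroid_glue gA) => // g h x y xg yh; split; apply: (@aligned_eq (g + h)) => //.
  - exact: aligned_mulr.
  - by rewrite w_proj !(proj_mulr gA _ _ yh) addrK w_proj.
  - exact: aligned_mull.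
  - by rewrite w_proj !(proj_mull gA _ _ xg) [g + h]addrC addrK w_proj.
rewrite (glueH gA w_lin (proj_in gA g0 x0)); apply: (@aligned_eq g0 _ _ _ x0_aligned) => //.
by rewrite w_proj (proj_id gA (proj_in gA _ _)).
Qed.
End MinimalSupport.

Section CentroidInDegreeZero.
Variables (F : fieldType) (G : zmodType) (A : galg F G).
Hypotheses (gA : is_galg A) (gsA : graded_simple A).
Hypothesis centroid_support_trivial : forall k, centroid_support A k -> k = 0.

Lemma centroid_deg0 c : is_centroid A c -> centroid_deg A 0 c.
Proof.
move=> cC g x xg; rewrite add0r; suff -> : c x = proj A g (c x) by apply: proj_in.
apply: (proj_ext gA) => h; rewrite (projH gA h (proj_in gA g _)); case: eqP => [-> //|/eqP gh].
have cH := homog_centroid_component gA (h - g) cC.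
rewrite -[h](subrK g) -(centroid_componentH gA _ cC xg); apply/eqP.
apply: contraNT gh => cx; rewrite eq_sym -subr_eq0; apply/eqP/centroid_support_trivial.
by exists (centroid_component c (h - g)) => //; exists x.
Qed.

Lemma graded_simple_simple : simple A.
Proof.
case: (gsA) => nzA [sqA _]; split=> //; split=> // I idI.
have [|[x xI x_neq0]] := subspace_trivial_or_nonzero I; [by left|right].
pose size_attained n := asbool (exists x, [/\ x \in I, x != 0 & size (degs x) = n]).
have ex_size : exists n, size_attained n by exists (size (degs x)); apply/asboolP; exists x.
have [n /asboolP[x0 [x0I x0n <-]] size_min] := ex_minnP ex_size.
have [g0 gx0] := nonzero_proj gA x0n.
have x0_min y : y \in I -> (size (degs y) < size (degs x0))%N -> y = 0.
  move=> yI; apply: contraTeq => y0; rewrite -leqNgt; apply: size_min.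
  by apply/asboolP; exists y.
have [theta thC thE] := minimal_support_centroid gA gsA idI x0I gx0 x0_min.
have := centroid_deg0 thC (proj_in gA g0 x0); rewrite thE add0r => x0H.
exact: (graded_simple_full gA gsA idI x0H).
Qed.

Lemma graded_central_central : graded_central A -> central A.
Proof. by move=> gcA c cC; apply: gcA cC (centroid_deg0 cC). Qed.
End CentroidInDegreeZero.

Section Transport.
Variables (F : fieldType) (G : zmodType) (A B : galg F G).
Variables (f : gcar A -> gcar B) (f' : gcar B -> gcar A).
Hypothesis fI : graded_iso f f'.

Lemma iso_homog_centroid k c : homog_centroid A k c -> homog_centroid B k (f \o c \o f').
Proof.
have [fL fK f'K fM fA f'A] := fI; have [f'L _ _ f'M _ _] := graded_iso_sym fI.
move=> [[cL cM] cD]; split; last by move=> g y yg; apply/fA/cD/f'A.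
split=> [|x y] /=; first exact: (linear_comp fL (linear_comp cL f'L)).
by rewrite f'M {1}(cM _ _).1 (cM _ _).2 !fM !f'K.
Qed.

Lemma iso_centroid_support k : centroid_support A k -> centroid_support B k.
Proof.
move=> [c cH [x cx]]; exists (f \o c \o f'); first exact: iso_homog_centroid.
have [fL fK _ _ _ _] := fI; exists (f x); rewrite /= fK.
by apply: contraNneq cx => /(congr1 f'); rewrite -(lin0 fL) !fK => ->.
Qed.
End Transport.

Lemma iso_graded_central_simple (F : fieldType) (G : zmodType) (A B : galg F G)
    (f : gcar A -> gcar B) (f' : gcar B -> gcar A) :
  is_galg A -> is_galg B -> graded_iso f f' ->
  graded_central_simple A -> graded_central_simple B.
Proof.
move=> gA gB fI [gsA gcA]; have f'I := graded_iso_sym fI.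
have [fL fK f'K fM fA f'A] := fI; have [f'L _ _ f'M _ _] := f'I.
split; last first.
  move=> c cC cD; have [dC dD] := iso_homog_centroid f'I (conj cC cD).
  have [lam lamE] := gcA _ dC dD; exists lam => x.
  by apply: (can_inj f'K); rewrite (linZ f'L) -lamE /= f'K.
have [[x x0] [sqA _]] := gsA; apply: (graded_simple_intro gB).
- by exists (f x); apply: contraNneq x0 => e; rewrite -(fK x) e (lin0 f'L).
- apply: sq_full_intro => P P_sub PM y; rewrite -[y]f'K.
  rewrite -[f _ \in P]/(f' y \in [pred z | f z \in P]).
  apply: (sq_full_spanning sqA (subspace_preim fL P_sub)) => u v.
  by rewrite inE fM.
- move=> I g y [I_sub idI] _ yg yI y0 z; rewrite -[z]f'K.
  rewrite -[f _ \in I]/(f' z \in [pred u | f u \in I]).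
  apply: (graded_simple_full gA gsA (x := f' y) (g := g)); rewrite ?inE ?f'K //; last 2 first.
  + exact: f'A.
  + by apply: contraNneq y0 => e; rewrite -(f'K y) e (lin0 fL).
  split=> [|u v]; first exact: (subspace_preim fL I_sub).
  by rewrite !inE !fM; apply: idI.
Qed.

(** * Loop algebras *)

Section Convolution.
Variables (F : fieldType) (G : zmodType) (V : lmodType F) (m : V -> V -> V).
Hypothesis m_linl : forall w, linear (m^~ w).
Hypothesis m_linr : forall v, linear (m v).

Lemma conv_sub (r s : seq G) (f f' : funT G V) k : finsupp f -> finsupp f' ->
  uniq r -> uniq s -> supported_on r f -> supported_on s f' ->
  conv m f f' k = \sum_(g <- r) \sum_(h <- s) (if g + h == k then m (f g) (f' h) else 0).
Proof.
move=> /fsuppP[uf fs] /fsuppP[uf' fs'] ur us fr f's.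
have inner_sum g : \sum_(h <- fsupp f') (if g + h == k then m (f g) (f' h) else 0) =
    \sum_(h <- s) (if g + h == k then m (f g) (f' h) else 0).
  apply: eq_big_supp => // h ne; suff f'h : f' h != 0 by rewrite fs' // f's.
  by apply: contraNneq ne => ->; rewrite (lin0 (m_linr _)) if_same.
rewrite /conv (eq_bigr _ (fun g _ => inner_sum g)); apply: eq_big_supp => // g ne.
suff fg : f g != 0 by rewrite fs // fr.
by apply: contraNneq ne => ->; rewrite big1 // => h _; rewrite (lin0 (m_linl _)) if_same.
Qed.

Lemma conv_linearl (f1 f2 e : funT G V) a k : finsupp f1 -> finsupp f2 -> finsupp e ->
  conv m (a *: f1 + f2) e k = a *: conv m f1 e k + conv m f2 e k.
Proof.
move=> fin1 fin2 fin_e; have [r [ur sr1 sr2 /(_ a) sr12]] := common_support fin1 fin2.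
have [s [us se _ _]] := common_support fin_e fin_e.
rewrite !(conv_sub (r := r) (s := s)) //; last by exists r.
rewrite scaler_sumr -big_split; apply: eq_bigr => g _ /=.
rewrite scaler_sumr -big_split; apply: eq_bigr => h _ /=.
by rewrite fun_at_linear m_linl; case: ifP => // _; rewrite scaler0 addr0.
Qed.

End Convolution.

Lemma conv_flip (F : fieldType) (G : zmodType) (V : lmodType F) (m : V -> V -> V)
    (f f' : funT G V) : conv m f f' = conv (fun v w => m w v) f' f.
Proof.
apply: functional_extensionality => k; rewrite /conv exchange_big; apply: eq_bigr => h _.
by apply: eq_bigr => g _; rewrite addrC.
Qed.

(* The external direct sum of the subspaces [P g] of [V], with the product induced by [m]:
   loop algebras and the algebras they are built from are of this form. *)
Section DirectSum.
Variables (F : fieldType) (G : zmodType) (V : lmodType F) (m : V -> V -> V).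
Variables (P : G -> pred V) (p : G -> V -> V).

Definition dsum_gen : pred (funT G V) :=
  fun f => asbool (exists g v, v \in P g /\ f = fdelta g v).
Definition dsum_alg : galg F G := @GAlg F G (spanT dsum_gen)
  (fun x y => insubd (0 : spanT dsum_gen) (conv m (sp_val x) (sp_val y)))
  (fun g x => asbool ((forall k, k != g -> sp_val x k = 0) /\ sp_val x g \in P g)).

Hypothesis p_lin : forall g, linear (p g).
Hypothesis p_in : forall g v, p g v \in P g.
Hypothesis p_id : forall g v, v \in P g -> p g v = v.
Hypothesis m_linl : forall w, linear (m^~ w).
Hypothesis m_linr : forall v, linear (m v).
Hypothesis mP : forall g h v w, v \in P g -> w \in P h -> m v w \in P (g + h).

Let P_sub g : subspace (P g).
Proof.
split=> [|a v w vP wP]; first by rewrite -(lin0 (p_lin g)); apply: p_in.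
by rewrite -(p_id vP) -(p_id wP) -p_lin; apply: p_in.
Qed.

Lemma dsum_spanP f : reflect (finsupp f /\ forall g, f g \in P g) (f \in spanP dsum_gen).
Proof.
apply: (iffP idP) => [|[[s fs] fP]].
  rewrite unfold_in => /asboolP f_span.
  pose Q := pred_of_Prop (fun f : funT G V => finsupp f /\ forall g, f g \in P g).
  suff /pred_of_PropP : f \in Q by [].
  apply: f_span => [|a x y|_ /asboolP[g [v [vP ->]]]].
  - apply/pred_of_PropP; split=> [|g]; last exact: (subspace0 (P_sub g)).
    by exists [::] => g; rewrite eqxx.
  - move=> /pred_of_PropP[xs xP] /pred_of_PropP[ys yP]; apply/pred_of_PropP.
    by split=> [|g]; [have [s [_ _ _ /(_ a)]] := common_support xs ys; exists s|apply: (P_sub g).2].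
  - apply/pred_of_PropP; split=> [|k].
      by exists [:: g] => k; rewrite inE /fdelta; case: ifP; rewrite ?eqxx.
    by rewrite /fdelta; case: eqP => [->|_] //; apply: (subspace0 (P_sub k)).
have -> : f = \sum_(g <- undup s) fdelta g (f g).
  by apply: fdelta_sum (undup_uniq s) _ => g /fs; rewrite mem_undup.
apply: rpred_sum => g _; rewrite unfold_in; apply/asboolP => Q _ _; apply.
by rewrite unfold_in; apply/asboolP; exists g, (f g).
Qed.

Definition dsum_at (x : gcar dsum_alg) (g : G) : V := sp_val (x : spanT dsum_gen) g.
Definition dsum_in (g : G) (v : V) : gcar dsum_alg :=
  insubd (0 : spanT dsum_gen) (fdelta g (p g v)).

Lemma dsum_finsupp (x : gcar dsum_alg) : finsupp (dsum_at x).
Proof. by have /dsum_spanP[] := sp_valP (x : spanT dsum_gen). Qed.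

Lemma dsum_at_in x g : dsum_at x g \in P g.
Proof. by have /dsum_spanP[] := sp_valP (x : spanT dsum_gen). Qed.

Lemma dsum_at_linear g : linear (dsum_at^~ g).
Proof. by []. Qed.

Lemma dsum_at_inj x y : dsum_at x =1 dsum_at y -> x = y.
Proof. by move=> e; apply/val_inj/functional_extensionality. Qed.

Lemma dsum_inE g v k : dsum_at (dsum_in g v) k = if k == g then p g v else 0.
Proof.
suff -> : dsum_at (dsum_in g v) = fdelta g (p g v) by [].
apply: (insubdK (0 : spanT dsum_gen)); rewrite unfold_in; apply/asboolP => Q _ _; apply.
by rewrite unfold_in; apply/asboolP; exists g, (p g v).
Qed.

Lemma dsum_in_at g v : v \in P g -> dsum_at (dsum_in g v) g = v.
Proof. by move=> vP; rewrite dsum_inE eqxx p_id. Qed.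

Lemma dsum_in_linear g : linear (dsum_in g).
Proof.
move=> a v w; apply: dsum_at_inj => k; rewrite dsum_at_linear !dsum_inE p_lin.
by case: ifP => // _; rewrite scaler0 addr0.
Qed.

Lemma dsum_compP g x :
  reflect ((forall k, k != g -> dsum_at x k = 0) /\ dsum_at x g \in P g) (x \in gcomp dsum_alg g).
Proof. exact: asboolP. Qed.

Lemma dsum_in_comp g v : dsum_in g v \in gcomp dsum_alg g.
Proof.
by apply/dsum_compP; split=> [k /negbTE kg|]; rewrite dsum_inE ?kg // eqxx.
Qed.

Lemma dsum_atK g x : x \in gcomp dsum_alg g -> dsum_in g (dsum_at x g) = x.
Proof.
move=> /dsum_compP[x0 xP]; apply: dsum_at_inj => k; rewrite dsum_inE p_id //.
by case: eqP => [->|/eqP/x0].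
Qed.

Lemma dsum_mulE x y : dsum_at (gmul dsum_alg x y) = conv m (dsum_at x) (dsum_at y).
Proof.
apply: (insubdK (0 : spanT dsum_gen)); apply/dsum_spanP; split=> [|k]; last first.
  apply: (subspace_sum (P_sub k)) => g; apply: (subspace_sum (P_sub k)) => h.
  by case: eqP => [<-|_]; [apply: mP; apply: dsum_at_in|apply: (subspace0 (P_sub k))].
exists [seq g + h | g <- fsupp (dsum_at x), h <- fsupp (dsum_at y)] => k; apply: contraNT => kxy.
rewrite /conv big_seq big1 // => g gs; rewrite big_seq big1 // => h hs.
by case: eqP => // e; case/negP: kxy; rewrite -e; apply: allpairs_f.
Qed.

Lemma dsum_in_mul g h v w : v \in P g -> w \in P h ->
  gmul dsum_alg (dsum_in g v) (dsum_in h w) = dsum_in (g + h) (m v w).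
Proof.
move=> vP wP; apply: dsum_at_inj => k; rewrite dsum_mulE.
rewrite (@conv_sub _ _ _ m m_linl m_linr [:: g] [:: h]) //; try exact: dsum_finsupp.
- by rewrite !big_seq1 !dsum_in_at // dsum_inE eq_sym p_id ?mP.
- by move=> g'; rewrite dsum_inE inE; case: ifP; rewrite ?eqxx.
- by move=> h'; rewrite dsum_inE inE; case: ifP; rewrite ?eqxx.
Qed.

Lemma dsum_galg : is_galg dsum_alg.
Proof.
split; first split=> a x y z.
- apply: dsum_at_inj => k; rewrite dsum_at_linear !dsum_mulE.
  by apply: conv_linearl => //; apply: dsum_finsupp.
- apply: dsum_at_inj => k; rewrite dsum_at_linear !dsum_mulE.
  by rewrite !(conv_flip m); apply: conv_linearl => //; apply: dsum_finsupp.
split; [|split; [|split]].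
- move=> g; split=> [|a x y /dsum_compP[x0 xP] /dsum_compP[y0 yP]]; apply/dsum_compP.
    by split=> //; apply: (subspace0 (P_sub g)).
  split=> [k kg|]; last exact: (P_sub g).2.
  by rewrite dsum_at_linear x0 // y0 // scaler0 addr0.
- move=> x; have [us xs] := fsuppP (dsum_finsupp x).
  exists (fsupp (dsum_at x)), (fun g => dsum_in g (dsum_at x g)).
  split=> [g|]; first exact: dsum_in_comp.
  apply: dsum_at_inj => k; rewrite (lin_sum (dsum_at_linear k)).
  rewrite (eq_bigr (fun g => if g == k then dsum_at x g else 0)) ?big_if_eq //; first exact: xs.
  by move=> g _; rewrite dsum_inE eq_sym p_id //; apply: dsum_at_in.
- move=> s f us fP s0 g gs; rewrite -(dsum_atK (fP g)).
  suff -> : dsum_at (f g) g = 0 by rewrite (lin0 (dsum_in_linear g)).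
  have <- : dsum_at (\sum_(h <- s) f h) g = dsum_at (f g) g; last by rewrite s0.
  rewrite (lin_sum (dsum_at_linear g)) (bigD1_seq g) //= big1 ?addr0 // => h hg.
  by have /dsum_compP[f0 _] := fP h; rewrite f0 // eq_sym.
- move=> g h x y xg yh; rewrite -(dsum_atK xg) -(dsum_atK yh) dsum_in_mul ?dsum_at_in //.
  exact: dsum_in_comp.
Qed.
End DirectSum.

Section LoopAlgebra.
Variables (F : fieldType) (G Gb : zmodType) (pi : {additive G -> Gb}).
Variables (A : galg F Gb) (t : G -> G -> F).
Hypothesis gA : is_galg A.
Local Notation L := (tloop pi A t).

Let P (g : G) : pred (gcar A) := gcomp A (pi g).
Let p (g : G) : gcar A -> gcar A := proj A (pi g).
Let p_lin g : linear (p g). Proof. exact: proj_linear. Qed.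
Let p_in g v : p g v \in P g. Proof. exact: proj_in. Qed.
Let p_id g v : v \in P g -> p g v = v. Proof. exact: proj_id. Qed.
Let mP g h v w : v \in P g -> w \in P h -> gmul A v w \in P (g + h).
Proof. by rewrite /P raddfD; apply: comp_mul. Qed.

Let untwisted_galg : is_galg (loop pi A).
Proof. exact: (dsum_galg p_lin p_in p_id (gmull_linear gA) (gmulr_linear gA) mP). Qed.

Lemma tloop_galg : is_galg L.
Proof. exact: twist_galg. Qed.

Definition loop_at (x : gcar L) (g : G) : gcar A := @dsum_at F G _ (gmul A) P x g.

(* The element [v g] of [L] when [v] is homogeneous of degree [pi g]; other components of [v]
   are discarded, so that [loop_in g] is linear on all of [A]. *)
Definition loop_in (g : G) (v : gcar A) : gcar L := dsum_in (gmul A) P p g v.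

Lemma loop_at_linear g : linear (loop_at^~ g).
Proof. exact: dsum_at_linear. Qed.
Lemma loop_at_comp x g : loop_at x g \in gcomp A (pi g).
Proof. exact: (dsum_at_in p_lin p_in p_id). Qed.
Lemma loop_in_linear g : linear (loop_in g).
Proof. exact: dsum_in_linear. Qed.
Lemma loop_in_comp g v : loop_in g v \in gcomp L g.
Proof. exact: dsum_in_comp. Qed.
Lemma loop_inK g v : v \in gcomp A (pi g) -> loop_at (loop_in g v) g = v.
Proof. exact: (dsum_in_at (gmul A) p_in p_id). Qed.
Lemma loop_atK g x : x \in gcomp L g -> loop_in g (loop_at x g) = x.
Proof. exact: (dsum_atK p_in p_id). Qed.

Lemma loop_at_loop_in g v h :
  loop_at (loop_in g v) h = if h == g then proj A (pi g) v else 0.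
Proof. exact: dsum_inE. Qed.

Lemma loop_in_eq0 g v : v \in gcomp A (pi g) -> loop_in g v = 0 -> v = 0.
Proof. by move=> vg v0; rewrite -(loop_inK vg) v0. Qed.

Lemma scale_loop_in_inj a g v w : a != 0 -> v \in gcomp A (pi g) -> w \in gcomp A (pi g) ->
  a *: loop_in g v = a *: loop_in g w -> v = w.
Proof. by move=> a0 vg wg /(scalerI a0)/(congr1 (loop_at^~ g)); rewrite !loop_inK. Qed.

Lemma loop_in_proj g v : loop_in g (proj A (pi g) v) = loop_in g v.
Proof.
apply: dsum_at_inj => k; rewrite /loop_in !(dsum_inE _ p_in).
by rewrite /p (proj_id gA (proj_in gA _ _)).
Qed.

Lemma loop_in_mull g h v w : v \in gcomp A (pi g) ->
  gmul L (loop_in g v) (loop_in h w) = t g h *: loop_in (g + h) (gmul A v w).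
Proof.
move=> vg; rewrite -(loop_in_proj h) -[in RHS]loop_in_proj raddfD.
rewrite (proj_mull gA _ _ vg) [pi g + _]addrC addrK.
rewrite (twist_mulH untwisted_galg _ (loop_in_comp g v) (loop_in_comp h _)); congr (_ *: _).
have wh := proj_in gA (pi h) w.
exact: (dsum_in_mul p_lin p_in p_id (gmull_linear gA) (gmulr_linear gA) mP vg wh).
Qed.

Lemma loop_in_mulr g h v w : w \in gcomp A (pi h) ->
  gmul L (loop_in g v) (loop_in h w) = t g h *: loop_in (g + h) (gmul A v w).
Proof.
move=> wh; rewrite -(loop_in_proj g) loop_in_mull ?proj_in //; congr (_ *: _).
by rewrite -[RHS]loop_in_proj raddfD (proj_mulr gA _ _ wh) addrK.
Qed.

Lemma loop_in_spanning (Q : pred (gcar L)) : subspace Q ->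
  (forall g v, v \in gcomp A (pi g) -> loop_in g v \in Q) -> forall x, x \in Q.
Proof.
move=> Q_sub QL; apply: (homog_spanning tloop_galg Q_sub) => g x xg.
by rewrite -(loop_atK xg); apply/QL/loop_at_comp.
Qed.

Lemma linear_loop_ext (V : lmodType F) (f1 f2 : gcar L -> V) : linear f1 -> linear f2 ->
  (forall g v, v \in gcomp A (pi g) -> f1 (loop_in g v) = f2 (loop_in g v)) -> f1 =1 f2.
Proof.
move=> f1L f2L f12; apply: (linear_homog_ext tloop_galg f1L f2L) => g x xg.
by rewrite -(loop_atK xg); apply/f12/loop_at_comp.
Qed.

Lemma loop_in_at g x : loop_in g (loop_at x g) = proj L g x.
Proof.
have gL := tloop_galg; move: x; apply: linear_loop_ext => [||h v vh].
- exact: linear_comp (loop_in_linear g) (loop_at_linear g).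
- exact: proj_linear gL g.
rewrite (projH gL g (loop_in_comp h v)) /loop_at /loop_in (dsum_inE _ p_in) eq_sym p_id //.
by case: eqP => [->|_] //; apply: (lin0 (loop_in_linear g)).
Qed.

Lemma loop_at_mulr h x w g : w \in gcomp A (pi h) ->
  loop_at (gmul L x (loop_in h w)) g = t (g - h) h *: gmul A (loop_at x (g - h)) w.
Proof.
move=> wh; have gL := tloop_galg.
have -> z : loop_at z g = loop_at (proj L g z) g by rewrite -loop_in_at loop_inK ?loop_at_comp.
rewrite (proj_mulr gL _ _ (loop_in_comp h w)) -loop_in_at loop_in_mull ?loop_at_comp // subrK.
rewrite (linZ (loop_at_linear g)) loop_inK // -[g in pi g](subrK h) raddfD.
exact: (comp_mul gA (loop_at_comp _ _)).
Qed.

Lemma loop_at_mull h x w g : w \in gcomp A (pi h) ->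
  loop_at (gmul L (loop_in h w) x) g = t h (g - h) *: gmul A w (loop_at x (g - h)).
Proof.
move=> wh; have gL := tloop_galg.
have -> z : loop_at z g = loop_at (proj L g z) g by rewrite -loop_in_at loop_inK ?loop_at_comp.
rewrite (proj_mull gL _ _ (loop_in_comp h w)) -loop_in_at loop_in_mull // subrKC.
rewrite (linZ (loop_at_linear g)) loop_inK // -[g in pi g](subrKC h) raddfD.
exact: (comp_mul gA wh (loop_at_comp _ _)).
Qed.

Lemma giso_tloop (B : galg F G) (rho : G -> gcar B -> gcar A) : is_galg B ->
  (forall g h, t g h != 0) ->
  (forall g, linear (rho g)) ->
  (forall g x, x \in gcomp B g -> rho g x \in gcomp A (pi g)) ->
  (forall g x, x \in gcomp B g -> rho g x = 0 -> x = 0) ->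
  (forall g v, v \in gcomp A (pi g) -> exists2 x, x \in gcomp B g & rho g x = v) ->
  (forall g h x y, x \in gcomp B g -> y \in gcomp B h ->
     rho (g + h) (gmul B x y) = t g h *: gmul A (rho g x) (rho h y)) ->
  giso B L.
Proof.
move=> gB t0 rhoL rhoA rho_inj rho_surj rhoM.
apply: (giso_intro (phi := fun g x => loop_in g (rho g x)) gB tloop_galg) => [g|g x xg|g x xg||].
- exact: (linear_comp (loop_in_linear g) (rhoL g)).
- exact: loop_in_comp.
- by move=> /(loop_in_eq0 (rhoA g x xg)); apply: rho_inj.
- move=> g y yg; have [x xg xE] := rho_surj _ _ (loop_at_comp y g).
  by exists x; rewrite ?xE ?loop_atK.
- move=> g h x y xg yh; rewrite rhoM // loop_in_mull ?rhoA //.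
  exact: (linZ (loop_in_linear _)).
Qed.
End LoopAlgebra.
Arguments loop_in {F G Gb pi A t} g v.
Arguments loop_at {F G Gb pi A t} x g.

(* [u h] behaves like multiplication by [X_h] in the twisted group algebra of the kernel of [pi]. *)
Definition twisted_kernel_action (F : fieldType) (G Gb : zmodType) (pi : G -> Gb) (B : galg F G)
    (u : G -> gcar B -> gcar B) (t : G -> G -> F) :=
  [/\ forall h, pi h = 0 -> homog_centroid B h (u h),
      forall h k x, pi h = 0 -> pi k = 0 -> u h (u k x) = t h k *: u (h + k) x &
      forall x, u 0 x = t 0 0 *: x].

Lemma twisted_kernel_action_inj (F : fieldType) (G Gb : zmodType) (pi : {additive G -> Gb})
    (B : galg F G) (u : G -> gcar B -> gcar B) (t : G -> G -> F) h :
  sym2cocycle t -> twisted_kernel_action pi u t -> pi h = 0 -> injective (u h).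
Proof.
move=> tC [_ uM u0] h0 x y /(congr1 (u (- h))).
rewrite !uM ?raddfN ?h0 ?oppr0 // addNr !u0 !scalerA => /scalerI; apply.
by rewrite mulf_neq0 ?cocycle_neq0.
Qed.

Section LoopCentroid.
Variables (F : fieldType) (G Gb : zmodType) (pi : {additive G -> Gb}) (s : Gb -> G).
Variables (A : galg F Gb) (t : G -> G -> F).
Hypotheses (sK : cancel s pi) (gA : is_galg A) (tC : sym2cocycle t).
Local Notation L := (tloop pi A t).
Let gL : is_galg L := tloop_galg pi t gA.

Lemma base_spanning (Q : pred (gcar A)) : subspace Q ->
  (forall g v, v \in gcomp A (pi g) -> v \in Q) -> forall v, v \in Q.
Proof. by move=> Q_sub QA; apply: (homog_spanning gA Q_sub) => a v; rewrite -(sK a); apply: QA. Qed.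

Lemma linear_base_ext (V : lmodType F) (f1 f2 : gcar A -> V) : linear f1 -> linear f2 ->
  (forall g v, v \in gcomp A (pi g) -> f1 v = f2 v) -> f1 =1 f2.
Proof.
move=> f1L f2L f12; apply: (linear_homog_ext gA f1L f2L) => a v.
by rewrite -(sK a); apply: f12.
Qed.

Section Lift.
Variables (k : G) (d : gcar A -> gcar A).
Hypothesis d_lin : linear d.

Definition loop_lift : gcar L -> gcar L :=
  glue (fun g x => t k g *: loop_in (k + g) (d (loop_at x g))).

Lemma loop_lift_family_linear g :
  linear (fun x : gcar L => t k g *: loop_in (k + g) (d (loop_at x g)) : gcar L).
Proof.
apply/linear_scale/(linear_comp (loop_in_linear pi t gA _)).
exact: linear_comp d_lin (loop_at_linear _).
Qed.

Lemma loop_lift_linear : linear loop_lift.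
Proof. exact: (glue_linear gL loop_lift_family_linear). Qed.

Lemma loop_liftE g v : v \in gcomp A (pi g) ->
  loop_lift (loop_in g v) = t k g *: loop_in (k + g) (d v).
Proof.
move=> vg; rewrite /loop_lift (glueH gL loop_lift_family_linear (loop_in_comp pi t gA g v)).
by rewrite loop_inK.
Qed.
End Lift.

Lemma homog_centroid_lift k d :
  homog_centroid A (pi k) d -> homog_centroid L k (loop_lift k d).
Proof.
move=> [[dL dM] dD].
have d_comp g v : v \in gcomp A (pi g) -> d v \in gcomp A (pi (k + g)).
  by rewrite raddfD; apply: dD.
split; last first.
  move=> g x xg; rewrite -(loop_atK gA xg) loop_liftE ?loop_at_comp //.
  by apply: (subspaceZ (comp_subspace gL _)); apply: loop_in_comp.
apply: (centroid_glue gL (loop_lift_family_linear k dL)) => g h x y xg yh.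
rewrite -(loop_atK gA xg) -(loop_atK gA yh) !loop_inK ?loop_at_comp //.
move: (loop_at x g) (loop_at_comp gA x g) (loop_at y h) (loop_at_comp gA y h) => v vg w wh.
have vw : gmul A v w \in gcomp A (pi (g + h)) by rewrite raddfD; apply: comp_mul.
rewrite loop_in_mull // (linZ (loop_at_linear _)) loop_inK // (linZ dL).
rewrite (linZ (loop_in_linear pi t gA _)) (gmulZl gL) (gmulZr gL) loop_in_mulr // loop_in_mull //.
rewrite -(dM _ _).1 -(dM _ _).2 !scalerA [g + (k + h)]addrCA -addrA; split; congr (_ *: _).
  by rewrite (cocycleA tC) mulrC.
by rewrite -(cocycleCA tC) mulrC.
Qed.

Lemma loop_lift_comp k l d e x : linear d -> homog_centroid A (pi l) e ->
  loop_lift k d (loop_lift l e x) = t k l *: loop_lift (k + l) (d \o e) x.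
Proof.
move=> dL [[eL _] eD]; have deL := linear_comp dL eL; move: x; apply: (linear_loop_ext gA).
- exact: linear_comp (loop_lift_linear k dL) (loop_lift_linear l eL).
- exact/linear_scale/loop_lift_linear.
move=> g v vg; rewrite !loop_liftE // (linZ (loop_lift_linear k dL)) loop_liftE ?raddfD ?eD //.
by rewrite !scalerA addrA (cocycleA tC).
Qed.

Lemma loop_lift0 x : loop_lift 0 id x = t 0 0 *: x.
Proof.
move: x; apply: (linear_loop_ext gA) => [||g v vg].
- exact: loop_lift_linear.
- exact: linear_scale.
by rewrite loop_liftE // add0r (cocycle0l tC).
Qed.

Lemma loop_lift_eq0 k d : homog_centroid A (pi k) d ->
  (forall x, loop_lift k d x = 0) -> forall v, d v = 0.
Proof.
move=> [[dL _] dD] lift0; apply: (linear_base_ext dL linear_zero) => g v vg.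
have /eqP := lift0 (loop_in g v); rewrite loop_liftE // scaler_eq0 (negbTE (cocycle_neq0 tC k g)).
by move=> /eqP; apply: (loop_in_eq0 gA); rewrite raddfD; apply: dD.
Qed.

Lemma loop_shift_action : twisted_kernel_action pi (loop_lift^~ id) t.
Proof.
have idH h : pi h = 0 -> homog_centroid A (pi h) id by move->; apply: homog_centroid_id.
split=> [h /idH|h k x _ /idH kH|x]; first exact: homog_centroid_lift.
  by rewrite (loop_lift_comp _ _ _ kH).
exact: loop_lift0.
Qed.

Section Descent.
Variables (k : G) (c : gcar L -> gcar L).
Hypotheses (cH : homog_centroid L k c) (sqL : sq_full L).

Let cL : linear c := centroid_linear cH.1.

Let D (g : G) (v : gcar A) : gcar A := (t k g)^-1 *: loop_at (c (loop_in g v)) (k + g).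

Let D_linear g : linear (D g).
Proof. exact/linear_scale/(linear_comp (loop_at_linear _))/(linear_comp cL)/loop_in_linear. Qed.

Let D_comp g v : D g v \in gcomp A (pi (k + g)).
Proof. exact/(subspaceZ (comp_subspace gA _))/loop_at_comp. Qed.

Let c_loop_in g v : c (loop_in g v) = t k g *: loop_in (k + g) (D g v).
Proof.
rewrite (linZ (loop_in_linear pi t gA _)) scalerA divff ?cocycle_neq0 // scale1r.
by rewrite loop_atK //; apply/cH.2/loop_in_comp.
Qed.

Let D_mull g h v w : v \in gcomp A (pi g) -> w \in gcomp A (pi h) ->
  D (g + h) (gmul A v w) = gmul A (D g v) w.
Proof.
move=> vg wh; have := (cH.1.2 (loop_in g v) (loop_in h w)).1.
rewrite loop_in_mull // (linZ cL) !c_loop_in (gmulZl gL) loop_in_mulr // !scalerA -addrA.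
rewrite (cocycleA tC); apply: (scale_loop_in_inj gA) => //.
  by rewrite mulf_neq0 ?cocycle_neq0.
by rewrite addrA raddfD; apply: comp_mul.
Qed.

Let D_mulr g h v w : v \in gcomp A (pi g) -> w \in gcomp A (pi h) ->
  D (g + h) (gmul A v w) = gmul A v (D h w).
Proof.
move=> vg wh; have := (cH.1.2 (loop_in g v) (loop_in h w)).2.
rewrite loop_in_mull // (linZ cL) !c_loop_in (gmulZr gL) loop_in_mull // !scalerA.
rewrite [g + (k + h)]addrCA (cocycleCA tC); apply: (scale_loop_in_inj gA) => //.
  by rewrite mulf_neq0 ?cocycle_neq0.
by rewrite addrCA raddfD; apply: comp_mul.
Qed.

(* [c] commutes with the centroid elements [loop_lift h id], so [D g] depends only on [pi g]. *)
Let D_shift g g' v : pi g = pi g' -> v \in gcomp A (pi g) -> D g v = D g' v.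
Proof.
move=> gg' vg; pose h := g' - g; have h0 : pi h = 0 by rewrite raddfB gg' subrr.
have hg : h + g = g' by rewrite subrK.
have [/(_ h h0)[uC _] _ _] := loop_shift_action.
have := centroid_comm (loop_in g v) sqL cH.1 uC.
rewrite loop_liftE // (linZ cL) !c_loop_in (linZ (centroid_linear uC)) loop_liftE // !scalerA.
rewrite (cocycleCA tC h) [h + (k + g)]addrCA hg => e.
apply: (scale_loop_in_inj gA) (esym e); rewrite ?mulf_neq0 ?cocycle_neq0 //.
by have := D_comp g v; rewrite !raddfD gg'.
Qed.

Lemma homog_centroid_descent :
  exists2 d, homog_centroid A (pi k) d & c =1 loop_lift k d.
Proof.
pose d := glue (fun a v => D (s a) v); have dL : linear d by apply: (glue_linear gA) => a.
have dE g v : v \in gcomp A (pi g) -> d v = D g v.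
  move=> vg; rewrite /d (glueH gA (fun a => D_linear (s a)) vg); apply: D_shift; rewrite ?sK //.
exists d; last first.
  apply: (linear_loop_ext gA cL (loop_lift_linear k dL)) => g v vg.
  by rewrite c_loop_in loop_liftE // (dE g v vg).
split; last first.
  by move=> a v; rewrite -(sK a) => va; rewrite (dE _ v va) -raddfD.
apply: (centroid_glue gA) => // a b v w va wb.
have -> : D (s (a + b)) (gmul A v w) = D (s a + s b) (gmul A v w).
  by apply: D_shift; rewrite ?raddfD ?sK //; apply: comp_mul.
by split; [apply: D_mull|apply: D_mulr]; rewrite sK.
Qed.
End Descent.
End LoopCentroid.

Lemma simple_graded_simple (F : fieldType) (G : zmodType) (A : galg F G) :
  simple A -> graded_simple A.
Proof. by move=> [nzA [sqA simpA]]; split=> //; split=> // I idI _; apply: simpA. Qed.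

Section LoopSimplicity.
Variables (F : fieldType) (G Gb : zmodType) (pi : {additive G -> Gb}) (s : Gb -> G).
Variables (A : galg F Gb) (t : G -> G -> F).
Hypotheses (sK : cancel s pi) (gA : is_galg A) (tC : sym2cocycle t).
Local Notation L := (tloop pi A t).
Local Notation inL := (@loop_in F G Gb pi A t).
Let gL : is_galg L := tloop_galg pi t gA.
Let inL_linear g : linear (inL g) := loop_in_linear pi t gA g.

Definition loop_eval : gcar L -> gcar A := glue (fun g x => loop_at x g).

Lemma loop_eval_linear : linear loop_eval.
Proof. by apply: (glue_linear gL) => g; apply: loop_at_linear. Qed.

Lemma loop_eval_in g v : v \in gcomp A (pi g) -> loop_eval (loop_in g v) = v.
Proof.
move=> vg; rewrite /loop_eval (glueH gL (@loop_at_linear _ _ _ pi A t) (loop_in_comp pi t gA g v)).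
exact: loop_inK.
Qed.

Lemma loop_eval_sum x : loop_eval x = \sum_(g <- degs x) loop_at x g.
Proof.
by apply: eq_bigr => g _; rewrite -loop_in_at // loop_inK // loop_at_comp.
Qed.

Lemma loop_eval_surj v : exists x, loop_eval x = v.
Proof.
pose im := pred_of_Prop (fun v => exists2 x, x \in (predT : pred (gcar L)) & loop_eval x = v).
suff /pred_of_PropP[x _ <-] : v \in im by exists x.
apply: (base_spanning sK gA (subspace_image loop_eval_linear _)) => // g w wg.
by apply/pred_of_PropP; exists (loop_in g w); rewrite ?loop_eval_in.
Qed.

Lemma loop_nonzero : nonzero L <-> nonzero A.
Proof.
split=> [[x x0]|[v v0]].
  apply: NNPP => A0; case/eqP: x0; move: x.
  apply: (linear_loop_ext gA linear_id linear_zero) => g v _.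
  suff -> : v = 0 by rewrite (lin0 (inL_linear g)).
  by apply/eqP; apply: contra_notT A0 => v0; exists v.
have [a] := nonzero_proj gA v0; rewrite -(sK a) => va.
exists (loop_in (s a) v); apply: contraNneq va => e.
by apply/eqP/(loop_in_eq0 gA (t := t) (proj_in gA _ v)); rewrite loop_in_proj.
Qed.

Lemma loop_sq_full : sq_full L <-> sq_full A.
Proof.
split=> [sqL|sqA]; apply: sq_full_intro => Q Q_sub QM x.
  have [y <-] := loop_eval_surj x; rewrite -[_ \in Q]/(y \in [pred y | loop_eval y \in Q]).
  apply: (sq_full_homog_spanning gL sqL (subspace_preim loop_eval_linear Q_sub)).
  move=> g h {}x {}y xg yh.
  rewrite inE -(loop_atK gA xg) -(loop_atK gA yh) loop_in_mull ?loop_at_comp //.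
  rewrite (linZ loop_eval_linear) loop_eval_in; last by rewrite raddfD comp_mul ?loop_at_comp.
  exact/(subspaceZ Q_sub)/QM.
move: x; apply: (loop_in_spanning gA Q_sub) => g v _.
rewrite -[_ \in Q]/(v \in [pred v | inL g v \in Q]).
apply: (sq_full_homog_spanning gA sqA (subspace_preim (inL_linear g) Q_sub)) => a b u w.
rewrite -(sK a) inE -[g](subrKC (s a)) => ua _.
by apply: (subspaceZK Q_sub (cocycle_neq0 tC (s a) (g - s a))); rewrite -loop_in_mull.
Qed.

Lemma base_graded_simple : graded_simple L -> graded_simple A.
Proof.
move=> gsL; have [/loop_nonzero nzA [/loop_sq_full sqA _]] := gsL.
apply: (graded_simple_intro gA nzA sqA) => I a v [I_sub idI] _; rewrite -(sK a) => va vI v0 w.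
pose J := pred_of_Prop (fun x : gcar L => forall g, x \in [pred x | loop_at x g \in I]).
have JP x : reflect (forall g, loop_at x g \in I) (x \in J) by exact: pred_of_PropP.
have J_sub : subspace J.
  by apply: subspace_forall => g; apply: (subspace_preim (@loop_at_linear _ _ _ pi A t g)).
have JI g u : u \in gcomp A (pi g) -> u \in I -> loop_in g u \in J.
  move=> ug uI; apply/JP => h; rewrite loop_at_loop_in // (proj_id gA ug).
  by case: ifP => // _; apply: (subspace0 I_sub).
have idJ : is_ideal L J.
  apply: (ideal_homog_intro gL J_sub) => h x y /JP xJ yh; have yA := loop_at_comp gA y h.
  rewrite -(loop_atK gA yh); split; apply/JP => g.
    by rewrite loop_at_mulr //; apply/(subspaceZ I_sub)/(idI _ _ _).1.
  by rewrite loop_at_mull //; apply/(subspaceZ I_sub)/(idI _ _ _).2.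
have J_full : forall x, x \in J.
  apply: (graded_simple_full gL gsL idJ (loop_in_comp pi t gA (s a) v)); first exact: JI.
  by apply: contraNneq v0 => /(loop_in_eq0 gA va) ->.
move: w; apply: (base_spanning sK gA I_sub) => g w wg.
by have /JP/(_ g) := J_full (loop_in g w); rewrite loop_inK.
Qed.

Lemma loop_in_at_ideal (I : pred (gcar L)) x g :
  is_ideal L I -> is_graded_subspace L I -> x \in I -> inL g (loop_at x g) \in I.
Proof. by move=> [I_sub _] grI xI; rewrite loop_in_at //; apply: graded_subspace_proj. Qed.

Definition loop_eval_image (I : pred (gcar L)) : pred (gcar A) :=
  pred_of_Prop (fun v => exists2 x, x \in I & loop_eval x = v).

Lemma mem_loop_eval_image (I : pred (gcar L)) g v :
  v \in gcomp A (pi g) -> inL g v \in I -> v \in loop_eval_image I.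
Proof. by move=> vg vI; apply/pred_of_PropP; exists (inL g v); rewrite ?loop_eval_in. Qed.

Lemma loop_eval_image_ideal (I : pred (gcar L)) :
  is_ideal L I -> is_graded_subspace L I -> is_ideal A (loop_eval_image I).
Proof.
move=> LI grI; have [I_sub idI] := LI; have J_sub := subspace_image loop_eval_linear I_sub.
apply: (ideal_homog_intro gA J_sub) => b _ w /pred_of_PropP[x xI <-]; rewrite -(sK b) => wb.
rewrite loop_eval_sum (lin_sum (gmull_linear gA w)) (lin_sum (gmulr_linear gA w)).
have xA g := loop_at_comp gA x g; have gI g := loop_in_at_ideal g LI grI xI.
split; apply: (subspace_sum J_sub) => g.
  apply: (mem_loop_eval_image (g := g + s b)); first by rewrite raddfD comp_mul.
  apply: (subspaceZK I_sub (cocycle_neq0 tC g (s b))); rewrite -loop_in_mulr //.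
  exact: (idI _ _ (gI g)).1.
apply: (mem_loop_eval_image (g := s b + g)); first by rewrite raddfD comp_mul.
apply: (subspaceZK I_sub (cocycle_neq0 tC (s b) g)); rewrite -loop_in_mull //.
exact: (idI _ _ (gI g)).2.
Qed.

Lemma tloop_graded_simple : graded_simple A -> graded_simple L.
Proof.
move=> gsA; have [nzA [sqA _]] := gsA.
apply: (graded_simple_intro gL) => [||I h x LI grI xh xI x0]; first exact/loop_nonzero.
  exact/loop_sq_full.
have [I_sub idI] := LI; have gI y g : y \in I -> inL g (loop_at y g) \in I.
  exact: loop_in_at_ideal LI grI.
have J_full : forall v, v \in loop_eval_image I.
  have xA := loop_at_comp gA x h.
  apply: (graded_simple_full gA gsA (loop_eval_image_ideal LI grI) xA).
    exact/(mem_loop_eval_image xA)/gI.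
  by apply: contraNneq x0 => e; rewrite -(loop_atK gA xh) e (lin0 (inL_linear h)).
pose Q := pred_of_Prop (fun v => forall g, v \in [pred v | inL g v \in I]).
have Q_sub : subspace Q by apply: subspace_forall => g; apply: (subspace_preim (inL_linear g)).
have Q_full : forall v, v \in Q.
  apply: (sq_full_spanning sqA Q_sub) => v w; have /pred_of_PropP[y yI <-] := J_full v.
  rewrite loop_eval_sum (lin_sum (gmull_linear gA w)); apply: (subspace_sum Q_sub) => k.
  apply/pred_of_PropP => g; rewrite inE -[g](subrKC k).
  apply: (subspaceZK I_sub (cocycle_neq0 tC k (g - k))); rewrite -loop_in_mull ?loop_at_comp //.
  exact: (idI _ _ (gI y k yI)).1.
by apply: (loop_in_spanning gA I_sub) => g v _; have /pred_of_PropP/(_ g) := Q_full v.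
Qed.
End LoopSimplicity.

Section LoopGradedCentralSimple.
Variables (F : fieldType) (G Gb : zmodType) (pi : {additive G -> Gb}) (s : Gb -> G).
Variables (A : galg F Gb) (t : G -> G -> F).
Hypotheses (sK : cancel s pi) (gA : is_galg A) (tC : sym2cocycle t).
Local Notation L := (tloop pi A t).
Let gL : is_galg L := tloop_galg pi t gA.

Section FromBase.
Hypothesis csA : central_simple A.

Lemma central_simple_tloop_graded_simple : graded_simple L.
Proof. exact: (tloop_graded_simple sK gA tC (simple_graded_simple csA.1)). Qed.

Lemma tloop_homog_centroid k c : homog_centroid L k c ->
  exists lam : F, forall x, c x = lam *: loop_lift k id x.
Proof.
move=> cH; have [_ [sqL _]] := central_simple_tloop_graded_simple.
have [d dH cE] := homog_centroid_descent sK gA tC cH sqL.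
have [lam lamE] := csA.2 d dH.1; exists lam => x; rewrite cE; move: x.
apply: (linear_loop_ext gA) => [||g v vg].
- exact: (loop_lift_linear gA k (centroid_linear dH.1)).
- exact/linear_scale/(loop_lift_linear gA k linear_id).
rewrite !loop_liftE //; last exact: centroid_linear dH.1.
by rewrite lamE (linZ (loop_in_linear _ _ gA _)) !scalerA mulrC.
Qed.

Lemma tloop_centroid_support k : centroid_support L k <-> pi k = 0.
Proof.
have [_ [sqL _]] := central_simple_tloop_graded_simple.
split=> [[c cH [x cx]]|k0].
  have [d dH cE] := homog_centroid_descent sK gA tC cH sqL; have [lam lamE] := csA.2 d dH.1.
  apply/eqP; apply: contraNT cx => k0; rewrite cE; apply/eqP; move: x.
  have dL := centroid_linear dH.1.
  apply: (linear_loop_ext gA (loop_lift_linear gA k dL) linear_zero) => g v vg.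
  suff dv : d v = 0 by rewrite loop_liftE // dv (lin0 (loop_in_linear _ _ gA _)) scaler0.
  apply: (comp_disjoint gA (h := pi g) (dH.2 _ _ vg)); last by rewrite -subr_eq0 addrK.
  by rewrite lamE; apply: (subspaceZ (comp_subspace gA _)).
have [[x x0] _] := central_simple_tloop_graded_simple.
have shift := loop_shift_action pi gA tC.
exists (loop_lift k id); first by have [/(_ k k0)] := shift.
exists x; apply: contraNneq x0 => e; apply/eqP/(twisted_kernel_action_inj tC shift k0).
by rewrite e (lin0 (loop_lift_linear gA k linear_id)).
Qed.

Lemma tloop_graded_central_simple : graded_central_simple L.
Proof.
split; first exact: central_simple_tloop_graded_simple.
move=> c cC cD; have [lam lamE] := tloop_homog_centroid (conj cC cD).
by exists (lam * t 0 0) => x; rewrite lamE loop_lift0 // scalerA.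
Qed.
End FromBase.

Section ToBase.
Hypothesis gcsL : graded_central_simple L.
Hypothesis centroid_support_ker : forall k, centroid_support L k -> pi k = 0.

Lemma base_central_simple : central_simple A.
Proof.
have gsA := base_graded_simple sK gA tC gcsL.1.
have support_trivial a : centroid_support A a -> a = 0.
  rewrite -(sK a) => -[d dH [v dv]]; apply: centroid_support_ker.
  exists (loop_lift (s a) d); first exact: homog_centroid_lift.
  apply: NNPP => lift0; case/eqP: dv; move: v; apply: (loop_lift_eq0 sK gA tC dH) => x.
  by apply/eqP; apply: contra_notT lift0; exists x.
split; first exact: graded_simple_simple.
apply: graded_central_central => // d dC dD; have d0H : homog_centroid A (pi 0) d by rewrite raddf0.
have [lam lamE] := gcsL.2 _ (homog_centroid_lift gA tC d0H).1 (homog_centroid_lift gA tC d0H).2.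
exists (lam / t 0 0); apply: (linear_base_ext sK gA (centroid_linear dC)) => [|g v vg].
  exact: linear_scale.
have := lamE (loop_in g v).
rewrite (loop_liftE t gA 0 (centroid_linear dC) vg) add0r (cocycle0l tC).
have dv : d v \in gcomp A (pi g) by rewrite -[pi g]add0r; apply: dD.
move=> /(congr1 (fun x => loop_at x g)); rewrite !(linZ (loop_at_linear g)) !loop_inK // => e.
by rewrite mulrC -scalerA -e scalerA mulVf ?scale1r // cocycle_neq0.
Qed.
End ToBase.
End LoopGradedCentralSimple.

(** * Twisted group algebras as centroids *)

Section GroupAlgebra.
Variables (F : fieldType) (G : zmodType).

Definition ground_galg : galg F G :=
  @GAlg F G F^o (fun x y => x * y) (fun g x => (g == 0) || (x == 0)).

Lemma ground_compE g (x : F^o) : (x \in gcomp ground_galg g) = (g == 0) || (x == 0).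
Proof. by []. Qed.

Lemma ground_is_galg : is_galg ground_galg.
Proof.
split; [split=> a x y z /=|split; [|split; [|split]]].
- by rewrite mulrDl scalerAl.
- by rewrite mulrDr scalerAr.
- move=> g; split=> [|a x y]; rewrite !ground_compE ?eqxx ?orbT //.
  by case: (g == 0) => //= /eqP-> /eqP->; rewrite scaler0 addr0.
- move=> x; exists [:: 0], (fun g => if g == 0 then x else 0).
  split=> [g|]; last by rewrite big_seq1 eqxx.
  by rewrite ground_compE; case: (g == 0); rewrite ?eqxx ?orbT.
- move=> r f ur fG f0 g gr; have := fG g; rewrite ground_compE => /orP[/eqP g0|/eqP //].
  rewrite -f0 (bigD1_seq g) //= big1 ?addr0 // => h hg.
  by have := fG h; rewrite ground_compE -g0 (negbTE hg) => /eqP.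
- move=> g h x y; rewrite !ground_compE => /orP[/eqP->|/eqP->]; last by rewrite /= mul0r eqxx orbT.
  by case/orP=> /eqP->; rewrite ?addr0 ?eqxx //= mulr0 eqxx orbT.
Qed.
End GroupAlgebra.

Lemma ground_comp_qproj (F : fieldType) (G : zmodType) (H : subgrp G) g (x : F^o) :
  (x \in gcomp (ground_galg F (quot H)) (qproj H g)) = (g \in sg_pred H) || (x == 0).
Proof. by rewrite ground_compE qproj_eq0. Qed.

Lemma grp_gen_loop (F : fieldType) (G : zmodType) (H : subgrp G) :
  grp_gen H = loop_gen (qproj H) (ground_galg F (quot H)).
Proof.
apply: functional_extensionality => f; apply/asboolP/asboolP => [[g [a [gH ->]]]|[g [v [vg ->]]]].
  by exists g, a; rewrite ground_comp_qproj gH.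
move: vg; rewrite ground_comp_qproj => /orP[gH|/eqP->].
  by exists g, v.
exists 0, 0; split; first exact: sg0.
by apply: functional_extensionality => k; rewrite /fdelta !if_same.
Qed.

Lemma grpalg_loop (F : fieldType) (G : zmodType) (H : subgrp G) :
  grpalg H = loop (qproj H) (ground_galg F (quot H)).
Proof.
pose of_gen (gen : pred (funT G F^o)) : galg F G := @GAlg F G (spanT gen)
  (fun x y => insubd (0 : spanT gen) (conv *%R (sp_val x) (sp_val y)))
  (fun g x => asbool ((forall k, k != g -> sp_val x k = 0) /\
                      sp_val x g \in gcomp (ground_galg F (quot H)) (qproj H g))).
rewrite -[RHS]/(of_gen (loop_gen (qproj H) (ground_galg F (quot H)))) -grp_gen_loop; congr GAlg.
apply: functional_extensionality => g; apply: functional_extensionality => x.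
apply/asboolP/asboolP => -[x0 xg]; split=> //; move: xg; rewrite ground_comp_qproj.
  by case=> [-> //|->]; rewrite eqxx orbT.
by case/orP=> [|/eqP]; [left|right].
Qed.

Section CentroidGroupAlgebra.
Variables (F : fieldType) (G : zmodType) (H : subgrp G) (B : galg F G).
Variables (u : G -> gcar B -> gcar B) (t : G -> G -> F).
Hypotheses (gB : is_galg B) (gcsB : graded_central_simple B) (tC : sym2cocycle t).
Hypothesis u_action : twisted_kernel_action (qproj H) u t.
Hypothesis centroid_support_sub : forall k, centroid_support B k -> k \in sg_pred H.

Local Notation E := (ground_galg F (quot H)).
Local Notation K := (tloop (qproj H) E (restr H t)).
Local Notation C := (centroid_alg B).
Let gE : is_galg E := ground_is_galg F (quot H).
Let gK : is_galg K := tloop_galg (qproj H) (restr H t) gE.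
Let gC : is_galg C := centroid_galg gB gcsB.1.

Let U (h : G) : gcar C := cent_elt (u h).

Let qproj0 h : h \in sg_pred H -> qproj H h = 0.
Proof. by rewrite -qproj_eq0 => /eqP. Qed.

Let u_homog h : h \in sg_pred H -> homog_centroid B h (u h).
Proof. by move=> /qproj0; have [uH _ _] := u_action; apply: uH. Qed.

Let cent_fun_U h x : h \in sg_pred H -> cent_fun (U h) x = u h x.
Proof. by move=> /u_homog[uC _]; rewrite cent_eltK. Qed.

Let u_neq0 h : h \in sg_pred H -> exists x, u h x != 0.
Proof.
move=> hH; have [[[x x0] _] _] := gcsB; exists x; apply: contraNneq x0 => e.
apply/eqP/(twisted_kernel_action_inj tC u_action (qproj0 hH)).
by rewrite e (lin0 (centroid_linear (u_homog hH).1)).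
Qed.

Let coef_out (x : gcar K) h : h \notin sg_pred H -> loop_at x h = 0.
Proof.
move=> hH; have := loop_at_comp gE x h.
by rewrite ground_comp_qproj (negbTE hH) => /eqP.
Qed.

Let coefM g h (x y : gcar K) : x \in gcomp K g -> y \in gcomp K h ->
  loop_at (gmul K x y) (g + h) = restr H t g h * (loop_at x g * loop_at y h).
Proof.
move=> xg yh; have xE := loop_at_comp gE x g; have yE := loop_at_comp gE y h.
rewrite -{1}(loop_atK gE xg) -{1}(loop_atK gE yh) loop_in_mull // (linZ (loop_at_linear _)).
by rewrite loop_inK // raddfD; apply: comp_mul.
Qed.

Lemma centroid_alg_grpalg : giso C (tgrpalg H (restr H t)).
Proof.
rewrite /tgrpalg grpalg_loop; apply: giso_sym.
pose phi g (x : gcar K) : gcar C := (loop_at x g : F) *: U g.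
have phi_out g x : g \notin sg_pred H -> phi g x = 0.
  by move=> gH; rewrite /phi coef_out // scale0r.
apply: (giso_intro (phi := phi) gK gC) => [g a x y|g x xg|g x xg|g c cg|g h x y xg yh].
- by rewrite /phi loop_at_linear scalerDl scalerA.
- case: (boolP (g \in sg_pred H)) => [gH|/phi_out->]; last exact: (comp0 gC).
  apply: (subspaceZ (comp_subspace gC g)); apply/(cent_compP gB).
  by rewrite (cent_eltK (u_homog gH).1); apply: u_homog.
- suff coef0 : phi g x = 0 -> loop_at x g = 0.
    by move=> /coef0 e; rewrite -(loop_atK gE xg) e (lin0 (loop_in_linear _ _ gE g)).
  case: (boolP (g \in sg_pred H)) => [gH e|/coef_out-> //]; have [y uy] := u_neq0 gH.
  have /eqP : cent_fun (phi g x) y = 0 by rewrite e.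
  rewrite -[cent_fun _ _]/(_ *: cent_fun (U g) y) cent_fun_U //.
  by rewrite scaler_eq0 (negbTE uy) orbF => /eqP.
- have /(cent_compP gB) cH := cg; case: (boolP (g \in sg_pred H)) => [gH|gH].
    have [lam lamE] := homog_centroid_line gB gcsB.1 gcsB.2 (u_homog gH) (u_neq0 gH) cH.
    exists (loop_in g (lam : gcar E)); first exact: loop_in_comp.
    rewrite /phi loop_inK //; last by rewrite ground_comp_qproj gH.
    apply: cent_fun_inj => y.
    by rewrite -[LHS]/(_ *: cent_fun (U g) y) cent_fun_U // lamE.
  exists 0; first exact: (comp0 gK); rewrite phi_out //; apply: cent_fun_inj => y.
  apply/esym/eqP; apply: contraNT gH => cy; apply: centroid_support_sub.
  by exists (cent_fun c) => //; exists y.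
case: (boolP (g \in sg_pred H)) => gH; last first.
  by rewrite /phi coefM // coef_out // mul0r mulr0 !scale0r (gmul0l gC).
case: (boolP (h \in sg_pred H)) => hH; last first.
  by rewrite /phi coefM // (coef_out _ hH) !mulr0 !scale0r (gmul0r gC).
have [_ uM _] := u_action; apply: cent_fun_inj => z; rewrite (cent_fun_mul gB).
rewrite -![cent_fun (phi _ _) _]/(_ *: cent_fun (U _) _) !cent_fun_U ?sgD //.
rewrite (linZ (centroid_linear (u_homog gH).1)) uM ?qproj0 // coefM // /restr gH hH !scalerA.
by rewrite mulrC.
Qed.
End CentroidGroupAlgebra.

(** * Graded-central-simple algebras are loop algebras *)

Section CentroidSubgroup.
Variables (F : fieldType) (G : zmodType) (B : galg F G).
Hypotheses (gB : is_galg B) (gcsB : graded_central_simple B).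
Let gsB : graded_simple B := gcsB.1.
Let sqB : sq_full B := gsB.2.1.

Definition centroid_subgrp : subgrp G :=
  subgrp_of_Prop (centroid_support0 gsB) (centroid_supportB gB gsB).
Local Notation H := (subgrp_type centroid_subgrp).

Lemma centroid_subgrpP k : reflect (centroid_support B k) (k \in sg_pred centroid_subgrp).
Proof. exact: subgrp_of_PropP. Qed.

Section ChosenElements.
Variable u : H -> gcar B -> gcar B.
Hypothesis u_homog : forall h, homog_centroid B (val h) (u h).
Hypothesis u_neq0 : forall h, exists x, u h x != 0.

Let u_linear h : linear (u h). Proof. exact: centroid_linear (u_homog h).1. Qed.

Lemma chosen_centroid_cocycle : exists2 t : H -> H -> F, sym2cocycle t &
  forall h k x, u h (u k x) = t h k *: u (h + k) x.
Proof.
have /functional_choice[t' t'E] (hk : H * H) :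
    exists l : F, forall x, u hk.1 (u hk.2 x) = l *: u (hk.1 + hk.2) x.
  have := homog_centroid_comp (u_homog hk.1) (u_homog hk.2); rewrite -raddfD.
  exact: (homog_centroid_line gB gsB gcsB.2 (u_homog _) (u_neq0 _)).
pose t h k := t' (h, k); have tE h k x : u h (u k x) = t h k *: u (h + k) x := t'E (h, k) x.
have scale_inj h (a b : F) : (forall x, a *: u h x = b *: u h x) -> a = b.
  move=> ab; have [x ux] := u_neq0 h; have /eqP := ab x.
  by rewrite -subr_eq0 -scalerBl scaler_eq0 (negbTE ux) orbF subr_eq0 => /eqP.
have u_inj h := homog_centroid_inj gB gsB (u_homog h) (u_neq0 h).
exists t => //; split=> [h k|].
  have [x ux] := u_neq0 k; apply: contraNneq ux => t0; apply/eqP/(u_inj h).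
  by rewrite tE t0 scale0r (lin0 (u_linear h)).
split=> [a b c|a b].
  apply: (scale_inj (a + (b + c))) => x; have := tE a b (u c x).
  rewrite (tE b c) (linZ (u_linear a)) (tE a (b + c)) (tE (a + b) c) !scalerA addrA => <-.
  by rewrite mulrC.
apply: (scale_inj (a + b)) => x; rewrite -tE addrC -tE.
exact: (centroid_comm x sqB (u_homog a).1 (u_homog b).1).
Qed.
End ChosenElements.

Lemma twisted_kernel_action_exists : exists (u : G -> gcar B -> gcar B) (t : G -> G -> F),
  sym2cocycle t /\ twisted_kernel_action (qproj centroid_subgrp) u t.
Proof.
have /functional_choice[u uP] (h : H) : exists c, homog_centroid B (val h) c /\ exists x, c x != 0.
  by case: h => h /= /centroid_subgrpP[c cH c0]; exists c.
have u_homog h := (uP h).1; have u_neq0 h := (uP h).2.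
have [t0 t0C uM] := chosen_centroid_cocycle u_homog u_neq0.
have [t tC tE] := sym2cocycle_extension (i := val : {additive H -> G}) val_inj t0C.
have subH h : qproj centroid_subgrp h = 0 -> h \in sg_pred centroid_subgrp.
  by move=> /eqP; rewrite qproj_eq0.
have val_insub h : h \in sg_pred centroid_subgrp -> val (insubd (0 : H) h) = h by exact: insubdK.
exists (fun g => u (insubd 0 g)), t; split=> //; split=> [h /subH hH|h k x /subH hH /subH kH|x].
- by have := u_homog (insubd 0 h); rewrite val_insub.
- have -> : insubd 0 (h + k) = insubd 0 h + insubd 0 k :> H.
    by apply: val_inj; rewrite raddfD /= !val_insub ?sgD.
  by rewrite uM -tE /= !val_insub.
have -> : insubd 0 0 = 0 :> H by apply: val_inj; rewrite raddf0 val_insub ?sg0.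
have tE00 : t0 0 0 = t 0 0 by rewrite -tE !raddf0.
apply: (homog_centroid_inj gB gsB (u_homog 0) (u_neq0 0)).
by rewrite uM addr0 tE00 (linZ (centroid_linear (u_homog 0).1)).
Qed.
End CentroidSubgroup.

(* The twist of [B] by [1 / t] has product [untwisted_mul], and [untwisted_shift] is an action on it
   of the kernel of [pi] by centroid elements; identifying the components of [B] along this action
   leaves one component for each element of [Gb]. *)
Section BaseAlgebra.
Variables (F : fieldType) (G Gb : zmodType) (pi : {additive G -> Gb}) (s : Gb -> G).
Variables (B : galg F G) (u : G -> gcar B -> gcar B) (t : G -> G -> F).
Hypotheses (sK : cancel s pi) (gB : is_galg B) (tC : sym2cocycle t).
Hypothesis u_action : twisted_kernel_action pi u t.

Let u_homog h : pi h = 0 -> homog_centroid B h (u h).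
Proof. by case: u_action => uH _ _; apply: uH. Qed.

Let u_linear h : pi h = 0 -> linear (u h).
Proof. by move=> /u_homog[/centroid_linear]. Qed.

Definition untwisted_shift (h g : G) (x : gcar B) : gcar B := (t h g)^-1 *: u h x.
Definition untwisted_mul (g h : G) (x y : gcar B) : gcar B := (t g h)^-1 *: gmul B x y.

Lemma untwisted_shift_linear h g : pi h = 0 -> linear (untwisted_shift h g).
Proof. by move=> h0; apply/linear_scale/u_linear. Qed.

Lemma untwisted_shift_comp h g x :
  pi h = 0 -> x \in gcomp B g -> untwisted_shift h g x \in gcomp B (h + g).
Proof. by move=> /u_homog[_ uD] xg; apply/(subspaceZ (comp_subspace gB _))/uD. Qed.

Lemma untwisted_shift0 g x : untwisted_shift 0 g x = x.
Proof.
have [_ _ u0] := u_action.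
by rewrite /untwisted_shift u0 (cocycle0l tC) scalerA mulVf ?scale1r ?cocycle_neq0.
Qed.

Lemma untwisted_shiftD h k g x : pi h = 0 -> pi k = 0 ->
  untwisted_shift k (h + g) (untwisted_shift h g x) = untwisted_shift (k + h) g x.
Proof.
move=> h0 k0; have [_ uM _] := u_action; have t0 := cocycle_neq0 tC.
rewrite /untwisted_shift (linZ (u_linear k0)) uM // !scalerA; congr (_ *: _).
by rewrite -invfM [t k _ * _]mulrC -(cocycleA tC k h g) invfM mulrAC mulVf ?mul1r.
Qed.

Lemma untwisted_shift_mull h g g' x y : pi h = 0 ->
  untwisted_mul (h + g) g' (untwisted_shift h g x) y =
  untwisted_shift h (g + g') (untwisted_mul g g' x y).
Proof.
move=> h0; have [[uL uM] _] := u_homog h0; rewrite /untwisted_mul /untwisted_shift.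
rewrite (gmulZl gB) (linZ uL) (uM x y).1 !scalerA -!invfM; congr (_^-1 *: _).
by rewrite mulrC (cocycleA tC) mulrC.
Qed.

Lemma untwisted_shift_mulr h g g' x y : pi h = 0 ->
  untwisted_mul g (h + g') x (untwisted_shift h g' y) =
  untwisted_shift h (g + g') (untwisted_mul g g' x y).
Proof.
move=> h0; have [[uL uM] _] := u_homog h0; rewrite /untwisted_mul /untwisted_shift.
rewrite (gmulZr gB) (linZ uL) (uM x y).2 !scalerA -!invfM; congr (_^-1 *: _).
by rewrite mulrC (cocycleCA tC) mulrC.
Qed.

Let rep (g : G) : G := s (pi g).
Let rep_ker g : pi (rep g - g) = 0. Proof. by rewrite raddfB sK subrr. Qed.
Let ker_rep g : pi (g - rep g) = 0. Proof. by rewrite raddfB sK subrr. Qed.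

Definition to_rep (g : G) : gcar B -> gcar B := untwisted_shift (s (pi g) - g) g.
Definition from_rep (g : G) : gcar B -> gcar B := untwisted_shift (g - s (pi g)) (s (pi g)).

Lemma to_rep_linear g : linear (to_rep g).
Proof. exact/untwisted_shift_linear/rep_ker. Qed.

Lemma to_rep_comp g x : x \in gcomp B g -> to_rep g x \in gcomp B (s (pi g)).
Proof.
move=> xg; rewrite -[X in gcomp B X](subrK g (s (pi g))).
exact/untwisted_shift_comp/xg/rep_ker.
Qed.

Lemma from_rep_comp g y : y \in gcomp B (s (pi g)) -> from_rep g y \in gcomp B g.
Proof.
move=> yg; rewrite -[X in gcomp B X](subrK (s (pi g)) g).
exact/untwisted_shift_comp/yg/ker_rep.
Qed.

Lemma to_repK g : cancel (to_rep g) (from_rep g).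
Proof.
move=> x; rewrite /from_rep /to_rep -{2}[s (pi g)](subrK g).
by rewrite untwisted_shiftD ?rep_ker ?ker_rep // addrA subrK subrr untwisted_shift0.
Qed.

Lemma from_repK g : cancel (from_rep g) (to_rep g).
Proof.
move=> y; rewrite /from_rep /to_rep -{3}[g](subrK (s (pi g))).
by rewrite untwisted_shiftD ?rep_ker ?ker_rep // addrA subrK subrr untwisted_shift0.
Qed.

Definition rep_mul (x y : gcar B) : gcar B :=
  glue to_rep (gmul (twist B (fun a b => (t a b)^-1)) x y).

Lemma rep_mulE g h x y : x \in gcomp B g -> y \in gcomp B h ->
  rep_mul x y = to_rep (g + h) (untwisted_mul g h x y).
Proof.
move=> xg yh; rewrite /rep_mul (twist_mulH gB _ xg yh).
apply: (glueH gB to_rep_linear).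
by apply: (subspaceZ (comp_subspace gB _)); apply: comp_mul.
Qed.

Lemma to_rep_mul g h x y : x \in gcomp B g -> y \in gcomp B h ->
  rep_mul (to_rep g x) (to_rep h y) = to_rep (g + h) (untwisted_mul g h x y).
Proof.
move=> xg yh; rewrite (rep_mulE (to_rep_comp xg) (to_rep_comp yh)) -/(rep g) -/(rep h).
set a := rep g - g; set b := rep h - h.
have ea : rep g = a + g by rewrite subrK.
have eb : rep h = b + h by rewrite subrK.
have e : rep g + rep h = a + b + (g + h) by rewrite ea eb addrACA.
have a0 : pi a = 0 by apply: rep_ker.
have b0 : pi b = 0 by apply: rep_ker.
have ab0 : pi (a + b) = 0 by rewrite raddfD a0 b0 addr0.
have -> : untwisted_mul (rep g) (rep h) (to_rep g x) (to_rep h y) =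
    untwisted_shift (a + b) (g + h) (untwisted_mul g h x y).
  rewrite ea eb untwisted_shift_mull // untwisted_shift_mulr // [g + (b + h)]addrCA.
  by rewrite untwisted_shiftD.
rewrite {1}/to_rep e untwisted_shiftD // ?raddfB ?sK ?subrr //; congr (untwisted_shift _ _ _).
have -> : pi (a + b + (g + h)) = pi (g + h) by rewrite raddfD ab0 add0r.
by move: (a + b) => c; rewrite opprD addrA addrAC subrK.
Qed.

Let P (a : Gb) : pred (gcar B) := gcomp B (s a).
Let p (a : Gb) : gcar B -> gcar B := proj B (s a).
Let p_lin a : linear (p a). Proof. exact: proj_linear. Qed.
Let p_in a v : p a v \in P a. Proof. exact: proj_in. Qed.
Let p_id a v : v \in P a -> p a v = v. Proof. exact: proj_id. Qed.

Let twB : is_galg (twist B (fun a b => (t a b)^-1)) := twist_galg gB _.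
Let rep_mull_linear y : linear (rep_mul^~ y).
Proof. exact: linear_comp (glue_linear gB to_rep_linear) (gmull_linear twB y). Qed.
Let rep_mulr_linear x : linear (rep_mul x).
Proof. exact: linear_comp (glue_linear gB to_rep_linear) (gmulr_linear twB x). Qed.
Let rep_mul_comp a b x y : x \in P a -> y \in P b -> rep_mul x y \in P (a + b).
Proof.
move=> xa yb; rewrite (rep_mulE xa yb) /P.
have -> : a + b = pi (s a + s b) by rewrite raddfD !sK.
by apply: to_rep_comp; apply: (subspaceZ (comp_subspace gB _)); apply: comp_mul.
Qed.

Definition base_alg : galg F Gb := dsum_alg rep_mul P.

Lemma base_alg_galg : is_galg base_alg.
Proof. exact: (dsum_galg p_lin p_in p_id rep_mull_linear rep_mulr_linear rep_mul_comp). Qed.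

Lemma base_alg_giso : giso B (tloop pi base_alg t).
Proof.
pose inA a : gcar B -> gcar base_alg := dsum_in rep_mul P p a.
have inA_lin a : linear (inA a) by apply: dsum_in_linear.
have inA_id a v : v \in gcomp B (s a) -> dsum_at (inA a v) a = v.
  exact: (dsum_in_at rep_mul p_in p_id).
apply: (giso_tloop base_alg_galg (rho := fun g x => inA (pi g) (to_rep g x)) gB).
- exact: cocycle_neq0.
- by move=> g; apply: (linear_comp (inA_lin (pi g)) (to_rep_linear g)).
- by move=> g x _; apply: dsum_in_comp.
- move=> g x xg /(congr1 (fun v : gcar base_alg => dsum_at v (pi g))).
  rewrite inA_id ?to_rep_comp // => x0; rewrite -(to_repK g x) x0.
  exact/lin0/untwisted_shift_linear/ker_rep.
- move=> g v vg; have vP := dsum_at_in p_lin p_in p_id v (pi g).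
  exists (from_rep g (dsum_at v (pi g))); first exact: from_rep_comp.
  by rewrite from_repK; apply: (dsum_atK p_in p_id).
move=> g h x y xg yh; have xP := to_rep_comp xg; have yP := to_rep_comp yh.
rewrite (dsum_in_mul p_lin p_in p_id rep_mull_linear rep_mulr_linear rep_mul_comp xP yP).
rewrite (to_rep_mul xg yh) raddfD.
have -> : to_rep (g + h) (untwisted_mul g h x y) = (t g h)^-1 *: to_rep (g + h) (gmul B x y).
  exact: (linZ (to_rep_linear _)).
move: (to_rep (g + h) (gmul B x y)) => z; rewrite -[RHS](linZ (inA_lin _)) scalerA.
by rewrite divff ?scale1r ?cocycle_neq0.
Qed.
End BaseAlgebra.

Lemma graded_central_simple_loop (F : fieldType) (G : zmodType) (B : galg F G) :
  is_galg B -> graded_central_simple B ->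
  exists (H : subgrp G) (A : galg F (quot H)) (t : G -> G -> F),
    is_galg A /\ central_simple A /\ sym2cocycle t /\ giso B (tloop (qproj H) A t).
Proof.
move=> gB gcsB; pose H := centroid_subgrp gB gcsB.
have [u [t [tC u_action]]] := twisted_kernel_action_exists gB gcsB.
have sK : cancel (@q_val G H) (qproj H) := @qproj_val G H.
pose A := base_alg (qproj H) (@q_val G H) u t.
have gA : is_galg A by apply: (base_alg_galg sK gB u_action).
have BL : giso B (tloop (qproj H) A t) by apply: (base_alg_giso sK gB tC u_action).
exists H, A, t; split=> //; split; last by split.
have gL := tloop_galg (qproj H) t gA; have /gisoP[f [f' fI]] := BL.
apply: (base_central_simple sK gA tC (iso_graded_central_simple gB gL fI gcsB)) => k kL.
apply/eqP; rewrite qproj_eq0; apply/centroid_subgrpP.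
exact: (iso_centroid_support (graded_iso_sym fI) kL).
Qed.

(** * Isomorphisms of loop algebras *)

Section ActionRatio.
Variables (F : fieldType) (G Gb : zmodType) (pi : {additive G -> Gb}) (B : galg F G).
Variables (u1 u2 : G -> gcar B -> gcar B) (t1 t2 : G -> G -> F).
Hypotheses (gB : is_galg B) (gcsB : graded_central_simple B).
Hypotheses (t1C : sym2cocycle t1) (t2C : sym2cocycle t2).
Hypothesis u1_action : twisted_kernel_action pi u1 t1.
Hypothesis u2_action : twisted_kernel_action pi u2 t2.

Lemma twisted_kernel_action_ratio : exists lam : G -> F,
  [/\ forall h, pi h = 0 -> lam h != 0,
      forall h x, pi h = 0 -> u1 h x = lam h *: u2 h x &
      forall h k, pi h = 0 -> pi k = 0 -> t1 h k * lam (h + k) = t2 h k * (lam h * lam k)].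
Proof.
have [u1H u1M _] := u1_action; have [u2H u2M _] := u2_action; have [[[x0 x0n] _] _] := gcsB.
have u_neq0 u t h : sym2cocycle t -> twisted_kernel_action pi u t -> pi h = 0 -> u h x0 != 0.
  move=> tC uA h0; have [/(_ h h0)[uC _] _ _] := uA.
  apply: contraNneq x0n => e; apply/eqP/(twisted_kernel_action_inj tC uA h0).
  by rewrite e (lin0 (centroid_linear uC)).
have /functional_choice[lam lamP] h : exists l : F, pi h = 0 -> forall x, u1 h x = l *: u2 h x.
  case: (classic (pi h = 0)) => [h0|h_neq0]; last by exists 0.
  have u2h : exists x, u2 h x != 0 by exists x0; apply: u_neq0 t2C u2_action h0.
  by have [l lE] := homog_centroid_line gB gcsB.1 gcsB.2 (u2H h h0) u2h (u1H h h0); exists l.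
exists lam; split=> [h h0|h x h0|h k h0 k0]; last 1 first.
- have hk0 : pi (h + k) = 0 by rewrite raddfD h0 k0 addr0.
  have := u1M h k x0 h0 k0; rewrite !(lamP _ _ _) // (linZ (centroid_linear (u2H h h0).1)).
  rewrite u2M // !scalerA => /eqP; rewrite -subr_eq0 -scalerBl scaler_eq0.
  rewrite (negbTE (u_neq0 _ _ _ t2C u2_action hk0)) orbF subr_eq0 => /eqP <-.
  by rewrite mulrC.
- apply: contraTneq (u_neq0 _ _ _ t1C u1_action h0) => l0.
  by rewrite lamP // l0 scale0r eqxx.
exact: lamP.
Qed.
End ActionRatio.

Lemma iso_twisted_kernel_action (F : fieldType) (G Gb : zmodType) (pi : G -> Gb) (A B : galg F G)
    (f : gcar A -> gcar B) (f' : gcar B -> gcar A) u (t : G -> G -> F) :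
  graded_iso f f' -> twisted_kernel_action pi u t ->
  twisted_kernel_action pi (fun h => f \o u h \o f') t.
Proof.
move=> fI [uH uM u0]; have [fL fK f'K _ _ _] := fI; split=> [h h0|h k y h0 k0|y] /=.
- exact: (iso_homog_centroid fI (uH h h0)).
- by rewrite fK uM // (linZ fL).
- by rewrite u0 (linZ fL) f'K.
Qed.

Section LoopIsomorphism.
Variables (F : fieldType) (G Gb : zmodType) (pi : {additive G -> Gb}).
Variables (A1 A2 : galg F Gb) (t1 t2 : G -> G -> F).
Hypotheses (gA1 : is_galg A1) (gA2 : is_galg A2).
Hypothesis t2C : sym2cocycle t2.
Local Notation L1 := (tloop pi A1 t1).
Local Notation L2 := (tloop pi A2 t2).
Let gL1 : is_galg L1 := tloop_galg pi t1 gA1.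
Let gL2 : is_galg L2 := tloop_galg pi t2 gA2.

Lemma tloop_giso_of_twist (mu : Gb -> Gb -> F) :
  cohomologous t1 (fun a b => mu (pi a) (pi b) * t2 a b) ->
  giso (twist A1 mu) A2 -> giso L1 L2.
Proof.
move=> [gam [gam0 t1E]] /gisoP[f [f' fI]]; have [fL fK f'K fM fA f'A] := fI.
apply: (giso_tloop gA2 (rho := fun g (x : gcar L1) => gam g *: f (loop_at x g)) gL1).
- exact: cocycle_neq0.
- by move=> g; apply/linear_scale/(linear_comp fL)/loop_at_linear.
- by move=> g x _; apply: (subspaceZ (comp_subspace gA2 _)); apply: fA (loop_at_comp gA1 x g).
- move=> g x xg /eqP; rewrite scaler_eq0 (negbTE (gam0 g)) /= => /eqP fx0.
  have x0 : loop_at x g = 0 by apply: (can_inj fK); rewrite fx0 (lin0 fL).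
  by rewrite -(loop_atK gA1 xg) x0 (lin0 (loop_in_linear _ _ gA1 g)).
- move=> g v vg; exists (loop_in g ((gam g)^-1 *: f' v : gcar A1) : gcar L1).
    exact: loop_in_comp.
  rewrite loop_inK //; last exact/(subspaceZ (comp_subspace gA1 _))/f'A.
  by rewrite (linZ fL) scalerA divff // scale1r f'K.
move=> g h x y xg yh; have xA := loop_at_comp gA1 x g; have yA := loop_at_comp gA1 y h.
rewrite -{1}(loop_atK gA1 yh) loop_at_mulr // addrK (linZ fL).
rewrite (gmulZl gA2) (gmulZr gA2) -fM (twist_mulH gA1 mu xA yA) (linZ fL) !scalerA t1E.
by congr (_ *: _); field; rewrite gam0.
Qed.

Section Descent.
Variables (s : Gb -> G) (f : gcar L1 -> gcar L2) (f' : gcar L2 -> gcar L1).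
Variables (lam gam : G -> F) (mu : Gb -> Gb -> F).
Hypotheses (sK : cancel s pi) (fI : graded_iso f f').
Hypotheses (lam_neq0 : forall h, pi h = 0 -> lam h != 0) (gam_neq0 : forall g, gam g != 0).
Hypothesis f_shift : forall h x, pi h = 0 ->
  f (loop_lift h id x) = lam h *: loop_lift h id (f x).
Hypothesis gam_shift : forall h g, pi h = 0 -> t1 h g * gam (h + g) = lam h * gam g * t2 h g.
Hypothesis gam_mul : forall g h,
  t1 g h * gam (g + h) = mu (pi g) (pi h) * (gam g * gam h * t2 g h).

Let f_lin : linear f := iso_linear fI.

Let E (g : G) (v : gcar A1) : gcar A2 := (gam g)^-1 *: loop_at (f (loop_in g v)) g.

Let E_linear g : linear (E g).
Proof. exact/linear_scale/(linear_comp (loop_at_linear g))/(linear_comp f_lin)/loop_in_linear. Qed.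

Let E_comp g v : E g v \in gcomp A2 (pi g).
Proof. exact/(subspaceZ (comp_subspace gA2 _))/loop_at_comp. Qed.

Let f_loop_in g v : f (loop_in g v) = gam g *: loop_in g (E g v).
Proof.
rewrite (linZ (loop_in_linear pi t2 gA2 g)) scalerA divff // scale1r loop_atK //.
exact/(iso_comp fI)/loop_in_comp.
Qed.

Let E_shift g g' v : pi g = pi g' -> v \in gcomp A1 (pi g) -> E g v = E g' v.
Proof.
move=> gg' vg; pose h := g' - g; have h0 : pi h = 0 by rewrite raddfB gg' subrr.
have hg : h + g = g' by rewrite subrK.
have := f_shift (loop_in g v) h0.
rewrite (loop_liftE t1 gA1 _ linear_id vg) (linZ f_lin) !f_loop_in.
rewrite (linZ (loop_lift_linear gA2 h linear_id)) (loop_liftE t2 gA2 _ linear_id (E_comp g v)).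
rewrite hg !scalerA -hg gam_shift // hg => e.
apply: (scale_loop_in_inj gA2) (esym e); rewrite ?mulf_neq0 ?lam_neq0 ?cocycle_neq0 //.
by rewrite -gg'.
Qed.

Let E_mul g h v w : v \in gcomp A1 (pi g) -> w \in gcomp A1 (pi h) ->
  mu (pi g) (pi h) *: E (g + h) (gmul A1 v w) = gmul A2 (E g v) (E h w).
Proof.
move=> vg wh; have e := iso_mul fI (loop_in g v) (loop_in h w).
rewrite loop_in_mull // (linZ f_lin) !f_loop_in (gmulZl gL2) (gmulZr gL2) loop_in_mull // in e.
rewrite !scalerA gam_mul [mu _ _ * _]mulrC -[LHS]scalerA in e.
rewrite -(linZ (loop_in_linear pi t2 gA2 _)) in e.
apply: (scale_loop_in_inj gA2) e; first by rewrite !mulf_neq0 ?cocycle_neq0.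
  exact: (subspaceZ (comp_subspace gA2 _)).
by rewrite raddfD; apply: comp_mul.
Qed.

Lemma twist_giso_of_tloop : giso (twist A1 mu) A2.
Proof.
have gT := twist_galg gA1 mu; have [_ _ f'K _ fA f'A] := fI.
apply: (@giso_intro F Gb (twist A1 mu) A2 (fun a => E (s a)) gT gA2) =>
  [a|a v _|a v va v0|a w wa|a b v w va wb].
- exact: E_linear.
- by rewrite -{2}(sK a); apply: E_comp.
- rewrite -[a]sK in va; apply: (loop_in_eq0 gA1 (t := t1) va); apply: (can_inj (iso_can fI)).
  by rewrite f_loop_in v0 (lin0 (loop_in_linear _ _ gA2 _)) scaler0 (lin0 f_lin).
- rewrite -[a]sK in wa; have wL := loop_in_comp pi t2 gA2 (s a) w.
  exists (gam (s a) *: loop_at (f' (loop_in (s a) w)) (s a)).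
    apply: (subspaceZ (comp_subspace gA1 a)); rewrite -[X in gcomp A1 X]sK.
    exact: loop_at_comp.
  rewrite /E (linZ (loop_in_linear _ _ gA1 _)) (linZ f_lin) loop_atK ?f'A // f'K.
  by rewrite (linZ (loop_at_linear _)) loop_inK // scalerA mulVf // scale1r.
rewrite (twist_mulH gA1 mu va wb) (linZ (E_linear _)) -E_mul ?sK //; congr (_ *: _).
by apply: E_shift; rewrite ?raddfD ?sK //; apply: comp_mul.
Qed.
End Descent.
End LoopIsomorphism.

Lemma tloop_giso_twist (F : fieldType) (G Gb : zmodType) (pi : {additive G -> Gb}) (s : Gb -> G)
    (A1 A2 : galg F Gb) (t1 t2 : G -> G -> F) :
  cancel s pi -> is_galg A1 -> is_galg A2 -> central_simple A2 ->
  sym2cocycle t1 -> sym2cocycle t2 -> giso (tloop pi A1 t1) (tloop pi A2 t2) ->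
  exists mu : Gb -> Gb -> F,
    [/\ sym2cocycle mu, cohomologous t1 (fun a b => mu (pi a) (pi b) * t2 a b) &
        giso (twist A1 mu) A2].
Proof.
move=> sK gA1 gA2 csA2 t1C t2C /gisoP[f [f' fI]].
have gL2 := tloop_galg pi t2 gA2; have gcsL2 := tloop_graded_central_simple sK gA2 t2C csA2.
have t2_neq0 := cocycle_neq0 t2C.
have [lam [lam0 lamE lamM]] := twisted_kernel_action_ratio gL2 gcsL2 t1C t2C
  (iso_twisted_kernel_action fI (loop_shift_action pi gA1 t1C)) (loop_shift_action pi gA2 t2C).
have tC := cocycle_div t1C t2C.
have [|gam gam0 gamS] := kernel_trivialization_extension sK tC lam0.
  by move=> h k h0 k0; rewrite mulrAC lamM // mulrAC mulfV ?mul1r // t2_neq0.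
have tgamC : sym2cocycle (fun a b => t1 a b / t2 a b / (gam a * gam b / gam (a + b))).
  exact: (cocycle_div tC (coboundary_cocycle gam0)).
have [|mu muC muE] := cocycle_deflation sK tgamC.
  move=> h g h0; have gam_h := gamS h 0 h0; rewrite addr0 (cocycle0r tC) in gam_h.
  have lam_h : lam h = t1 0 0 / t2 0 0 * gam h / gam 0 by rewrite gam_h mulfK.
  transitivity (t1 h g / t2 h g * gam (h + g) / (gam h * gam g)).
    by field; rewrite !gam0 t2_neq0.
  by rewrite gamS // lam_h addr0; field; rewrite !gam0 t2_neq0.
exists mu; split=> //.
  by exists gam; split=> // a b; rewrite -muE; field; rewrite !gam0 t2_neq0.
apply: (twist_giso_of_tloop gA1 gA2 t2C sK fI lam0 gam0) => [h x h0|h g h0|g h].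
- by rewrite -lamE //= (iso_can fI).
- by rewrite -gamS //; field; rewrite t2_neq0.
- by rewrite -muE; field; rewrite !gam0 t2_neq0.
Qed.

Lemma tloop_giso_subgrp (F : fieldType) (G : zmodType) (H1 H2 : subgrp G)
    (A1 : galg F (quot H1)) (A2 : galg F (quot H2)) (t1 t2 : G -> G -> F) :
  is_galg A1 -> central_simple A1 -> is_galg A2 -> central_simple A2 ->
  sym2cocycle t1 -> sym2cocycle t2 ->
  giso (tloop (qproj H1) A1 t1) (tloop (qproj H2) A2 t2) -> sg_pred H1 =i sg_pred H2.
Proof.
move=> gA1 csA1 gA2 csA2 t1C t2C /gisoP[f [f' fI]] k.
have in1 := tloop_centroid_support (@qproj_val G H1) gA1 t1C csA1 k.
have in2 := tloop_centroid_support (@qproj_val G H2) gA2 t2C csA2 k.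
rewrite -!qproj_eq0; apply/eqP/eqP => [/in1|/in2] k_supp.
  exact/in2/(iso_centroid_support fI).
exact/in1/(iso_centroid_support (graded_iso_sym fI)).
Qed.

Theorem theorem5p2 (F : fieldType) (G : zmodType) :
  (* (1) *)
  (forall B : galg F G, is_galg B -> graded_central_simple B ->
     exists (H : subgrp G) (A : galg F (quot H)) (t : G -> G -> F),
       is_galg A /\ central_simple A /\ sym2cocycle t /\
       giso B (tloop (qproj H) A t))
  /\
  (* (2) *)
  (forall (H : subgrp G) (A : galg F (quot H)) (t : G -> G -> F),
     is_galg A -> central_simple A -> sym2cocycle t ->
     graded_central_simple (tloop (qproj H) A t) /\
     giso (centroid_alg (tloop (qproj H) A t)) (tgrpalg H (restr H t)))
  /\
  (* (3), "only if" part concerning the subgroups: H1 = H2 *)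
  (forall (H1 H2 : subgrp G) (A1 : galg F (quot H1)) (A2 : galg F (quot H2))
          (t1 t2 : G -> G -> F),
     is_galg A1 -> central_simple A1 -> is_galg A2 -> central_simple A2 ->
     sym2cocycle t1 -> sym2cocycle t2 ->
     giso (tloop (qproj H1) A1 t1) (tloop (qproj H2) A2 t2) ->
     sg_pred H1 =i sg_pred H2)
  /\
  (* (3), for H1 = H2 = H *)
  (forall (H : subgrp G) (A1 A2 : galg F (quot H)) (t1 t2 : G -> G -> F),
     is_galg A1 -> central_simple A1 -> is_galg A2 -> central_simple A2 ->
     sym2cocycle t1 -> sym2cocycle t2 ->
     (giso (tloop (qproj H) A1 t1) (tloop (qproj H) A2 t2) <->
      exists mu : quot H -> quot H -> F,
        sym2cocycle mu /\
        cohomologous t1 (fun a b => mu (qproj H a) (qproj H b) * t2 a b) /\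
        giso (twist A1 mu) A2)).
Proof.
split; first exact: graded_central_simple_loop.
split=> [H A t gA csA tC|].
  have gL := tloop_galg (qproj H) t gA; have sK := @qproj_val G H.
  have gcsL := tloop_graded_central_simple sK gA tC csA; split=> //.
  apply: (centroid_alg_grpalg gL gcsL tC (loop_shift_action (qproj H) gA tC)) => k.
  by move=> /(tloop_centroid_support sK gA tC csA)/eqP; rewrite qproj_eq0.
split=> [|H A1 A2 t1 t2 gA1 _ gA2 csA2 t1C t2C]; first exact: tloop_giso_subgrp.
split=> [/(tloop_giso_twist (@qproj_val G H) gA1 gA2 csA2 t1C t2C)[mu [muC coh iso]]|].
  by exists mu.
by move=> [mu [_ [coh iso]]]; apply: (tloop_giso_of_twist gA1 gA2 t2C coh iso).
Qed.
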